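(* Let $(\mu,\nu,\lambda)$ and $(\tilde\mu,\tilde\nu,\tilde\lambda)$ be two triples of partitions related by a one-box pivot about $p$ with common hook $h$; that is, exactly one of the three partitions is changed, by a single-box move with pivot box $p$ and shared $\alpha$-hook length $h$, while the other two partitions are equal in both triples. Then the shifted Jack Littlewood--Richardson coefficients satisfy $$g^{\lambda}_{\mu\nu}\equiv g^{\tilde\lambda}_{\tilde\mu\tilde\nu}\pmod h,$$ i.e. $g^{\lambda}_{\mu\nu}-g^{\tilde\lambda}_{\tilde\mu\tilde\nu}\in h\,\mathbb{Q}[\alpha^{\pm1}]$.
   Context: Let $\alpha$ be an indeterminate. Rows and columns of partitions are indexed from $1$; partitions are padded with zeros. Single-box move (pivot): two partitions $\sigma,\tilde\sigma$ of the same size are related by a pivot, $\sigma\sim_p\tilde\sigma$, if $\tilde\sigma$ is a partition obtained from $\sigma$ by removing one box from the end of a row $i$ and adding one box to the end of a row $k>i$, i.e. $\tilde\sigma_i=\sigma_i-1$, $\tilde\sigma_k=\sigma_k+1$, all other parts being equal. (It suffices to consider moves to a strictly lower row, as the congruence is symmetric.) The pivot box is $p=(i,\sigma_k+1)$. The shared hook is $$h=h_\sigma(p)=h'_{\tilde\sigma}(p)=\alpha(\sigma_i-\sigma_k-1)+(k-i).$$ Hooks: for a box $s=(i,j)$ of a partition $\lambda$ (with conjugate $\lambda'$), $\mathrm{arm}_\lambda(s)=\lambda_i-j$, $\mathrm{leg}_\lambda(s)=\lambda'_j-i$, $h_\lambda(s)=\alpha\,\mathrm{arm}_\lambda(s)+\mathrm{leg}_\lambda(s)+1$,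 $h'_\lambda(s)=\alpha(\mathrm{arm}_\lambda(s)+1)+\mathrm{leg}_\lambda(s)$, $H_\lambda=\prod_{s\in\lambda}h_\lambda(s)$, $H'_\lambda=\prod_{s\in\lambda}h'_\lambda(s)$. Shifted symmetric functions: the ring $\Lambda^*_{(\alpha)}$ of $\alpha$-shifted symmetric functions over $\mathbb{Q}(\alpha)$ consists of sequences $(f_N(x_1,\dots,x_N))_{N\ge1}$ of polynomials over $\mathbb{Q}(\alpha)$, of bounded degree, with $f_N$ symmetric in the variables $z_i=\alpha x_i-i$ and $f_{N+1}(x_1,\dots,x_N,0)=f_N(x_1,\dots,x_N)$. For a partition $\lambda$, $f(\lambda)=f_N(\lambda_1,\dots,\lambda_N)$ for any $N\ge\ell(\lambda)$. Shifted Jack functions: for each partition $\mu$, $J^{\#}_\mu\in\Lambda^*_{(\alpha)}$ is the unique $\alpha$-shifted symmetric function of degree at most $|\mu|$ such that $J^{\#}_\mu(\mu)=\alpha^{-|\mu|}H_\mu H'_\mu$ and $J^{\#}_\mu(\lambda)=0$ for all $\lambda\neq\mu$ with $|\lambda|\le|\mu|$. These form a $\mathbb{Q}(\alpha)$-basis of $\Lambda^*_{(\alpha)}$. Shifted Jack Littlewood--Richardson coefficients: $d^\lambda_{\mu\nu}\in\mathbb{Q}(\alpha)$ are defined by $J^{\#}_\mu J^{\#}_\nu=\sum_{|\lambda|\le|\mu|+|\nu|}d^\lambda_{\mu\nu}J^{\#}_\lambda$ (and $d^\lambda_{\mu\nu}=0$ for $|\lambda|>|\mu|+|\nu|$), and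 $g^\lambda_{\mu\nu}:=H_\lambda H'_\lambda\,d^\lambda_{\mu\nu}$. It is known (Alexandersson--F\'eray) that $g^\lambda_{\mu\nu}\in\mathbb{Q}[\alpha^{\pm1}]$. *)

(* Defs.v *)
From HB Require Import structures.
From mathcomp Require Import all_boot all_order all_algebra.
From mathcomp Require Import mpoly zify ring.

Set Implicit Arguments.
Unset Strict Implicit.
Unset Printing Implicit Defensive.

Import GRing.Theory.
Local Open Scope ring_scope.

(** * Partitions *)

(* Weakly decreasing sequences of positive parts: trailing zeros are excluded,
   so that Leibniz equality is equality of partitions and [size] is the length
   of the partition. *)
Definition is_part (s : seq nat) : bool := sorted geq s && (0%N \notin s).

Record intpart := IntPart { parts :> seq nat; partsP : is_part parts }.

HB.instance Definition _ := [isSub for parts].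
HB.instance Definition _ := [Countable of intpart by <:].

Implicit Types (lam mu nu sigma tau : intpart) (p : nat * nat).

(* Rows are numbered from 1; the value at i = 0 is meaningless and never
   used. *)
Definition part lam (i : nat) : nat := nth 0%N lam i.-1.

Definition weight lam : nat := sumn lam.

Definition conj_part lam (j : nat) : nat := count (fun m => j <= m)%N lam.

Definition parts_le (n : nat) : seq intpart :=
  [seq lam <- undup (pmap insub
      [seq [seq m <- [seq val x | x <- t] | m != 0%N]
         | t : n.-tuple 'I_n.+1])
   | (weight lam <= n)%N].

Lemma parts_le_uniq n : uniq (parts_le n).
Proof. by rewrite filter_uniq ?undup_uniq. Qed.

Lemma mem_parts_le n lam : (lam \in parts_le n) = (weight lam <= n)%N.
Proof.
rewrite mem_filter mem_undup andb_idr // => le_n.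
rewrite mem_pmap; apply/mapP; exists (val lam); last by rewrite valK.
have /andP[_ n0] := partsP lam.
have size_le : (size lam <= n)%N.
  apply: leq_trans le_n; rewrite /weight; elim: (parts lam) n0 => //= m s IHs.
  rewrite inE negb_or => /andP[m0 /IHs]; lia.
have part_le m : m \in (lam : seq nat) -> (m <= n)%N.
  move=> ms; apply: leq_trans le_n; rewrite /weight.
  elim: (parts lam) ms => //= a s IHs.
  rewrite inE => /orP[/eqP->|/IHs]; lia.
pose s := (lam : seq nat) ++ nseq (n - size lam) 0%N.
have size_s : size [seq (inord m : 'I_n.+1) | m <- s] == n.
  by rewrite size_map size_cat size_nseq subnKC.
apply/mapP; exists (Tuple size_s).
  by rewrite mem_enum.
rewrite /= -map_comp (@eq_in_map _ _ _ id _).1 => [|m].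
  rewrite map_id filter_cat; set z := filter _ (nseq _ _).
  have -> : z = [::] by rewrite /z; elim: (n - _)%N.
  rewrite cats0; apply/esym/all_filterP/allP => m ms.
  by apply: contraNneq n0 => <-.
rewrite mem_cat => /orP[/part_le le_m|/nseqP[-> _]] /=; by rewrite inordK.
Qed.

(** * The base field, its Laurent subring, and the hook polynomials *)

Definition Qalpha := {fraction {poly rat}}.

Definition alpha : Qalpha := @tofrac {poly rat} 'X.

Definition laurent (x : Qalpha) : Prop :=
  exists (q : {poly rat}) (n : nat), x = @tofrac {poly rat} q / alpha ^+ n.

(* The hooks are only used at boxes p of lam, where no natural subtraction
   truncates. *)
Definition arm lam p : nat := (part lam p.1 - p.2)%N.
Definition leg lam p : nat := (conj_part lam p.2 - p.1)%N.

Definition hook lam p : Qalpha := alpha * (arm lam p)%:R + (leg lam p)%:R + 1.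
Definition hook' lam p : Qalpha := alpha * ((arm lam p)%:R + 1) + (leg lam p)%:R.

Definition Hprod lam : Qalpha :=
  \prod_(1 <= i < (size lam).+1) \prod_(1 <= j < (part lam i).+1) hook lam (i, j).
Definition Hprod' lam : Qalpha :=
  \prod_(1 <= i < (size lam).+1) \prod_(1 <= j < (part lam i).+1) hook' lam (i, j).

(** * Shifted symmetric functions *)

(* The component [f n] is the polynomial in N = n + 1 variables, and the
   variable ['X_i], with i : 'I_n.+1, is the one numbered i + 1. *)
Definition poly_family := forall n : nat, {mpoly Qalpha[n.+1]}.

Implicit Types (f : poly_family).

Definition degree_le f (d : nat) : Prop := forall n, (msize (f n) <= d.+1)%N.

Definition shifted_vars n : n.+1.-tuple {mpoly Qalpha[n.+1]} :=
  [tuple alpha *: 'X_i - (i.+1)%:R | i < n.+1].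

Definition symmetric_in_shifted_vars f : Prop :=
  forall n, exists2 g : {mpoly Qalpha[n.+1]},
    g \is symmetric & f n = g \mPo shifted_vars n.

Definition last_var_zero n : n.+2.-tuple {mpoly Qalpha[n.+1]} :=
  [tuple if unlift ord_max i is Some j then 'X_j else 0 | i < n.+2].

Definition stable f : Prop := forall n, f n.+1 \mPo last_var_zero n = f n.

Definition shifted_symmetric f : Prop :=
  [/\ exists d, degree_le f d, symmetric_in_shifted_vars f & stable f].

Definition eval_at f n lam : Qalpha :=
  (f n).@[fun i : 'I_n.+1 => (part lam i.+1)%:R].

(* The value at lam, computed with one variable more than there are rows; by
   [shifted_evalE] any sufficient number of variables gives the same value. *)
Definition shifted_eval f lam : Qalpha := eval_at f (size lam) lam.

Lemma shifted_evalE f lam n :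
  stable f -> (size lam <= n.+1)%N -> eval_at f n lam = shifted_eval f lam.
Proof.
move=> fS.
have step m : (size lam <= m.+1)%N -> eval_at f m lam = eval_at f m.+1 lam.
  move=> le_m; rewrite {1}/eval_at -fS comp_mpoly_meval; apply: meval_eq => i.
  rewrite tnth_mktuple; case: unliftP => [j|] ->; last first.
    by rewrite meval0 /part nth_default.
  by rewrite mevalXU lift_max.
have climb m k : (size lam <= m.+1)%N -> eval_at f m lam = eval_at f (m + k) lam.
  move=> le_m; elim: k => [|k ->]; first by rewrite addn0.
  rewrite addnS; apply: step; lia.
move=> le_n; rewrite /shifted_eval (climb n (size lam)) // addnC -climb //.
Qed.

(** * Shifted Jack functions and their structure coefficients *)

Definition is_shifted_jack mu f : Prop :=
  [/\ shifted_symmetric f,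
      degree_le f (weight mu),
      shifted_eval f mu = alpha ^- weight mu * Hprod mu * Hprod' mu &
      forall lam, lam != mu -> (weight lam <= weight mu)%N ->
        shifted_eval f lam = 0].

(* [d mu nu lam] is the coefficient usually written with lam as the upper index
   and mu, nu as the lower ones. *)
Definition is_jack_LR (J : intpart -> poly_family)
    (d : intpart -> intpart -> intpart -> Qalpha) : Prop :=
  forall mu nu,
    (forall n, J mu n * J nu n =
       \sum_(lam <- parts_le (weight mu + weight nu)) d mu nu lam *: J lam n) /\
    (forall lam, (weight mu + weight nu < weight lam)%N -> d mu nu lam = 0).

Definition jack_g (d : intpart -> intpart -> intpart -> Qalpha) mu nu lam :
    Qalpha :=
  Hprod lam * Hprod' lam * d mu nu lam.

(** * Pivots *)

Definition box_move (i k : nat) sigma tau : Prop :=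
  [/\ (0 < i < k)%N,
      part sigma i = (part tau i).+1,
      part tau k = (part sigma k).+1 &
      forall j, (0 < j)%N -> j != i -> j != k -> part tau j = part sigma j].

Definition pivot p (h : Qalpha) sigma tau : Prop :=
  exists i k, [/\ box_move i k sigma tau,
                  p = (i, (part sigma k).+1) & h = hook sigma p].

Definition pivot_triple p (h : Qalpha) (t t' : intpart * intpart * intpart) :
    Prop :=
  let: (mu, nu, lam) := t in
  let: (mu', nu', lam') := t' in
  [\/ [/\ pivot p h mu mu', nu = nu' & lam = lam'],
      [/\ mu = mu', pivot p h nu nu' & lam = lam'] |
      [/\ mu = mu', nu = nu' & pivot p h lam lam']].

Lemma part_leq lam i j : (0 < i <= j)%N -> (part lam j <= part lam i)%N.
Proof.
move=> /andP[i0 ij]; rewrite /part.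
have [le_s|lt_s] := leqP (size lam) j.-1; first by rewrite nth_default.
have /andP[srt _] := partsP lam.
have tr : transitive geq by move=> a b c /= ba ac; apply: leq_trans ac ba.
have := sorted_leq_nth tr leqnn 0%N srt; apply; rewrite ?inE; lia.
Qed.

(* [conj_part lam j] is the number k - 1 as soon as j fits in row k - 1 but not
   in row k. *)
Lemma conj_partE lam j k : (0 < j)%N -> (0 < k)%N ->
  (part lam k < j)%N -> (k = 1%N \/ j <= part lam k.-1)%N ->
  conj_part lam j = k.-1.
Proof.
move=> j0 k0 lt_j le_j.
have le_size : (k.-1 <= size lam)%N.
  case: le_j => [->//|]; rewrite leqNgt => le_j; apply/negP => lt.
  by move: le_j; rewrite /part nth_default; lia.
rewrite /conj_part -(cat_take_drop k.-1 lam) count_cat.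
have -> : count (fun m => j <= m)%N (take k.-1 lam) = k.-1.
  rewrite -[RHS](size_takel le_size); apply/eqP; rewrite -all_count.
  apply/(all_nthP 0%N) => i; rewrite size_takel // => lt_i; rewrite nth_take //.
  case: le_j => [?|le_j]; first by lia.
  by apply: leq_trans le_j _; apply: (@part_leq lam i.+1 k.-1); lia.
rewrite [X in (_ + X)%N](_ : _ = 0%N) ?addn0 //.
apply/eqP; rewrite -leqn0 leqNgt -has_count; apply/(has_nthP 0%N) => -[i lt_i].
rewrite nth_drop => le_i; have := @part_leq lam k (k.-1 + i).+1.
by rewrite /part /= in lt_j *; lia.
Qed.

(* The hook carried by a pivot is the hook shared by both partitions. *)
Lemma pivot_hookE i k sigma tau : box_move i k sigma tau ->
  let p := (i, (part sigma k).+1) in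
  let h := alpha * ((part sigma i)%:R - (part sigma k)%:R - 1)
           + (k%:R - i%:R) in
  hook sigma p = h /\ hook' tau p = h.
Proof.
move=> [/andP[i0 ik] si tk eqj] p h.
have le_tau : (part tau k <= part tau i)%N by apply: part_leq; lia.
have conj_s : conj_part sigma (part sigma k).+1 = k.-1.
  apply: conj_partE => //; [lia | right].
  have [<-|ne] := eqVneq i k.-1; first by lia.
  rewrite -(eqj k.-1); [|lia..]; rewrite -tk; apply: part_leq; lia.
have conj_t : conj_part tau (part sigma k).+1 = k.
  rewrite (@conj_partE tau _ k.+1) //=; last by right; rewrite tk.
  rewrite (eqj k.+1); [|lia..]; rewrite ltnS; apply: part_leq; lia.
rewrite /hook /hook' /arm /leg /= conj_s conj_t /h; split.
- rewrite natrB; last by lia.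
  rewrite natrB; last by lia.
  rewrite -[in RHS](prednK (leq_trans i0 (ltnW ik))) -!natr1; ring.
- rewrite natrB; last by lia.
  rewrite natrB; last by lia.
  rewrite si -!natr1; ring.
Qed.

(* Main.v *)
Require Import Defs.
From mathcomp Require Import all_boot all_order all_algebra.
From mathcomp Require Import mpoly zify ring.

(* Idea. Let R be the ring of Laurent polynomials and call a shifted symmetric
   function integral if it is an R-polynomial in the power sums of the
   z_i = alpha x_i - i. A pivot preserves the z_i modulo h up to permutation, so
   integral functions take congruent values at the two partitions.

   The J_mu are eigenfunctions, of eigenvalue |mu|, of the difference operator
   E f(x) = sum_i w_i(x) (f(x) - f(x - e_i)), where w_i(x) is
   (z_i + N)/alpha times the product over j <> i of (z_i - z_j - 1)/(z_i - z_j),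
   and E preserves integrality. Hence the products of the E - j extract from f the
   coefficient of J_lam times its norm as the value at lam of an integral function.
   This settles pivots of lam once J_mu is integral.

   For mu, more is true: if t is a measure on the partitions of n that takes
   integral functions to R, then the sum of the t_kap J_kap is integral. Applied to
   the Dirac measure at mu it says that J_mu is integral, and applied to
   (delta_mu - delta_mu~)/h it says that J_mu and J_mu~ are congruent modulo h. The
   proof is by induction on n. With u_i the Jack transition measure, the operators
   sum_i u_i f(x + e_i) - f and sum_i u_i (z_i + 1) f(x + e_i) lower the degree and
   are adjoint to integral operators by the hook formula for the norms; their
   symbols, alpha d/dp_1 and alpha sum_k k p_{k-1} d/dp_k (k >= 2), suffice to detect
   integrality of the leading term. *)

Set Implicit Arguments.
Unset Strict Implicit.
Unset Printing Implicit Defensive.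

Import GRing.Theory.
Local Open Scope ring_scope.

(** * Quotients of products and their power sums *)

Section Newton.
Variable F : fieldType.

(** The values J_kap(lam) form a triangular system whose diagonal entries, the norms, are in general
    not units of R, so solving it would lose integrality. No norm is therefore inverted.
    Coefficients are extracted at the price of dividing by n! only, a unit because R contains the
    rationals, and the norms enter the integrality proof through ratios for partitions that differ
    by one box, where they compare u_i with w_i.

    The induction has to run over measures: the masses of (delta_mu - delta_mu~)/h are not in R,
    only its pairings with integral functions are, and this is the condition that transposed
    lowering operators preserve.

    Two operators are needed because alpha d/dp_1 sees only partitions with a part 1; the other one
    lowers the parts that are at least 2. The scalars alpha and k in the symbols are units of R.

    The number N of variables is fixed, and functions are compared only on partitions with fewer
    than N parts. The power sums of all N shifted variables, empty rows included, are not stable in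
    N, but this does no harm; p_0 is the constant N. *)

Definition revprod (I : Type) (r : seq I) (P : pred I) (a : I -> F) : {poly F} :=
  \prod_(i <- r | P i) (1 - a i *: 'X).

Definition psum (I : Type) (r : seq I) (P : pred I) (a : I -> F) (k : nat) : F :=
  \sum_(i <- r | P i) a i ^+ k.

Lemma geom_poly (x : F) K :
  (1 - x *: 'X) * (\sum_(k < K) x ^+ k.+1 *: 'X^(k.+1)) =
  x *: 'X - x ^+ K.+1 *: 'X^(K.+1).
Proof.
elim: K => [|K IH]; first by rewrite big_ord0 mulr0 !expr1 subrr.
rewrite big_ord_recr /= mulrDr IH mulrBl mul1r -scalerAl -scalerAr scalerA.
by rewrite -!exprS addrA subrK.
Qed.

(** Newton's identities: - X A'/A is the generating series of the power sums. A congruence modulo a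
    power of X, cleared of denominators, stands for an identity of truncated power series. *)
Lemma revprod_deriv (I : Type) (r : seq I) (P : pred I) (a : I -> F) K :
  'X^(K.+1) %| 'X * (revprod r P a)^`() +
    revprod r P a * \sum_(k < K) psum r P a k.+1 *: 'X^(k.+1).
Proof.
rewrite /revprod /psum; elim: r => [|i r IH].
  rewrite big_nil derivC mulr0 add0r mul1r big1 ?dvdp0 // => k _.
  by rewrite big_nil scale0r.
have [Pi|nPi] := boolP (P i); last first.
  rewrite big_cons (negPf nPi) (eq_bigr (fun k : 'I_K =>
    (\sum_(i <- r | P i) a i ^+ k.+1) *: 'X^(k.+1))) //.
  by move=> k _; rewrite big_cons (negPf nPi).
rewrite big_cons Pi (eq_bigr (fun k : 'I_K => a i ^+ k.+1 *: 'X^(k.+1) +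
    (\sum_(i <- r | P i) a i ^+ k.+1) *: 'X^(k.+1))); last first.
  by move=> k _; rewrite big_cons Pi scalerDl.
rewrite big_split /= derivM derivB derivC sub0r derivZ derivX.
set A := \prod_(_ <- _ | _) _ in IH *.
set S := \sum_(_ < _) (\sum_(_ <- _ | _) _) *: _ in IH *.
have G := geom_poly (a i) K; set T := \sum_(_ < _) _ ^+ _ *: _ in G *.
have -> : 'X * (- (a i *: 1) * A + (1 - a i *: 'X) * A^`()) +
          (1 - a i *: 'X) * A * (T + S) =
          (1 - a i *: 'X) * ('X * A^`() + A * S) +
           A * ((1 - a i *: 'X) * T - a i *: 'X).
  by rewrite -!mul_polyC; ring.
rewrite G [X in _ + A * X](_ : _ = - (a i ^+ K.+1 *: 'X^(K.+1))); last by ring.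
rewrite dvdp_add ?dvdp_mull //.
by rewrite dvdpNr -mul_polyC dvdp_mull.
Qed.

Lemma revprod0 (I : Type) (r : seq I) (P : pred I) (a : I -> F) :
  (revprod r P a).[0] = 1.
Proof.
rewrite /revprod horner_prod big1 // => i _.
by rewrite !(hornerE, mulr0, oppr0, addr0).
Qed.

(* The logarithmic derivative turns a quotient of products into a recursion on
   its coefficients in terms of power sums. *)
Lemma newton_quotient (I J : Type) (r : seq I) (P : pred I) (a : I -> F)
    (r' : seq J) (P' : pred J) (b : J -> F) (g : {poly F}) K :
  'X^(K.+1) %| revprod r' P' b * g - revprod r P a ->
  forall k, (k <= K)%N ->
    k%:R * g`_k = \sum_(j < k) (psum r' P' b j.+1 - psum r P a j.+1) * g`_(k - j.+1).
Proof.
set A := revprod r P a; set B := revprod r' P' b => dvdg k le_k.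
have := revprod_deriv r P a K; have := revprod_deriv r' P' b K.
rewrite -/A -/B; set SB := \sum_(_ < _) _; set SA := \sum_(_ < _) _ => dB dA.
(* The congruence B g = A is differentiated and multiplied by X, which restores the lost power; X A'
   and X B' are then replaced by power sums. *)
have dvd1 : 'X^(K.+1) %| B * ('X * g^`() - g * (SB - SA)).
  have -> : B * ('X * g^`() - g * (SB - SA)) =
     'X * (B * g - A)^`() + ('X * A^`() + A * SA) - g * ('X * B^`() + B * SB)
     + SA * (B * g - A).
    by rewrite derivB derivM; ring.
  case/dvdpP: (dvdg) => e ->.
  rewrite dvdp_add ?dvdp_mull // dvdp_sub ?dvdp_mull // dvdp_add //.
  rewrite derivM derivXn -mulr_natr /= exprS (_ : 'X * _ = ('X * e^`() + e * K.+1%:R) * ('X * 'X^K)).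
    exact: dvdp_mulIr.
  by ring.
have cop : coprimep 'X^(K.+1) B.
  rewrite coprimep_expl // coprimep_sym.
  by have := coprimep_XsubC B 0; rewrite subr0 => ->; rewrite /root revprod0 oner_eq0.
rewrite Gauss_dvdpr // in dvd1; case/dvdpP: dvd1 => e /(congr1 (fun p : {poly F} => p`_k)).
rewrite coefMXn ltnS le_k coefB coefXM coef_deriv.
move/eqP; rewrite subr_eq0 => /eqP E.
have {E} -> : k%:R * g`_k = (g * (SB - SA))`_k.
  by rewrite -E; case: k {le_k E} => [|k] /=; rewrite ?mul0r // mulr_natl.
have coefS j : (j <= K)%N -> (SB - SA)`_j =
    if j is i.+1 then psum r' P' b i.+1 - psum r P a i.+1 else 0.
  move=> le_j; rewrite coefB !coef_sum; case: j le_j => [|j] le_j.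
    by rewrite !big1 ?subrr // => i _; rewrite coefZ coefXn mulr0.
  have dl (u : nat -> F) : \sum_(i < K) (u i *: 'X^(i.+1))`_j.+1 = u j.
    rewrite (bigD1 (Ordinal le_j)) //= coefZ coefXn eqxx mulr1 big1 ?addr0 //.
    move=> i ne; rewrite coefZ coefXn; case: eqP => [[e1]|]; last by rewrite mulr0.
    by case/eqP: ne; apply: val_inj; rewrite /= e1.
  by rewrite (dl (fun i => psum r' P' b i.+1)) (dl (fun i => psum r P a i.+1)).
rewrite mulrC coefM big_ord_recl coefS // mul0r add0r.
by apply: eq_bigr => i _; rewrite coefS //= /bump /=; have := ltn_ord i; lia.
Qed.

(** * Coefficients of rational functions as moments of partial fractions *)

Section Moments.
Variables (n : nat) (b : 'I_n -> F).
Hypotheses (b_inj : injective b) (b_neq0 : forall i, b i != 0).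

Let B := revprod (index_enum 'I_n) xpredT b.
Let Bi (i : 'I_n) := revprod (index_enum 'I_n) (fun j => j != i) b.

Lemma size_revprod (P : pred 'I_n) (a : 'I_n -> F) :
  (size (revprod (index_enum 'I_n) P a) <= #|P|.+1)%N.
Proof.
rewrite /revprod; apply: leq_trans (size_poly_prod_leq _ _) _.
rewrite leq_subLR; have : (\sum_(i | P i) size (1 - a i *: 'X)%R <= \sum_(i | P i) 2)%N.
  apply: leq_sum => i _; rewrite (leq_trans (size_polyD _ _)) //.
  rewrite geq_max size_poly1 size_polyN /=.
  by rewrite (leq_trans (size_scale_leq _ _)) ?size_polyX.
rewrite sum_nat_const => H; rewrite addnS ltnS (leq_trans H) //.
by rewrite muln2 addnn.
Qed.

Lemma revprod_horner (P : pred 'I_n) (a : 'I_n -> F) (x : F) : x != 0 ->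
  (revprod (index_enum 'I_n) P a).[x^-1] =
   \prod_(j | P j) (x - a j) / x ^+ #|P|.
Proof.
move=> x0; rewrite /revprod horner_prod -prodr_const -prodf_div.
by apply: eq_bigr => j _; rewrite !hornerE mulrBl divff.
Qed.

(** Interpolation at the n points 1 / b_i: [Bi i] vanishes at every node except its own. *)
Lemma lagrange_rev (A : {poly F}) : (size A <= n)%N ->
  A = \sum_i (A.[(b i)^-1] / (Bi i).[(b i)^-1]) *: Bi i.
Proof.
move=> sA; apply/eqP; rewrite -subr_eq0; apply/eqP.
have Bz i : (Bi i).[(b i)^-1] != 0.
  rewrite revprod_horner // mulf_neq0 ?invr_eq0 ?expf_neq0 //.
  apply/prodf_neq0 => j ne; rewrite subr_eq0; apply: contra ne => /eqP e.
  by rewrite (b_inj e).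
have Bz' i j : i != j -> (Bi i).[(b j)^-1] = 0.
  move=> ne; rewrite revprod_horner // (bigD1 j) 1?eq_sym //=.
  by rewrite subrr !mul0r.
apply: (@roots_geq_poly_eq0 F _ [seq (b i)^-1 | i <- enum 'I_n]).
- apply/allP => x /mapP [i _ ->]; rewrite /root hornerD hornerN horner_sum.
  rewrite (bigD1 i) //= big1 ?addr0; last first.
    by move=> j ne; rewrite hornerZ (Bz' j i ne) mulr0.
  by rewrite hornerZ divfK // subrr.
- by rewrite map_inj_uniq ?enum_uniq // => i j /invr_inj /b_inj.
- rewrite size_map size_enum_ord (leq_trans (size_polyD _ _)) // geq_max sA /=.
  rewrite size_polyN (leq_trans (size_sum _ _ _)) //; apply/bigmax_leqP => i _.
  rewrite (leq_trans (size_scale_leq _ _)) // (leq_trans (size_revprod _ _)) //.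
  have := cardC1 i; rewrite card_ord => ->; have := ltn_ord i; lia.
Qed.

(** A / B is a sum of terms u_i / (1 - b_i X), each of which expands as a geometric series. *)
Lemma partial_fractions (A : {poly F}) K : (size A <= n)%N ->
  'X^K %| B * (\poly_(k < K) \sum_i A.[(b i)^-1] / (Bi i).[(b i)^-1] * b i ^+ k) - A.
Proof.
move=> sA; rewrite {2}(lagrange_rev sA).
pose u i := A.[(b i)^-1] / (Bi i).[(b i)^-1].
rewrite poly_def -/u.
under eq_bigr => k _ do rewrite scaler_suml.
rewrite exchange_big /= mulr_sumr -sumrB; apply: (big_ind (fun p => 'X^K %| p)) => [|p q|i _].
- exact: dvdp0.
- exact: dvdp_add.
have -> : B = Bi i * (1 - b i *: 'X).
  by rewrite /B /revprod (bigD1 i) //= mulrC.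
have -> : \sum_(k < K) (u i * b i ^+ k) *: 'X^k = u i *: \sum_(k < K) b i ^+ k *: 'X^k.
  by rewrite scaler_sumr; apply: eq_bigr => k _; rewrite scalerA.
have G : (1 - b i *: 'X) * (\sum_(k < K) b i ^+ k *: 'X^k) = 1 - b i ^+ K *: 'X^K.
  elim: K => [|K IH]; first by rewrite big_ord0 mulr0 !expr0 scale1r subrr.
  rewrite big_ord_recr /= mulrDr IH mulrBl mul1r -scalerAl -scalerAr scalerA.
  by rewrite -!exprS addrA subrK.
rewrite -scalerAr -mulrA G -!mul_polyC.
rewrite (_ : _ - _ = - (u i)%:P * Bi i * (b i ^+ K)%:P * 'X^K); last by rewrite -/(u i); ring.
exact: dvdp_mulIr.
Qed.

(** Numerator and denominator have equally many factors, so partial fractions apply only to C = (A -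
    B) / X. From A / B = 1 + X C / B come the separate value [g 0] and the shift of the index. *)
Lemma moments_equal (a : 'I_n -> F) (g : nat -> F) :
  g 0%N = 1 ->
  (forall k, g k.+1 = \sum_i \prod_j (b i - a j) / \prod_(j | j != i) (b i - b j) * b i ^+ k) ->
  forall k, k%:R * g k =
    \sum_(j < k) (\sum_i b i ^+ j.+1 - \sum_i a i ^+ j.+1) * g (k - j.+1)%N.
Proof.
move=> g0 gS k.
set A := revprod (index_enum 'I_n) xpredT a.
pose G := \poly_(j < k.+1) g j.
have [C defC] : exists C, A - B = C * 'X.
  have /factor_theorem [C] : root (A - B) 0 by rewrite /root !hornerE !revprod0 subrr.
  by rewrite subr0 => ->; exists C.
have sC : (size C <= n)%N.
  have [->|C0] := eqVneq C 0; first by rewrite size_poly0.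
  rewrite -ltnS -size_mulX // -defC (leq_trans (size_polyD _ _)) // geq_max size_polyN.
  have := size_revprod xpredT a; have := size_revprod xpredT b.
  by rewrite card_ord -/A -/B => -> ->.
have GE : G = 1 + 'X * \poly_(j < k) g j.+1.
  apply/polyP => j; rewrite coefD coefXM !coef_poly coef1.
  by case: j => [|j] /=; rewrite ?g0 ?addr0 ?add0r.
have dvdG : 'X^(k.+1) %| B * G - A.
  have := partial_fractions k sC; set S := \poly_(_ < _) _ => dS.
  have -> : B * G - A = 'X * (B * S - C).
    rewrite GE (_ : \poly_(j < k) g j.+1 = S); last first.
      apply/polyP => j; rewrite !coef_poly; case: ifP => // _; rewrite gS.
      apply: eq_bigr => i _; congr (_ * _).
      have -> : C.[(b i)^-1] = b i * A.[(b i)^-1].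
        have := congr1 (fun p : {poly F} => p.[(b i)^-1]) defC.
        rewrite !hornerE /B (revprod_horner xpredT b) // (bigD1 i) //= subrr !mul0r subr0.
        by move=> ->; rewrite mulrC mulfVK.
      rewrite !revprod_horner //.
      have -> : #|[pred j | j != i]| = n.-1 by have := cardC1 i; rewrite card_ord.
      have bi0 := b_neq0 i.
      have -> : b i ^+ #|xpredT : pred 'I_n| = b i * b i ^+ n.-1.
        by rewrite cardT size_enum_ord -exprS prednK //; have := ltn_ord i; lia.
      set pa := \prod_(_ | _) _; set pb := \prod_(_ | _) _.
      have [->|pb0] := eqVneq pb 0; first by rewrite mul0r !invr0 !mulr0.
      by field; rewrite pb0 bi0 expf_neq0.
    by rewrite mulrBr -[in RHS](mulrC C) -defC; ring.
  by rewrite exprS dvdp_mul2l ?polyX_eq0.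
have := newton_quotient dvdG (leqnn k); rewrite coef_poly ltnSn => ->.
apply: eq_bigr => j _; rewrite coef_poly ltnS leq_subr; by [].
Qed.

(** With one factor fewer the numerator already has degree below n, and no index shift occurs. *)
Lemma moments_less (i0 : 'I_n) (a : 'I_n -> F) (g : nat -> F) :
  (forall k, g k =
     \sum_i \prod_(j | j != i0) (b i - a j) / \prod_(j | j != i) (b i - b j) * b i ^+ k) ->
  g 0%N = 1 /\
  forall k, k%:R * g k =
    \sum_(j < k) (\sum_i b i ^+ j.+1 - \sum_(i | i != i0) a i ^+ j.+1) * g (k - j.+1)%N.
Proof.
move=> gE; set A := revprod (index_enum 'I_n) (fun j => j != i0) a.
have sA : (size A <= n)%N.
  rewrite (leq_trans (size_revprod _ _)) //.
  have := cardC1 i0; rewrite card_ord => ->; have := ltn_ord i0; lia.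
have dvdG k : 'X^(k.+1) %| B * (\poly_(j < k.+1) g j) - A.
  have := partial_fractions k.+1 sA.
  rewrite (_ : \poly_(_ < _) _ = \poly_(j < k.+1) g j) //.
  apply/polyP => j; rewrite !coef_poly; case: ifP => // _; rewrite gE.
  apply: eq_bigr => i _; congr (_ * _); rewrite !revprod_horner //.
  have -> : #|[pred j | j != i]| = n.-1 by have := cardC1 i; rewrite card_ord.
  have -> : #|[pred j | j != i0]| = n.-1 by have := cardC1 i0; rewrite card_ord.
  set pa := \prod_(_ | _) _; set pb := \prod_(_ | _) _.
  have := b_neq0 i => bi0; have [->|pb0] := eqVneq pb 0.
    by rewrite mul0r !invr0 !mulr0.
  by field; rewrite pb0 expf_neq0.
split.
  have := dvdG 0%N; case/dvdpP => q /(congr1 (fun p : {poly F} => p.[0])).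
  rewrite !hornerE /= !revprod0 mul1r horner_poly big_ord1 mulr1.
  by move/eqP; rewrite subr_eq0 => /eqP.
move=> k; have := newton_quotient (dvdG k) (leqnn k); rewrite coef_poly ltnSn => ->.
by apply: eq_bigr => j _; rewrite coef_poly ltnS leq_subr.
Qed.

End Moments.
End Newton.

(** * Adding and removing boxes *)

Implicit Types (lam mu : intpart).

Lemma geq_trans : transitive geq.
Proof. by move=> a b c /= ba ac; apply: leq_trans ac ba. Qed.

Lemma part_gt0 (lam : intpart) i : (0 < part lam i.+1)%N = (i < size lam)%N.
Proof.
rewrite /part /=; case: (ltnP i (size lam)) => [lt_i|le_i]; last by rewrite nth_default.
have /andP[_ n0] := partsP lam; rewrite lt0n; apply: contraNneq n0 => <-.
exact: mem_nth.
Qed.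

Lemma part_ext (lam mu : intpart) :
  (forall i, part lam i.+1 = part mu i.+1) -> lam = mu.
Proof.
move=> E; apply/val_inj; apply: (@eq_from_nth _ 0%N) => [|i _]; last exact: E.
have sE (i : nat) : (i < size lam)%N = (i < size mu)%N by rewrite -!part_gt0 E.
have := sE (size lam); have := sE (size mu); rewrite !ltnn => /negbT + /esym/negbT.
by rewrite -!leqNgt => *; apply/eqP; rewrite eqn_leq; apply/andP.
Qed.

Lemma part_ext_le N (lam mu : intpart) : (size lam <= N)%N -> (size mu <= N)%N ->
  (forall i, (i < N)%N -> part lam i.+1 = part mu i.+1) -> lam = mu.
Proof.
move=> sl sm E; apply: part_ext => i; have [/E //|le_i] := ltnP i N.
by rewrite /part !nth_default // ?(leq_trans sl) ?(leq_trans sm).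
Qed.

Lemma weight_part N (lam : intpart) : (size lam <= N)%N ->
  weight lam = (\sum_(i < N) part lam i.+1)%N.
Proof.
move=> sN; rewrite /weight sumnE (big_nth 0%N) big_mkord.
rewrite (big_ord_widen _ (fun i => nth 0%N lam i) sN).
rewrite big_mkcond; apply: eq_bigr => i _; case: ifP => // /negbT.
by rewrite -leqNgt => ?; rewrite /part nth_default.
Qed.

Lemma size_le_weight (lam : intpart) : (size lam <= weight lam)%N.
Proof.
rewrite (weight_part (leqnn _)) -[X in (X <= _)%N]card_ord -sum1_card.
by apply: leq_sum => i _; rewrite part_gt0.
Qed.

Lemma mkpart_subproof (s : seq nat) : is_part (sort geq [seq k <- s | k != 0%N]).
Proof.
rewrite /is_part sort_sorted; last by move=> a b; exact: leq_total.
by rewrite mem_sort mem_filter eqxx.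
Qed.

Definition mkpart (s : seq nat) : intpart := IntPart (mkpart_subproof s).

Lemma mkpart_perm (s t : seq nat) :
  perm_eq [seq k <- s | k != 0%N] [seq k <- t | k != 0%N] -> mkpart s = mkpart t.
Proof.
move=> st; apply/val_inj/(perm_sortP _ _ _ _ _) => //.
- by move=> a b; exact: leq_total.
- exact: geq_trans.
- by move=> a b; rewrite /= andbC; apply: anti_leq.
Qed.

Lemma filter_parts (lam : intpart) : [seq k <- parts lam | k != 0%N] = lam.
Proof.
have /andP[_ n0] := partsP lam; apply/all_filterP/allP => k kl.
by apply: contraNneq n0 => <-.
Qed.

Lemma mkpartK (lam : intpart) : mkpart lam = lam.
Proof.
apply/val_inj; rewrite /= filter_parts sorted_sort //; first exact: geq_trans.
by have /andP[] := partsP lam.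
Qed.

Lemma perm_mkpart (s : seq nat) : perm_eq (mkpart s) [seq k <- s | k != 0%N].
Proof. by rewrite /= perm_sort. Qed.

Lemma weight_mkpart (s : seq nat) : weight (mkpart s) = sumn s.
Proof.
rewrite /weight !sumnE (perm_big _ (perm_mkpart s)) /= big_filter [RHS]big_mkcond /=.
by rewrite big_mkcond; apply: eq_bigr => -[].
Qed.

Lemma nth_filter_sorted (s : seq nat) i : sorted geq s ->
  nth 0%N [seq k <- s | k != 0%N] i = nth 0%N s i.
Proof.
elim: s i => [|k s IH] i //= srt; case: k srt => [|k] srt /=; last first.
  by case: i => [|i] //=; apply: IH; apply: path_sorted srt.
have /allP s0 := order_path_min geq_trans srt.
have {}s0 : all (fun k => k == 0%N) s.
  by apply/allP => k /s0 /=; rewrite leqn0.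
rewrite (_ : filter _ _ = [::]); last first.
  by apply/eqP; rewrite -size_eq0 size_filter -leqn0 leqNgt -has_count -all_predC;
     apply: sub_all s0 => k /= ->.
rewrite nth_nil; case: i => [|i] //=; have [lt_i|le_i] := ltnP i (size s).
  by have /allP /(_ _ (mem_nth 0%N lt_i)) /eqP := s0.
by rewrite nth_default.
Qed.

Lemma part_mkpart (s : seq nat) i : sorted geq s -> part (mkpart s) i.+1 = nth 0%N s i.
Proof.
move=> srt; rewrite -nth_filter_sorted // /part /= sorted_sort //; first exact: geq_trans.
exact: (sorted_filter geq_trans).
Qed.

Lemma size_mkpart (s : seq nat) : (size (mkpart s) <= size s)%N.
Proof. by rewrite /= size_sort size_filter count_size. Qed.

Definition of_fun N (f : nat -> nat) : intpart := mkpart (mkseq f N).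

Lemma part_of_fun N f : (forall i, (i.+1 < N)%N -> (f i.+1 <= f i)%N) ->
  forall i, (i < N)%N -> part (of_fun N f) i.+1 = f i.
Proof.
move=> fP i lt_i; rewrite part_mkpart ?nth_mkseq //.
apply: (path.path_sorted (x := f 0%N)); rewrite -/(path _ _ _).
apply/(pathP 0%N) => j; rewrite size_mkseq => lt_j /=.
case: j lt_j => [|j] lt_j /=; first by rewrite nth_mkseq.
by rewrite !nth_mkseq ?(ltnW lt_j) // fP.
Qed.

Lemma size_of_fun N f : (size (of_fun N f) <= N)%N.
Proof. by rewrite (leq_trans (size_mkpart _)) // size_mkseq. Qed.

(** Since [mkpart] sorts, [inc] and [dec] return a partition for every row, but the intended one
    only if the row is addable, respectively removable. In the other rows the weights [ut] and [wt]
    vanish. *)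
Definition inc N (lam : intpart) (i : nat) : intpart :=
  of_fun N (fun j => part lam j.+1 + (j == i))%N.
Definition dec N (lam : intpart) (i : nat) : intpart :=
  of_fun N (fun j => part lam j.+1 - (j == i))%N.

Definition addable (lam : intpart) (i : nat) : bool :=
  (i == 0)%N || (part lam i.+1 < part lam i)%N.
Definition removable (lam : intpart) (i : nat) : bool :=
  (part lam i.+2 < part lam i.+1)%N.

Lemma part_inc N lam i j : addable lam i -> (j < N)%N ->
  part (inc N lam i) j.+1 = (part lam j.+1 + (j == i))%N.
Proof.
move=> ad lt_j; rewrite part_of_fun // => k lt_k.
have := @part_leq lam k.+1 k.+2; move: ad; rewrite /addable => /orP[/eqP->|]; first by lia.
by have [<-|] := eqVneq k.+1 i; lia.
Qed.

Lemma part_dec N lam i j : removable lam i -> (j < N)%N ->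
  part (dec N lam i) j.+1 = (part lam j.+1 - (j == i))%N.
Proof.
move=> ad lt_j; rewrite part_of_fun // => k lt_k.
have := @part_leq lam k.+1 k.+2; move: ad; rewrite /removable.
by have [->|] := eqVneq k i; lia.
Qed.

Lemma size_inc N lam i : (size (inc N lam i) <= N)%N.
Proof. exact: size_of_fun. Qed.

Lemma size_dec N lam i : (size (dec N lam i) <= N)%N.
Proof. exact: size_of_fun. Qed.

Lemma sum_eq_nat N i : (i < N)%N -> (\sum_(j < N) (j == i :> nat) = 1)%N.
Proof.
move=> lt_i; rewrite (bigD1 (Ordinal lt_i)) //= eqxx big1 // => j.
by rewrite -val_eqE /= => /negPf ->.
Qed.

Lemma weight_inc N lam i : (size lam <= N)%N -> (i < N)%N -> addable lam i ->
  weight (inc N lam i) = (weight lam).+1.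
Proof.
move=> sN lt_i ad; rewrite (weight_part (size_inc _ _ _)) (weight_part sN).
rewrite (eq_bigr (fun j : 'I_N => part lam j.+1 + (j == i :> nat))%N) => [|j _].
  by rewrite big_split /= sum_eq_nat ?addn1.
exact: part_inc.
Qed.

Lemma weight_dec N lam i : (size lam <= N)%N -> (i < N)%N -> removable lam i ->
  weight lam = (weight (dec N lam i)).+1.
Proof.
move=> sN lt_i ad; rewrite (weight_part (size_dec _ _ _)) (weight_part sN).
rewrite (eq_bigr (fun j : 'I_N => part (dec N lam i) j.+1 + (j == i :> nat))%N) => [|j _].
  by rewrite big_split /= sum_eq_nat ?addn1.
rewrite part_dec //; have [ji|_] := eqVneq (j : nat) i; last by rewrite subn0 addn0.
by rewrite ji; move: ad; rewrite /removable; lia.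
Qed.

Lemma size_dec_le N lam i : (size lam <= N)%N -> (i < N)%N -> removable lam i ->
  (size (dec N lam i) <= size lam)%N.
Proof.
move=> sN lt_i ad; rewrite leqNgt -part_gt0; have [lt|ge] := ltnP (size lam) N.
  by rewrite part_dec // [part lam _]nth_default.
by rewrite [part (dec _ _ _) _]nth_default ?(leq_trans (size_dec _ _ _)).
Qed.

Lemma addable_dec N lam i : (i < N)%N -> removable lam i -> addable (dec N lam i) i.
Proof.
move=> lt_i rm; rewrite /addable; case: i lt_i rm => //= i lt_i rm.
rewrite !part_dec //; [|lia]; have := @part_leq lam i.+1 i.+2.
by rewrite /removable in rm; lia.
Qed.

Lemma inc_dec N lam i : (size lam <= N)%N -> (i < N)%N -> removable lam i ->
  inc N (dec N lam i) i = lam.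
Proof.
move=> sN lt_i rm; apply: (part_ext_le (size_inc _ _ _) sN) => j lt_j.
rewrite part_inc ?addable_dec // part_dec //; have [->|_] := eqVneq j i; last by lia.
by rewrite /removable in rm; lia.
Qed.

Lemma removable_inc N lam i : (size lam < N)%N -> (i < N)%N -> addable lam i ->
  removable (inc N lam i) i.
Proof.
move=> sN lt_i ad; rewrite /removable [X in (_ < X)%N]part_inc // eqxx addn1 ltnS.
have [lt|le] := ltnP i.+1 N; last by rewrite [part _ _]nth_default ?(leq_trans (size_inc _ _ _)).
rewrite part_inc // (_ : _ == _ = false); last by lia.
by rewrite addn0; apply: part_leq; rewrite ltn0Sn leqW.
Qed.

Lemma dec_inc N lam i : (size lam < N)%N -> (i < N)%N -> addable lam i ->
  dec N (inc N lam i) i = lam.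
Proof.
move=> sN lt_i ad; apply: (part_ext_le (size_dec _ _ _) (ltnW sN)) => j lt_j.
by rewrite part_dec ?removable_inc // part_inc // addnK.
Qed.

(** * Functions of the shifted variables *)

Section Shifted.
Variables (F : fieldType) (al : F) (M : nat).
Notation N := M.+1.
Implicit Types (y : F).
(** This is how the indeterminate enters: the denominators met below are products of forms al a + b
    with integers a and b, not both zero. The case a = 0 gives characteristic zero. *)
Hypothesis al_free : forall a b : int, al * a%:~R + b%:~R = 0 -> a = 0 /\ b = 0.

Lemma lin_neq0 (a b : int) : (a != 0) || (b != 0) -> al * a%:~R + b%:~R != 0.
Proof. by move=> ab; apply/eqP => /al_free [a0 b0]; rewrite a0 b0 eqxx in ab. Qed.

Lemma natr_neq0 k : (0 < k)%N -> k%:R != 0 :> F.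
Proof.
move=> k0; have := @lin_neq0 0 k; rewrite mulr0 add0r -pmulrn; apply.
by apply/orP; right; case: k k0.
Qed.

Lemma al_neq0 : al != 0.
Proof. by have := @lin_neq0 1 0 isT; rewrite mulr1 addr0. Qed.

(* Rows are numbered from 0 from here on: [z lam i] is the shifted variable
   alpha * lam_{i+1} - (i+1). *)
Definition z (lam : intpart) (i : nat) : F := al * (part lam i.+1)%:R - i.+1%:R.

Lemma zB lam i j : z lam i - z lam j =
  al * ((part lam i.+1)%:Z - (part lam j.+1)%:Z)%:~R + (j%:Z - i%:Z)%:~R.
Proof. rewrite /z !rmorphB /= -!pmulrn -!natr1; ring. Qed.

Lemma z_inj lam i j : z lam i = z lam j -> i = j.
Proof.
move/eqP; rewrite -subr_eq0 zB => /eqP /al_free [_ /eqP]; rewrite subr_eq0 => /eqP.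
by case.
Qed.

Lemma z_neq0 lam i : z lam i != 0.
Proof.
have -> : z lam i = al * (part lam i.+1)%:~R + (- i.+1%:Z)%:~R.
  by rewrite /z rmorphN /= -!pmulrn.
by rewrite lin_neq0 // orbC oppr_eq0.
Qed.

Lemma z_addN1_neq0 lam (i : nat) : (i < N)%N -> z lam i + N%:R + 1 != 0.
Proof.
move=> lt_i; have -> : z lam i + N%:R + 1 = al * (part lam i.+1)%:~R + (N%:Z - i%:Z)%:~R.
  by rewrite /z rmorphB /= -!pmulrn -!natr1; ring.
by rewrite lin_neq0 //; lia.
Qed.

Definition pow_sum (k : nat) (lam : intpart) : F := \sum_(i < N) z lam i ^+ k.
Definition pow_prod (s : seq nat) (lam : intpart) : F := \prod_(k <- s) pow_sum k lam.

Lemma pow_sum0 lam : pow_sum 0 lam = N%:R.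
Proof. by rewrite /pow_sum sumr_const card_ord. Qed.

(** * The filtered ring generated by the power sums *)

Section Filtration.
Variable A : F -> Prop.

(** Applied to the Laurent polynomials and, as [any_coef], to the whole field when only degrees
    matter. The inverses of integers serve Newton's recursions and the division by n!. *)
Definition coef_ring : Prop :=
  [/\ forall x y, A x -> A y -> A (x + y), forall x y, A x -> A y -> A (x * y),
      A al, A al^-1 & A (-1) /\ forall k, A (k.+1%:R^-1)].

Hypothesis A_ring : coef_ring.

Lemma A_add x y : A x -> A y -> A (x + y). Proof. by case: A_ring => H *; apply: H. Qed.
Lemma A_mul x y : A x -> A y -> A (x * y). Proof. by case: A_ring => _ H *; apply: H. Qed.
Lemma A_al : A al. Proof. by case: A_ring. Qed.
Lemma A_alV : A al^-1. Proof. by case: A_ring. Qed.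
Lemma A_1 : A 1. Proof. by case: A_ring => _ _ _ _ [_ /(_ 0%N)]; rewrite invr1. Qed.
Lemma A_opp x : A x -> A (- x).
Proof. by rewrite -mulN1r => Ax; apply: A_mul => //; case: A_ring => _ _ _ _ []. Qed.
Lemma A_0 : A 0. Proof. by rewrite -(subrr 1); apply: A_add; [|apply: A_opp]; exact: A_1. Qed.
Lemma A_sub x y : A x -> A y -> A (x - y).
Proof. by move=> Ax Ay; apply: A_add => //; apply: A_opp. Qed.
Lemma A_nat k : A k%:R.
Proof. elim: k => [|k IH]; [exact: A_0 | rewrite -natr1; apply: A_add => //; exact: A_1]. Qed.
Lemma A_natV k : A k%:R^-1.
Proof. by case: k => [|k]; [rewrite invr0; exact: A_0 | case: A_ring => _ _ _ _ []]. Qed.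
Lemma A_exp x k : A x -> A (x ^+ k).
Proof. by move=> Ax; elim: k => [|k IH]; [exact: A_1|rewrite exprS; exact: A_mul]. Qed.
Lemma A_prod (I : eqType) (r : seq I) (f : I -> F) :
  (forall i, i \in r -> A (f i)) -> A (\prod_(i <- r) f i).
Proof.
elim: r => [|i r IH] Af; first by rewrite big_nil; exact: A_1.
rewrite big_cons; apply: A_mul; first by apply: Af; rewrite inE eqxx.
by apply: IH => j jr; apply: Af; rewrite inE jr orbT.
Qed.
Lemma A_sum (I : eqType) (r : seq I) (P : pred I) (f : I -> F) :
  (forall i, i \in r -> P i -> A (f i)) -> A (\sum_(i <- r | P i) f i).
Proof.
elim: r => [|i r IH] Af; first by rewrite big_nil; exact: A_0.
rewrite big_cons; case: ifP => Pi; last by apply: IH => j jr; apply: Af; rewrite inE jr orbT.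
apply: A_add; first by apply: Af; rewrite ?inE ?eqxx.
by apply: IH => j jr; apply: Af; rewrite inE jr orbT.
Qed.

(* Combinations of terms a p_s y^m with |s| + m <= d - c; with the two naturals c
   and d, the bound d - c may be negative. The length is kept below the number N
   of variables, so that the last one is z_N = - N. *)
Definition filt2 (c d : nat) (G : intpart -> F -> F) : Prop :=
  exists2 l : seq (F * seq nat * nat),
    (forall x, x \in l -> A x.1.1 /\ (sumn x.1.2 + x.2 + c <= d)%N) &
    forall lam y, (size lam < N)%N ->
      G lam y = \sum_(x <- l) x.1.1 * pow_prod x.1.2 lam * y ^+ x.2.

(** The terms may still contain y. As the value does not depend on it, y = 0 is substituted where an
    expansion is used, whence the factors [0 ^+ x.2]. *)
Definition filt (c d : nat) (f : intpart -> F) : Prop := filt2 c d (fun lam _ => f lam).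

Lemma filt2_ext c d G H : filt2 c d G ->
  (forall lam y, (size lam < N)%N -> H lam y = G lam y) -> filt2 c d H.
Proof.
by move=> [l lP E] HG; exists l => // lam y sl; rewrite HG // E.
Qed.

Lemma filt2_le c d c' d' G : (c' + d <= c + d')%N -> filt2 c d G -> filt2 c' d' G.
Proof.
by move=> le [l lP E]; exists l => // x /lP [Ax b]; split=> //; lia.
Qed.

Lemma filt2_0 c d : filt2 c d (fun _ _ => 0).
Proof. by exists [::] => // lam y _; rewrite big_nil. Qed.

Lemma filt2_term c d a s m : A a -> (sumn s + m + c <= d)%N ->
  filt2 c d (fun lam y => a * pow_prod s lam * y ^+ m).
Proof.
move=> Aa b; exists [:: (a, s, m)]; last by move=> lam y _; rewrite big_seq1.
by move=> x; rewrite inE => /eqP ->.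
Qed.

Lemma filt2_const a : A a -> filt2 0 0 (fun _ _ => a).
Proof.
move=> Aa; apply: filt2_ext (filt2_term (s := [::]) (m := 0%N) Aa (leqnn _)) _ => lam y _.
by rewrite /pow_prod big_nil !mulr1.
Qed.

Lemma filt_pow_prod s : filt 0 (sumn s) (pow_prod s).
Proof.
apply: filt2_ext (filt2_term (s := s) (m := 0%N) A_1 _) _ => [|lam y _]; first by lia.
by rewrite mul1r mulr1.
Qed.

Lemma filt_pow_sum k : filt 0 k (pow_sum k).
Proof.
apply: filt2_ext (filt2_le _ (filt_pow_prod [:: k])) _ => [|lam y _] /=; first by lia.
by rewrite /pow_prod big_seq1.
Qed.

Lemma filt2_exp m : filt2 0 m (fun _ y => y ^+ m).
Proof.
apply: filt2_ext (filt2_term (s := [::]) A_1 _) _ => [|lam y _]; last first.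
  by rewrite /pow_prod big_nil !mul1r.
by rewrite /=; lia.
Qed.

Lemma filt2_add c d G H : filt2 c d G -> filt2 c d H -> filt2 c d (fun lam y => G lam y + H lam y).
Proof.
move=> [l lP E] [l' lP' E']; exists (l ++ l'); last first.
  by move=> lam y sl; rewrite E // E' // big_cat.
by move=> x; rewrite mem_cat => /orP[/lP|/lP'].
Qed.

Lemma filt2_mul c d c' d' G H : filt2 c d G -> filt2 c' d' H ->
  filt2 (c + c') (d + d') (fun lam y => G lam y * H lam y).
Proof.
move=> [l lP E] [l' lP' E'].
exists [seq (u.1.1 * v.1.1, u.1.2 ++ v.1.2, (u.2 + v.2)%N) | u <- l, v <- l'].
  move=> x /allpairsP [[u v] /= [/lP [Au bu] /lP' [Av bv] ->]] /=.
  split; first exact: A_mul.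
  by rewrite sumn_cat /=; move: bu bv => /=; lia.
move=> lam y sl; rewrite E // E' // big_allpairs_dep /= mulr_suml.
apply: eq_bigr => u _; rewrite mulr_sumr; apply: eq_bigr => v _ /=.
by rewrite /pow_prod big_cat /= exprD; ring.
Qed.

Lemma filt2_scale c d a G : A a -> filt2 c d G -> filt2 c d (fun lam y => a * G lam y).
Proof. by move=> Aa gG; have := filt2_mul (filt2_const Aa) gG; rewrite !add0n. Qed.

Lemma filt2_opp c d G : filt2 c d G -> filt2 c d (fun lam y => - G lam y).
Proof.
move=> gG; apply: filt2_ext (filt2_scale (A_opp A_1) gG) _ => lam y _.
by rewrite mulN1r.
Qed.

Lemma filt2_sub c d G H : filt2 c d G -> filt2 c d H -> filt2 c d (fun lam y => G lam y - H lam y).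
Proof. by move=> gG /filt2_opp; apply: filt2_add. Qed.

Lemma filt2_sum c d (I : eqType) (r : seq I) (P : pred I) (G : I -> intpart -> F -> F) :
  (forall i, i \in r -> P i -> filt2 c d (G i)) ->
  filt2 c d (fun lam y => \sum_(i <- r | P i) G i lam y).
Proof.
elim: r => [|i r IH] GG.
  by apply: filt2_ext (filt2_0 _ _) _ => lam y _; rewrite big_nil.
have gr : filt2 c d (fun lam y => \sum_(i <- r | P i) G i lam y).
  by apply: IH => j jr; apply: GG; rewrite inE jr orbT.
have [Pi|nPi] := boolP (P i); last first.
  by apply: filt2_ext gr _ => lam y _; rewrite big_cons (negPf nPi).
apply: filt2_ext (filt2_add (GG i _ Pi) gr) _; first by rewrite inE eqxx.
by move=> lam y _; rewrite big_cons Pi.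
Qed.

Lemma filt_ext c d f g : filt c d f ->
  (forall lam, (size lam < N)%N -> g lam = f lam) -> filt c d g.
Proof. by move=> ff E; apply: filt2_ext ff _ => lam _ /E. Qed.

(** * Power sums under a change of one shifted variable, and moments of the weights [wt] *)

Definition pow_diff (e : F) (k : nat) (y : F) : F := (y + e) ^+ k - y ^+ k.

Lemma pow_diffE e k y : pow_diff e k y = \sum_(j < k) ('C(k, j)%:R * e ^+ (k - j)) * y ^+ j.
Proof.
rewrite /pow_diff [y + e]addrC exprDn big_ord_recr /= subnn expr0 mul1r binn mulr1n addrK.
by apply: eq_bigr => j _; rewrite -mulr_natl mulrA.
Qed.

Lemma pow_diffE1 e k y : pow_diff e k.+1 y - k.+1%:R * e * y ^+ k =
  \sum_(j < k) ('C(k.+1, j)%:R * e ^+ (k.+1 - j)) * y ^+ j.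
Proof. by rewrite pow_diffE big_ord_recr /= binSn subSnn expr1 addrK. Qed.

Lemma filt2_pow_diff e k : A e -> filt2 1 k (fun _ y => pow_diff e k y).
Proof.
move=> Ae; pose G (j : 'I_k) (lam : intpart) y := ('C(k, j)%:R * e ^+ (k - j)) * y ^+ j.
apply: (@filt2_ext _ _ (fun lam y => \sum_(j < k) G j lam y)); last first.
  by move=> lam y _; rewrite pow_diffE.
apply: filt2_sum => j _ _; apply: filt2_scale; first by apply: A_mul; [exact: A_nat | exact: A_exp].
apply: filt2_le (filt2_exp j); have := ltn_ord j; lia.
Qed.

Lemma filt2_pow_diff_top e k : A e -> filt2 2 k (fun _ y => pow_diff e k y - k%:R * e * y ^+ k.-1).
Proof.
case: k => [|k] Ae /=.
  by apply: filt2_ext (filt2_0 _ _) _ => lam y _; rewrite /pow_diff !expr0 subrr !mul0r subrr.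
pose G (j : 'I_k) (lam : intpart) y := ('C(k.+1, j)%:R * e ^+ (k.+1 - j)) * y ^+ j.
apply: (@filt2_ext _ _ (fun lam y => \sum_(j < k) G j lam y)); last first.
  by move=> lam y _; rewrite pow_diffE1.
apply: filt2_sum => j _ _; apply: filt2_scale; first by apply: A_mul; [exact: A_nat | exact: A_exp].
apply: filt2_le (filt2_exp j); have := ltn_ord j; lia.
Qed.

Lemma filt_sum_pow_diff e k : A e -> filt 1 k (fun lam => \sum_(i < N) pow_diff e k (z lam i)).
Proof.
move=> Ae; pose G (j : 'I_k) (lam : intpart) (y : F) := ('C(k, j)%:R * e ^+ (k - j)) * pow_sum j lam.
apply: (@filt2_ext _ _ (fun lam y => \sum_(j < k) G j lam y)); last first.
  move=> lam y _; under eq_bigr => i _ do rewrite pow_diffE.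
  by rewrite exchange_big; apply: eq_bigr => j _ /=; rewrite -mulr_sumr.
apply: filt2_sum => j _ _; apply: filt2_scale; first by apply: A_mul; [exact: A_nat | exact: A_exp].
apply: filt2_le (filt_pow_sum j); have := ltn_ord j; lia.
Qed.

Lemma filt_sum_pow_diff_top e k : A e ->
  filt 2 k (fun lam => \sum_(i < N) pow_diff e k (z lam i) - k%:R * e * pow_sum k.-1 lam).
Proof.
case: k => [|k] Ae.
  apply: filt2_ext (filt2_0 _ _) _ => lam y _; rewrite !mul0r subr0 big1 // => i _.
  by rewrite /pow_diff !expr0 subrr.
pose G (j : 'I_k) (lam : intpart) (y : F) := ('C(k.+1, j)%:R * e ^+ (k.+1 - j)) * pow_sum j lam.
apply: (@filt2_ext _ _ (fun lam y => \sum_(j < k) G j lam y)); last first.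
  move=> lam y _; rewrite /pow_sum mulr_sumr -sumrB; under eq_bigr => i _ do rewrite pow_diffE1.
  by rewrite exchange_big; apply: eq_bigr => j _ /=; rewrite -mulr_sumr.
apply: filt2_sum => j _ _; apply: filt2_scale; first by apply: A_mul; [exact: A_nat | exact: A_exp].
apply: filt2_le (filt_pow_sum j); have := ltn_ord j; lia.
Qed.

(* The shifted binomial coefficient of lam over lam - e_i; it vanishes when
   lam - e_i is not a partition, because z_i - z_{i+1} = 1 or z_i = - N then. *)
Definition wt (lam : intpart) (i : 'I_N) : F :=
  al^-1 * (z lam i + N%:R) * \prod_(j < N | j != i) ((z lam i - z lam j - 1) / (z lam i - z lam j)).

(* The probability of adding a box to row i under the Jack transition measure; it
   vanishes when lam + e_i is not a partition. *)
Definition ut (lam : intpart) (i : 'I_N) : F :=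
  (z lam i + N%:R + 1)^-1 * \prod_(j < N | j != i) ((z lam i - z lam j + 1) / (z lam i - z lam j)).

(** The coefficients of prod_j (1 - (z_j + 1) X) / (1 - z_j X), written as moments. *)
Definition shift_moment (lam : intpart) (k : nat) : F :=
  if k is j.+1 then \sum_(i < N) \prod_(j < N) (z lam i - (z lam j + 1))
     / \prod_(j < N | j != i) (z lam i - z lam j) * z lam i ^+ j else 1.

Lemma shift_moment_rec lam k : k%:R * shift_moment lam k =
  \sum_(j < k) (- \sum_(i < N) pow_diff 1 j.+1 (z lam i)) * shift_moment lam (k - j.+1)%N.
Proof.
rewrite (@moments_equal F N (fun i => z lam i) _ _ (fun j => z lam j + 1) (shift_moment lam)) //.
- by apply: eq_bigr => j _; congr (_ * _); rewrite -sumrB -sumrN; apply: eq_bigr => i _;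
     rewrite /pow_diff opprB.
- by move=> i j /z_inj /val_inj.
- by move=> i; exact: z_neq0.
Qed.

(** The factors of the recursion are differences of powers and lose one degree each, so a moment of
    positive order k has degree k - 1. The boolean [0 < k] is read as a number. *)
Lemma filt_shift_moment k : filt (0 < k) k (shift_moment ^~ k).
Proof.
elim/ltn_ind: k => -[|k] IH; first exact: filt2_const A_1.
pose G (j : 'I_k.+1) (lam : intpart) (y : F) :=
  (- \sum_(i < N) pow_diff 1 j.+1 (z lam i)) * shift_moment lam (k.+1 - j.+1)%N.
apply: (@filt2_ext _ _ (fun lam y => k.+1%:R^-1 * \sum_(j < k.+1) G j lam y)); last first.
  by move=> lam y _; rewrite -shift_moment_rec mulKf // natr_neq0.
apply: filt2_scale; first exact: A_natV.
apply: filt2_sum => j _ _.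
apply: filt2_le (filt2_mul (filt2_opp (filt_sum_pow_diff j.+1 A_1)) (IH (k.+1 - j.+1)%N _)).
  by have := ltn_ord j; lia.
by have := ltn_ord j; lia.
Qed.

Definition wt_moment (k : nat) (lam : intpart) : F := \sum_i wt lam i * z lam i ^+ k.

(** The product over all j in [shift_moment] contains z_i - (z_i + 1) = -1, hence the sign; the
    factor z_i + N of [wt] combines two consecutive moments. *)
Lemma wt_momentE lam k : wt_moment k lam = - al^-1 * (shift_moment lam k.+2 + N%:R * shift_moment lam k.+1).
Proof.
rewrite /wt_moment /= mulr_sumr -big_split mulr_sumr /=; apply: eq_bigr => i _.
rewrite /wt (bigD1 i (P := xpredT)) //= prodf_div; set p1 := \prod_(_ < _ | _) _.
have -> : \prod_(j < N | j != i) (z lam i - (z lam j + 1)) = p1.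
  by apply: eq_bigr => j _; rewrite opprD addrA.
rewrite exprS; set a := al^-1; set p2 := (\prod_(_ | _) (_ - _))^-1; ring.
Qed.

Lemma filt_wt_moment k : filt 0 k.+1 (wt_moment k).
Proof.
apply: (filt_ext (f := fun lam => - al^-1 * (shift_moment lam k.+2 + N%:R * shift_moment lam k.+1))).
  apply: filt2_scale; first by apply: A_opp; exact: A_alV.
  apply: filt2_add; first by apply: filt2_le (filt_shift_moment k.+2) => /=; lia.
  apply: filt2_scale; first exact: A_nat.
  by apply: filt2_le (filt_shift_moment k.+1) => /=; lia.
by move=> lam _; exact: wt_momentE.
Qed.

Lemma pow_diff_1 e y : pow_diff e 1 y = e.
Proof. by rewrite /pow_diff !expr1 addrAC subrr add0r. Qed.

Lemma sum_ordS n : 2 * (\sum_(i < n) i.+1%:R) = n%:R * (n%:R + 1) :> F.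
Proof.
elim: n => [|n IH]; first by rewrite big_ord0 mulr0 mul0r.
by rewrite big_ord_recr /= mulrDr IH -natr1; ring.
Qed.

(** The first two steps of the recursion, together with 2 p_1 = 2 alpha |lam| - N (N + 1). *)
Lemma wt_moment0 lam : (size lam < N)%N -> wt_moment 0 lam = (weight lam)%:R.
Proof.
move=> sl.
have q1 : \sum_(i < N) pow_diff 1 1 (z lam i) = N%:R.
  by under eq_bigr => i _ do rewrite pow_diff_1; rewrite sumr_const card_ord.
have q2 : \sum_(i < N) pow_diff 1 2 (z lam i) = 2 * pow_sum 1 lam + N%:R.
  have -> : N%:R = \sum_(i < N) 1 :> F by rewrite sumr_const card_ord.
  rewrite /pow_sum mulr_sumr -big_split /=.
  by apply: eq_bigr => i _; rewrite /pow_diff; ring.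
have p1 : 2 * pow_sum 1 lam = 2 * (al * (weight lam)%:R) - N%:R * (N%:R + 1).
  rewrite (weight_part (ltnW sl)) natr_sum -sum_ordS -mulrBr [al * _]mulr_sumr -sumrB.
  by congr (_ * _); apply: eq_bigr => i _; rewrite expr1.
rewrite wt_momentE; apply: (mulfI (natr_neq0 (ltn0Sn 1))); apply: (mulfI al_neq0).
have -> : al * (2 * (- al^-1 * (shift_moment lam 2 + N%:R * shift_moment lam 1))) =
          - (2 * shift_moment lam 2 + 2 * N%:R * shift_moment lam 1).
  by field; exact: al_neq0.
have R1 : shift_moment lam 1 = - N%:R.
  by have := shift_moment_rec lam 1; rewrite mul1r big_ord1 q1 => ->; exact: mulr1.
have R2 : 2 * shift_moment lam 2 = - N%:R * shift_moment lam 1 - (2 * pow_sum 1 lam + N%:R) * 1.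
  by rewrite -{1}q1 -q2 (shift_moment_rec lam 2) big_ord_recl big_ord1 mulNr; congr (_ + _); rewrite mulNr.
by rewrite R2 R1 p1; ring.
Qed.

(** Summation against the weights turns y^m into the moment of order m, which has degree m + 1. *)
Lemma filt_sum_wt c d G : filt2 c d G ->
  filt c d.+1 (fun lam => \sum_i wt lam i * G lam (z lam i)).
Proof.
move=> [l lP E].
pose H (x : F * seq nat * nat) lam y := x.1.1 * (pow_prod x.1.2 lam * wt_moment x.2 lam).
apply: (@filt2_ext _ _ (fun lam y => \sum_(x <- l) H x lam y)); last first.
  move=> lam y sl; under eq_bigr => i _ do rewrite E // mulr_sumr.
  rewrite exchange_big; apply: eq_bigr => x _ /=; rewrite /H mulrA /wt_moment mulr_sumr.
  by apply: eq_bigr => i _; ring.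
apply: filt2_sum => x /lP [Ax b] _; apply: filt2_scale => //.
by apply: filt2_le (filt2_mul (filt_pow_prod x.1.2) (filt_wt_moment x.2)); lia.
Qed.

(** The value of p_s after one shifted variable y has become y + e; [pw_shift_lin] is the part of it
    that is linear in the differences. *)
Definition pw_shift (e : F) (s : seq nat) lam y : F := \prod_(k <- s) (pow_sum k lam + pow_diff e k y).

Fixpoint pw_shift_lin (e : F) (s : seq nat) lam y : F :=
  if s is k :: s' then pow_diff e k y * pow_prod s' lam + pow_sum k lam * pw_shift_lin e s' lam y else 0.

Lemma pow_prod_cons k s lam : pow_prod (k :: s) lam = pow_sum k lam * pow_prod s lam.
Proof. by rewrite /pow_prod big_cons. Qed.

Lemma filt2_pw_shift_lin e s : A e -> filt2 1 (sumn s) (pw_shift_lin e s).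
Proof.
move=> Ae; elim: s => [|k s IH] /=; first exact: filt2_0.
apply: filt2_add.
  by apply: filt2_le (filt2_mul (filt2_pow_diff k Ae) (filt_pow_prod s)); lia.
by apply: filt2_le (filt2_mul (filt_pow_sum k) IH); lia.
Qed.

(** A difference [pow_diff e k y] has degree k - 1, so terms with two of them lie two degrees below
    p_s. *)
Lemma filt2_pw_shift2 e s : A e ->
  filt2 2 (sumn s) (fun lam y => pw_shift e s lam y - pow_prod s lam - pw_shift_lin e s lam y).
Proof.
move=> Ae; elim: s => [|k s IH] /=.
  by apply: filt2_ext (filt2_0 _ _) _ => lam y _; rewrite /pw_shift /pow_prod !big_nil subrr subr0.
apply: (@filt2_ext _ _ (fun lam y => pow_sum k lam * (pw_shift e s lam y - pow_prod s lam - pw_shift_lin e s lam y) +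
  pow_diff e k y * (pw_shift e s lam y - pow_prod s lam - pw_shift_lin e s lam y) + pow_diff e k y * pw_shift_lin e s lam y)).
  apply: filt2_add; [apply: filt2_add|].
  - by apply: filt2_le (filt2_mul (filt_pow_sum k) IH); lia.
  - by apply: filt2_le (filt2_mul (filt2_pow_diff k Ae) IH); lia.
  - by apply: filt2_le (filt2_mul (filt2_pow_diff k Ae) (filt2_pw_shift_lin s Ae)); lia.
by move=> lam y _; rewrite pow_prod_cons /pw_shift big_cons; ring.
Qed.

Lemma filt2_pw_shift1 e s : A e -> filt2 1 (sumn s) (fun lam y => pw_shift e s lam y - pow_prod s lam).
Proof.
move=> Ae; apply: filt2_ext (filt2_add (filt2_le _ (filt2_pw_shift2 s Ae)) (filt2_pw_shift_lin s Ae)) _ => [|lam y _].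
  by lia.
by rewrite subrK.
Qed.

Lemma filt2_pw_shift e s : A e -> filt2 0 (sumn s) (pw_shift e s).
Proof.
move=> Ae; apply: filt2_ext (filt2_add (filt2_le _ (filt2_pw_shift1 s Ae)) (filt_pow_prod s)) _ => [|lam y _].
  by lia.
by rewrite subrK.
Qed.

(** * The lowering operators and the degree operator *)

Lemma wt0 lam (i : 'I_N) : (size lam < N)%N -> ~~ removable lam i -> wt lam i = 0.
Proof.
rewrite /removable -leqNgt => sl le; have [lt_i|ge_i] := ltnP i.+1 N.
  have e : part lam i.+1 = part lam i.+2.
    by apply/eqP; rewrite eqn_leq le /=; apply: part_leq; lia.
  rewrite /wt (bigD1 (Ordinal lt_i)) /=; last by rewrite -val_eqE /=; lia.
  rewrite (_ : z lam i - z lam i.+1 - 1 = 0) ?mul0r ?mulr0 //.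
  by rewrite /z e -[i.+2%:R]natr1; ring.
have iM : i = M :> nat by have := ltn_ord i; lia.
rewrite /wt (_ : z lam i + N%:R = 0) ?mulr0 ?mul0r //.
by rewrite /z /part nth_default /= iM // mulr0 add0r addNr.
Qed.

Lemma z_dec lam i j : removable lam i -> (j < N)%N ->
  z (dec N lam i) j = z lam j - al * (j == i)%:R.
Proof.
move=> rm lt_j; rewrite /z part_dec // natrB; first by ring.
by have [->|//] := eqVneq j i; move: rm; rewrite /removable; lia.
Qed.

Lemma sum_shift (f : 'I_N -> F) (i : 'I_N) e k :
  \sum_(j < N) (f j + e * (j == i :> nat)%:R) ^+ k = \sum_j f j ^+ k + pow_diff e k (f i).
Proof.
rewrite (bigD1 i) //= [in RHS](bigD1 i) //= eqxx mulr1 /pow_diff.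
rewrite (eq_bigr (fun j => f j ^+ k)) => [|j]; first by ring.
by rewrite -val_eqE /= => /negPf ->; rewrite mulr0 addr0.
Qed.

Lemma pow_sum_dec lam (i : 'I_N) k : removable lam i ->
  pow_sum k (dec N lam i) = pow_sum k lam + pow_diff (- al) k (z lam i).
Proof.
move=> rm; rewrite -(sum_shift (fun j : 'I_N => z lam j)); apply: eq_bigr => j _.
by rewrite z_dec // mulNr.
Qed.

Lemma pow_prod_dec lam (i : 'I_N) s : removable lam i ->
  pow_prod s (dec N lam i) = pw_shift (- al) s lam (z lam i).
Proof. by move=> rm; apply: eq_bigr => k _; rewrite pow_sum_dec. Qed.

(** The factor z_i - al + 1 is z_i + 1 taken at the smaller partition; it matches the factor of
    [raise_op] under transposition. *)
Definition lower_op (n : nat) (f : intpart -> F) (lam : intpart) : F :=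
  \sum_(i < N) wt lam i * ((z lam i - al + 1) ^+ n * f (dec N lam i)).

(** By [wt_moment0] this is sum_i w_i (f(lam) - f(lam - e_i)), the operator E, on partitions with
    fewer than N parts. *)
Definition degree_op (f : intpart -> F) (lam : intpart) : F :=
  (weight lam)%:R * f lam - lower_op 0 f lam.

Lemma size_dec_lt lam (i : 'I_N) : (size lam < N)%N -> removable lam i ->
  (size (dec N lam i) < N)%N.
Proof. by move=> sl rm; apply: leq_ltn_trans (size_dec_le (ltnW sl) _ rm) sl. Qed.

(** The shift on the right makes sense in every row. Where no box can be removed both sides vanish
    with [wt], so [filt_sum_wt] can be applied to the sum over all rows. *)
Lemma wt_dec (l : seq (F * seq nat * nat)) (f : intpart -> F) lam (i : 'I_N) :
  (forall lam y, (size lam < N)%N -> f lam = \sum_(x <- l) x.1.1 * pow_prod x.1.2 lam * y ^+ x.2) ->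
  (size lam < N)%N ->
  wt lam i * f (dec N lam i) =
  wt lam i * \sum_(x <- l) (x.1.1 * 0 ^+ x.2) * pw_shift (- al) x.1.2 lam (z lam i).
Proof.
move=> E sl; have [rm|nrm] := boolP (removable lam i); last by rewrite wt0 // !mul0r.
rewrite (E _ 0) ?size_dec_lt //; congr (_ * _); apply: eq_bigr => x _.
by rewrite pow_prod_dec // mulrAC.
Qed.

Lemma filt_lower_op n c d f : filt c d f -> filt c (d + n).+1 (lower_op n f).
Proof.
move=> [l lP E].
pose G (x : F * seq nat * nat) lam y := (x.1.1 * 0 ^+ x.2) * pw_shift (- al) x.1.2 lam y.
apply: (filt_ext (f := fun lam => \sum_i wt lam i *
   ((z lam i - al + 1) ^+ n * \sum_(x <- l) G x lam (z lam i)))); last first.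
  move=> lam sl; apply: eq_bigr => i _.
  by rewrite mulrCA (wt_dec _ E) // mulrCA.
apply: (filt_sum_wt (G := fun lam y => (y - al + 1) ^+ n * \sum_(x <- l) G x lam y)).
have gy : filt2 0 1 (fun _ y => y - al + 1).
  apply: (@filt2_ext _ _ (fun lam y => y ^+ 1 + (- al + 1))); last first.
    by move=> lam y _; rewrite expr1 addrA.
  apply: filt2_add; first exact: filt2_exp.
  apply: filt2_le (filt2_const _) => //; apply: A_add; [apply: A_opp; exact: A_al|exact: A_1].
have gyn : filt2 0 n (fun _ y => (y - al + 1) ^+ n).
  elim: n => [|n IH]; first by apply: filt2_ext (filt2_const A_1) _ => lam y _; rewrite expr0.
  apply: filt2_ext (filt2_mul gy IH) _ => lam y _; exact: exprS.
have gG : filt2 c d (fun lam y => \sum_(x <- l) G x lam y).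
  apply: filt2_sum => x /lP [Ax b] _; apply: filt2_scale.
    by apply: A_mul => //; apply: A_exp; exact: A_0.
  apply: filt2_le (filt2_pw_shift x.1.2 (A_opp A_al)); lia.
by rewrite addnC; exact: filt2_mul gyn gG.
Qed.

(** The degree gained in [filt_sum_wt] is lost again in the difference between f and its shift. *)
Lemma filt_degree_op c d f : filt c d f -> filt c d (degree_op f).
Proof.
move=> [l lP E].
pose G (x : F * seq nat * nat) lam y :=
  (x.1.1 * 0 ^+ x.2) * (pw_shift (- al) x.1.2 lam y - pow_prod x.1.2 lam).
apply: (filt_ext (f := fun lam => - \sum_i wt lam i * \sum_(x <- l) G x lam (z lam i))); last first.
  move=> lam sl; rewrite /degree_op -(wt_moment0 sl) /wt_moment mulr_suml -sumrB -sumrN; apply: eq_bigr => i _.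
  rewrite expr0 mul1r (wt_dec _ E) // (E _ 0) // mulr1 -mulrBr -mulrN; congr (_ * _).
  by rewrite -sumrB -sumrN; apply: eq_bigr => x _; rewrite /G; ring.
apply: filt2_opp; apply: (@filt2_le c.+1 d.+1); first by lia.
apply: (filt_sum_wt (G := fun lam y => \sum_(x <- l) G x lam y)).
apply: filt2_sum => x /lP [Ax b] _; apply: filt2_scale.
  by apply: A_mul => //; apply: A_exp; exact: A_0.
by apply: filt2_le (filt2_pw_shift1 x.1.2 (A_opp A_al)); lia.
Qed.

(** * Moments of the transition measure *)

Lemma z_last lam : (size lam < N)%N -> z lam M = - N%:R.
Proof. by move=> sl; rewrite /z /part nth_default // mulr0 add0r. Qed.

Definition ut_moment (k : nat) lam : F := \sum_(i < N) ut lam i * z lam i ^+ k.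

(** The last row is empty, so z_N = - N and the denominator z_i + N + 1 is z_i - (z_N - 1). It
    cancels the last row from the numerator, which leads to [moments_less]. *)
Lemma ut_momentE lam k : (size lam < N)%N -> ut_moment k lam =
  \sum_(i < N) \prod_(j < N | j != ord_max) (z lam i - (z lam j - 1))
     / \prod_(j < N | j != i) (z lam i - z lam j) * z lam i ^+ k.
Proof.
move=> sl; apply: eq_bigr => i _; congr (_ * _); rewrite /ut prodf_div mulrA; congr (_ / _).
have n0 := z_addN1_neq0 lam (ltn_ord i); apply: (mulfI n0); rewrite mulVKf //.
have e : \prod_(j < N) (z lam i - z lam j + 1) = \prod_(j < N | j != i) (z lam i - z lam j + 1).
  by rewrite (bigD1 i) //= subrr add0r mul1r.
rewrite -e (bigD1 ord_max) //= z_last // opprK; congr (_ * _).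
by apply: eq_bigr => j _; ring.
Qed.

Lemma ut_moment_rec lam : (size lam < N)%N -> ut_moment 0 lam = 1 /\
  forall k, k%:R * ut_moment k lam =
   \sum_(j < k) ((- N%:R - 1) ^+ j.+1 - \sum_(i < N) pow_diff (- 1) j.+1 (z lam i)) * ut_moment (k - j.+1) lam.
Proof.
move=> sl; have [|||U0 UR] := (@moments_less F N (fun i => z lam i) _ _ ord_max
  (fun j => z lam j - 1) (ut_moment ^~ lam)).
- by move=> i j /z_inj /val_inj.
- by move=> i; exact: z_neq0.
- by move=> k; exact: ut_momentE.
split=> // k; rewrite UR; apply: eq_bigr => j _; congr (_ * _).
rewrite /pow_diff sumrB opprB; have -> : \sum_(i < N) (z lam i + -1) ^+ j.+1 =
   (- N%:R - 1) ^+ j.+1 + \sum_(i < N | i != ord_max) (z lam i - 1) ^+ j.+1.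
  by rewrite (bigD1 ord_max) //= z_last.
by ring.
Qed.

Lemma ut_moment0 lam : (size lam < N)%N -> ut_moment 0 lam = 1.
Proof. by case/ut_moment_rec. Qed.

(** So z_i + 1 has mean zero. This explains the factor z_i + 1 in the raising operators: its mean is
    the coefficient of p_s itself, and the degree drops. *)
Lemma ut_moment1 lam : (size lam < N)%N -> ut_moment 1 lam = - 1.
Proof.
move=> sl; have [U0 /(_ 1)] := ut_moment_rec sl; rewrite mul1r big_ord1 subnn U0 mulr1 => ->.
under eq_bigr => i _ do rewrite pow_diff_1; rewrite sumr_const card_ord expr1 -mulr_natr; ring.
Qed.

(** The factor in the recursion for [ut_moment]; the power of - N - 1 corrects for the last row,
    absent from the numerator. *)
Let cf (j : nat) lam : F := (- N%:R - 1) ^+ j - \sum_(i < N) pow_diff (- 1) j (z lam i).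

Let A_N1 j : A ((- N%:R - 1) ^+ j).
Proof. by apply: A_exp; apply: A_sub; [apply: A_opp; exact: A_nat|exact: A_1]. Qed.

Let filt_cf j : filt 1 j.+1 (cf j.+1).
Proof.
apply: filt2_sub; last by apply: filt_sum_pow_diff; apply: A_opp; exact: A_1.
by apply: filt2_le (filt2_const (A_N1 _)); lia.
Qed.

Let filt_cf_top j : (0 < j)%N -> filt 2 j.+1 (fun lam => cf j.+1 lam - j.+1%:R * pow_sum j lam).
Proof.
move=> j0; apply: (@filt2_ext _ _ (fun lam y => (- N%:R - 1) ^+ j.+1 -
   (\sum_(i < N) pow_diff (- 1) j.+1 (z lam i) - j.+1%:R * (-1) * pow_sum j.+1.-1 lam))).
  apply: filt2_sub; first by apply: filt2_le (filt2_const (A_N1 _)); lia.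
  by apply: filt_sum_pow_diff_top; apply: A_opp; exact: A_1.
by move=> lam y _; rewrite /cf /=; ring.
Qed.

Lemma filt_ut_moment k : filt (0 < k) k (ut_moment k).
Proof.
elim/ltn_ind: k => -[|k] IH.
  by apply: (filt_ext (filt2_const A_1)) => lam /ut_moment0.
pose G (j : 'I_k.+1) lam (y : F) := cf j.+1 lam * ut_moment (k.+1 - j.+1)%N lam.
apply: (@filt2_ext _ _ (fun lam y => k.+1%:R^-1 * \sum_(j < k.+1) G j lam y)); last first.
  move=> lam y sl; have [_ /(_ k.+1) E] := ut_moment_rec sl.
  by rewrite -[LHS](mulKf (natr_neq0 (ltn0Sn k))) E.
apply: filt2_scale; first exact: A_natV.
apply: filt2_sum => j _ _.
apply: filt2_le (filt2_mul (filt_cf j) (IH (k.+1 - j.+1)%N _)); have := ltn_ord j; lia.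
Qed.

(** Only the last term of the recursion reaches degree k - 1, and its factor [cf k] has leading term
    k p_(k-1). *)
Lemma filt_ut_moment_top k : (1 < k)%N -> filt 2 k (fun lam => ut_moment k lam - pow_sum k.-1 lam).
Proof.
case: k => [//|k] k0.
pose G (j : 'I_k) lam (y : F) := cf j.+1 lam * ut_moment (k.+1 - j.+1)%N lam.
apply: (@filt2_ext _ _ (fun lam y => k.+1%:R^-1 *
   (\sum_(j < k) G j lam y + (cf k.+1 lam - k.+1%:R * pow_sum k lam)))); last first.
  move=> lam y sl; have [U0 /(_ k.+1)] := ut_moment_rec sl.
  rewrite big_ord_recr /= subnn U0 mulr1 => E; rewrite addrA.
  apply: (mulfI (natr_neq0 (ltn0Sn k))); rewrite mulVKf ?natr_neq0 //.
  by rewrite mulrBr E.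
apply: filt2_scale; first exact: A_natV.
apply: filt2_add; last by apply: filt_cf_top.
apply: filt2_sum => j _ _.
apply: filt2_le (filt2_mul (filt_cf j) (filt_ut_moment (k.+1 - j.+1)%N)); have := ltn_ord j; lia.
Qed.

Lemma filt_sum_ut c d G : filt2 c d G ->
  filt c d (fun lam => \sum_(i < N) ut lam i * G lam (z lam i)).
Proof.
move=> [l lP E].
pose H (x : F * seq nat * nat) lam y := x.1.1 * (pow_prod x.1.2 lam * ut_moment x.2 lam).
apply: (@filt2_ext _ _ (fun lam y => \sum_(x <- l) H x lam y)); last first.
  move=> lam y sl; under eq_bigr => i _ do rewrite E // mulr_sumr.
  rewrite exchange_big; apply: eq_bigr => x _ /=; rewrite /H mulrA /ut_moment mulr_sumr.
  by apply: eq_bigr => i _; ring.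
apply: filt2_sum => x /lP [Ax b] _; apply: filt2_scale => //.
by apply: filt2_le (filt2_mul (filt_pow_prod x.1.2) (filt_ut_moment x.2)); lia.
Qed.

(** The factor z_i costs no degree, because the moment of order m + 1 has degree at most m. *)
Lemma filt_sum_utz c d G : filt2 c d G ->
  filt c d (fun lam => \sum_(i < N) ut lam i * (z lam i * G lam (z lam i))).
Proof.
move=> [l lP E].
pose H (x : F * seq nat * nat) lam y := x.1.1 * (pow_prod x.1.2 lam * ut_moment x.2.+1 lam).
apply: (@filt2_ext _ _ (fun lam y => \sum_(x <- l) H x lam y)); last first.
  move=> lam y sl; under eq_bigr => i _ do rewrite E // 2!mulr_sumr.
  rewrite exchange_big; apply: eq_bigr => x _ /=; rewrite /H mulrA /ut_moment mulr_sumr.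
  by apply: eq_bigr => i _; rewrite exprS; ring.
apply: filt2_sum => x /lP [Ax b] _; apply: filt2_scale => //.
have gU : filt 1 x.2.+1 (ut_moment x.2.+1) := filt_ut_moment x.2.+1.
by apply: filt2_le (filt2_mul (filt_pow_prod x.1.2) gU); move: b => /=; lia.
Qed.

(** * The raising operators and their symbols *)

Lemma ut0 lam (i : 'I_N) : (size lam < N)%N -> ~~ addable lam i -> ut lam i = 0.
Proof.
case: i => -[//|i] lt_i sl; rewrite /addable /= -leqNgt => le.
have e : part lam i.+1 = part lam i.+2.
  by apply/eqP; rewrite eqn_leq le /=; apply: part_leq; lia.
have lt_i' : (i < N)%N by exact: ltnW.
rewrite /ut (bigD1 (Ordinal lt_i')) /=; last by rewrite -val_eqE /=; lia.
rewrite (_ : z lam i.+1 - z lam i + 1 = 0) ?mul0r ?mulr0 //.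
by rewrite /z e -[i.+2%:R]natr1; ring.
Qed.

Lemma z_inc lam i j : addable lam i -> (j < N)%N ->
  z (inc N lam i) j = z lam j + al * (j == i)%:R.
Proof. by move=> ad lt_j; rewrite /z part_inc // natrD; ring. Qed.

Lemma pow_prod_inc lam (i : 'I_N) s : addable lam i ->
  pow_prod s (inc N lam i) = pw_shift al s lam (z lam i).
Proof.
move=> ad; apply: eq_bigr => k _; rewrite -(sum_shift (fun j : 'I_N => z lam j)).
by apply: eq_bigr => j _; rewrite z_inc.
Qed.

Definition raise_op (n : nat) (f : intpart -> F) lam : F :=
  \sum_(i < N) ut lam i * ((z lam i + 1) ^+ n * f (inc N lam i)).

Lemma raise_op_pow_prod n s lam : (size lam < N)%N ->
  raise_op n (pow_prod s) lam = \sum_(i < N) ut lam i * ((z lam i + 1) ^+ n * pw_shift al s lam (z lam i)).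
Proof.
move=> sl; apply: eq_bigr => i _; have [ad|nad] := boolP (addable lam i).
  by rewrite pow_prod_inc.
by rewrite ut0 // !mul0r.
Qed.

(* The derivation of the polynomial ring in the power sums sending pow_sum k to
   phi k. *)
Fixpoint der (phi : nat -> intpart -> F) (s : seq nat) lam : F :=
  if s is k :: s' then phi k lam * pow_prod s' lam + pow_sum k lam * der phi s' lam else 0.

Lemma filt_der phi c s : (forall k, filt c k (phi k)) -> filt c (sumn s) (der phi s).
Proof.
move=> fphi; elim: s => [|k s IH] /=; first exact: filt2_0.
apply: filt2_add; first by apply: filt2_le (filt2_mul (fphi k) (filt_pow_prod s)); lia.
by apply: filt2_le (filt2_mul (filt_pow_sum k) IH); lia.
Qed.

Lemma derB phi psi s lam :
  der (fun k lam => phi k lam - psi k lam) s lam = der phi s lam - der psi s lam.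
Proof.
elim: s => [|k s IH] /=; first by rewrite subr0.
by rewrite IH; ring.
Qed.

Definition symbol0 (k : nat) lam : F := if k == 1%N then al else 0.
Definition symbol1 (k : nat) lam : F := if (1 < k)%N then al * k%:R * pow_sum k.-1 lam else 0.

(** The linear part of the shift obeys Leibniz's rule, so its mean is a derivation, determined by
    the means of the [pow_diff al k]. *)
Lemma sum_ut_pw_shift_lin (f : F -> F) s lam :
  \sum_(i < N) ut lam i * (f (z lam i) * pw_shift_lin al s lam (z lam i)) =
  der (fun k lam => \sum_(i < N) ut lam i * (f (z lam i) * pow_diff al k (z lam i))) s lam.
Proof.
elim: s => [|k s IH] /=; first by rewrite big1 // => i _; rewrite !mulr0.
rewrite -IH mulr_suml mulr_sumr -big_split /=; apply: eq_bigr => i _; ring.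
Qed.

(** The leading contribution is k al times the moment of order k - 1: al for k = 1, and of degree k
    - 2, hence negligible, for larger k. *)
Lemma filt_symbol0 k :
  filt 2 k (fun lam => \sum_(i < N) ut lam i * (1 * pow_diff al k (z lam i)) - symbol0 k lam).
Proof.
apply: (@filt2_ext _ _ (fun lam y => \sum_(i < N) ut lam i *
   (pow_diff al k (z lam i) - k%:R * al * z lam i ^+ k.-1) +
   (k%:R * al * ut_moment k.-1 lam - symbol0 k lam))); last first.
  move=> lam y _; rewrite addrA; congr (_ - _).
  rewrite /ut_moment mulr_sumr -big_split /=; apply: eq_bigr => i _; ring.
apply: filt2_add; first exact: (filt_sum_ut (filt2_pow_diff_top k A_al)).
case: k => [|[|k]].
- by apply: filt2_ext (filt2_0 _ _) _ => lam y _; rewrite !mul0r /symbol0 subrr.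
- by apply: filt2_ext (filt2_0 _ _) _ => lam y sl; rewrite /= ut_moment0 // mulr1 mul1r /symbol0 eqxx subrr.
apply: (@filt2_ext _ _ (fun lam y => k.+2%:R * al * ut_moment k.+1 lam)).
  apply: filt2_scale; first by apply: A_mul; [exact: A_nat | exact: A_al].
  by apply: filt2_le (filt_ut_moment k.+1) => /=; lia.
by move=> lam y _; rewrite /symbol0 subr0.
Qed.

(** The leading contribution is k al times the sum of the moments of orders k and k - 1: zero for k
    = 1, and al k p_(k-1) up to lower degree for larger k. *)
Lemma filt_symbol1 k :
  filt 2 k (fun lam => \sum_(i < N) ut lam i * ((z lam i + 1) * pow_diff al k (z lam i)) - symbol1 k lam).
Proof.
have gt := filt2_pow_diff_top k A_al.
apply: (@filt2_ext _ _ (fun lam y => (\sum_(i < N) ut lam i *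
   (z lam i * (pow_diff al k (z lam i) - k%:R * al * z lam i ^+ k.-1)) +
   \sum_(i < N) ut lam i * (pow_diff al k (z lam i) - k%:R * al * z lam i ^+ k.-1)) +
   (k%:R * al * (\sum_(i < N) ut lam i * (z lam i * z lam i ^+ k.-1) + ut_moment k.-1 lam)
      - symbol1 k lam))); last first.
  move=> lam y _; rewrite addrA; congr (_ - _).
  rewrite /ut_moment mulrDr !mulr_sumr -!big_split /=; apply: eq_bigr => i _; ring.
apply: filt2_add; first by apply: filt2_add; [exact: (filt_sum_utz gt) | exact: (filt_sum_ut gt)].
have ut_momentS m lam : \sum_(i < N) ut lam i * (z lam i * z lam i ^+ m) = ut_moment m.+1 lam.
  by apply: eq_bigr => i _; rewrite exprS.
case: k gt => [|[|k]] _.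
- by apply: filt2_ext (filt2_0 _ _) _ => lam y _; rewrite !mul0r /symbol1 subrr.
- apply: filt2_ext (filt2_0 _ _) _ => lam y sl; by rewrite ut_momentS ut_moment0 // ut_moment1 // addNr mulr0 /symbol1 subr0.
apply: (@filt2_ext _ _ (fun lam y => k.+2%:R * al * ((ut_moment k.+2 lam - pow_sum k.+1 lam) + ut_moment k.+1 lam))).
  apply: filt2_scale; first by apply: A_mul; [exact: A_nat | exact: A_al].
  apply: filt2_add; first exact: filt_ut_moment_top.
  by apply: filt2_le (filt_ut_moment k.+1) => /=; lia.
by move=> lam y _; rewrite /symbol1 ut_momentS /=; ring.
Qed.

Lemma filt_raise_op0_pow_prod s : filt 2 (sumn s) (fun lam => raise_op 0 (pow_prod s) lam - pow_prod s lam - der symbol0 s lam).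
Proof.
apply: (@filt2_ext _ _ (fun lam y =>
   \sum_(i < N) ut lam i * (pw_shift al s lam (z lam i) - pow_prod s lam - pw_shift_lin al s lam (z lam i)) +
   der (fun k lam => \sum_(i < N) ut lam i * (1 * pow_diff al k (z lam i)) - symbol0 k lam) s lam)).
  apply: filt2_add; first exact: (filt_sum_ut (filt2_pw_shift2 s A_al)).
  exact: (filt_der s filt_symbol0).
move=> lam y sl; rewrite raise_op_pow_prod // derB -(sum_ut_pw_shift_lin (fun=> 1)) addrA; congr (_ - _).
have e : pow_prod s lam = ut_moment 0 lam * pow_prod s lam by rewrite ut_moment0 // mul1r.
rewrite [X in _ - X = _]e /ut_moment mulr_suml -sumrB -big_split /=.
by apply: eq_bigr => i _; rewrite !expr0; ring.
Qed.

Lemma filt_raise_op1_pow_prod s : filt 2 (sumn s) (fun lam => raise_op 1 (pow_prod s) lam - der symbol1 s lam).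
Proof.
have gt := filt2_pw_shift2 s A_al.
apply: (@filt2_ext _ _ (fun lam y =>
   (\sum_(i < N) ut lam i * (z lam i * (pw_shift al s lam (z lam i) - pow_prod s lam - pw_shift_lin al s lam (z lam i)))
  + \sum_(i < N) ut lam i * (pw_shift al s lam (z lam i) - pow_prod s lam - pw_shift_lin al s lam (z lam i))) +
   der (fun k lam => \sum_(i < N) ut lam i * ((z lam i + 1) * pow_diff al k (z lam i)) - symbol1 k lam) s lam)).
  apply: filt2_add; last exact: (filt_der s filt_symbol1).
  by apply: filt2_add; [exact: (filt_sum_utz gt) | exact: (filt_sum_ut gt)].
move=> lam y sl; rewrite raise_op_pow_prod // derB -(sum_ut_pw_shift_lin (fun y => y + 1)) addrA; congr (_ - _).
(* The multiple of p_s by the mean of z_i + 1, which is zero, is subtracted so that the differences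
   of shifts can be formed. *)
have e : (ut_moment 1 lam + ut_moment 0 lam) * pow_prod s lam = 0 by rewrite ut_moment1 // ut_moment0 // addNr mul0r.
rewrite -[LHS]subr0 -[X in _ - X = _]e {e} /ut_moment -big_split mulr_suml -sumrB.
rewrite -!big_split; apply: eq_bigr => i _ /=; rewrite !expr1 expr0; ring.
Qed.
End Filtration.

(** * Normal forms in power sums; symmetric polynomials *)

Lemma sum_parts_le_pred1 d (tau : intpart) (g : intpart -> F) : (weight tau <= d)%N ->
  \sum_(rho <- parts_le d | tau == rho) g rho = g tau.
Proof.
move=> le; rewrite big_mkcond /= (bigD1_seq tau) ?mem_parts_le ?parts_le_uniq //= eqxx.
by rewrite big1 ?addr0 // => rho; rewrite eq_sym => /negPf ->.
Qed.

Lemma parts_le_widen d D (g : intpart -> F) : (d <= D)%N ->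
  (forall rho, (d < weight rho)%N -> g rho = 0) ->
  \sum_(rho <- parts_le D) g rho = \sum_(rho <- parts_le d) g rho.
Proof.
move=> le g0; rewrite (bigID (fun rho => weight rho <= d)%N) /= [X in _ + X]big1 ?addr0.
  rewrite -big_filter; apply: perm_big; apply: uniq_perm.
  - by rewrite filter_uniq ?parts_le_uniq.
  - exact: parts_le_uniq.
  - by move=> rho; rewrite mem_filter !mem_parts_le andb_idr // => /leq_trans; apply.
by move=> rho; rewrite -ltnNge => /g0.
Qed.

Definition pw_comb (d : nat) (c : intpart -> F) lam : F :=
  \sum_(rho <- parts_le d) c rho * pow_prod rho lam.

Lemma pw_comb_widen d D c lam : (d <= D)%N -> (forall rho, (d < weight rho)%N -> c rho = 0) ->
  pw_comb D c lam = pw_comb d c lam.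
Proof. by move=> le c0; apply: parts_le_widen => // rho /c0 ->; rewrite mul0r. Qed.

Lemma pw_combB d c c' lam : pw_comb d c lam - pw_comb d c' lam = pw_comb d (fun rho => c rho - c' rho) lam.
Proof. by rewrite /pw_comb -sumrB; apply: eq_bigr => rho _; rewrite mulrBl. Qed.

Lemma pow_prod_mkpart s lam : pow_prod s lam = N%:R ^+ count_mem 0%N s * pow_prod (mkpart s) lam.
Proof.
rewrite /pow_prod (perm_big _ (perm_mkpart s)) /= big_filter.
elim: s => [|k s IH]; first by rewrite !big_nil mulr1.
by rewrite !big_cons IH; case: k => [|k] /=; rewrite ?pow_sum0 ?add0n ?exprS; ring.
Qed.

(** Parts 0 become powers of N, since p_0 = N, and terms with the same sorted index are collected;
    this stays within A. *)
Lemma filt_normal A c0 d D f : coef_ring A -> (d <= D)%N -> filt A c0 d f ->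
  exists c, [/\ forall rho, A (c rho), forall rho, (d < weight rho + c0)%N -> c rho = 0 &
    forall lam, (size lam < N)%N -> f lam = pw_comb D c lam].
Proof.
move=> AR le [l lP E].
pose g (x : F * seq nat * nat) := x.1.1 * 0 ^+ x.2 * N%:R ^+ count_mem 0%N x.1.2.
exists (fun rho => \sum_(x <- l | mkpart x.1.2 == rho) g x); split.
- move=> rho; apply: A_sum => // x /lP [Ax _] _; apply: A_mul => //.
    by apply: A_mul => //; apply: A_exp => //; exact: A_0.
  by apply: A_exp => //; exact: A_nat.
- move=> rho lt; rewrite big_seq_cond big1 // => x /andP[/lP [_ b] /eqP e].
  by move: lt; rewrite -e weight_mkpart; move: b => /=; lia.
- move=> lam sl; rewrite (E _ 0) // /pw_comb.
  under [RHS]eq_bigr => rho _ do rewrite mulr_suml big_mkcond.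
  rewrite exchange_big /= big_seq [RHS]big_seq; apply: eq_bigr => x /lP [_ b].
  rewrite -big_mkcond /= sum_parts_le_pred1 ?weight_mkpart.
    by rewrite pow_prod_mkpart /g; ring.
  by move: b => /=; lia.
Qed.

Lemma filt_pw_comb A d c : coef_ring A -> (forall rho, (weight rho <= d)%N -> A (c rho)) ->
  filt A 0 d (pw_comb d c).
Proof.
move=> AR Ac; apply: (filt2_sum (G := fun rho lam y => c rho * pow_prod rho lam)) => // rho.
rewrite mem_parts_le => le _; apply: filt2_scale => //; first exact: Ac.
by apply: filt2_le (filt_pow_prod AR rho); rewrite -/(weight rho); lia.
Qed.

Definition any_coef (x : F) : Prop := True.
Lemma any_coef_ring : coef_ring any_coef. Proof. by []. Qed.

Lemma revprod_mesym n (x : 'I_n -> F) k :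
  (revprod (index_enum 'I_n) xpredT x)`_k = (-1) ^+ k * (mesym n F k).@[x].
Proof.
rewrite /revprod (eq_bigr (fun i => - x i *: 'X + 1)) => [|i _]; last first.
  by rewrite scaleNr addrC.
rewrite (bigA_distr _ _ (fun i => - x i *: 'X) (fun=> 1)) coef_sum /mesym rmorph_sum.
rewrite mulr_sumr /= [RHS]big_mkcond /=; apply: eq_bigr => J _.
rewrite -big_mkcond /= rmorph_prod /=.
have -> : \prod_(i in J) (- x i *: 'X) = ((-1) ^+ #|J| * \prod_(i in J) x i) *: 'X^#|J|.
  rewrite -mul_polyC rmorphM rmorphXn /= rmorph_prod /= rmorphN1.
  rewrite -!prodr_const -!big_split /=; apply: eq_bigr => i _.
  by rewrite -mul_polyC rmorphN /=; ring.
rewrite coefZ coefXn eq_sym; case: eqP => [->|_]; last by rewrite mulr0.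
by rewrite mulr1; congr (_ * _); apply: eq_bigr => i _; rewrite mevalXU.
Qed.

(** Newton's identities, as the case of an empty denominator. *)
Lemma mesym_rec lam k : k%:R * ((-1) ^+ k * (mesym N F k).@[fun i => z lam i]) =
  \sum_(j < k) - pow_sum j.+1 lam *
     ((-1) ^+ (k - j.+1) * (mesym N F (k - j.+1)).@[fun i => z lam i]).
Proof.
have := @newton_quotient F 'I_N 'I_0 (index_enum 'I_N) xpredT (fun i => z lam i) [::] xpredT
  (fun=> 0) (revprod (index_enum 'I_N) xpredT (fun i => z lam i)) k.
rewrite {1}/revprod big_nil mul1r subrr dvdp0 => /(_ isT k (leqnn k)).
rewrite revprod_mesym => ->; apply: eq_bigr => j _; rewrite revprod_mesym.
by rewrite /psum big_nil sub0r.
Qed.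

Lemma filt_mesym k : filt any_coef 0 k (fun lam => (mesym N F k).@[fun i => z lam i]).
Proof.
elim/ltn_ind: k => -[|k] IH.
  by apply: filt_ext (filt2_const (I : any_coef 1)) _ => lam _; rewrite mesym0E meval1.
pose G (j : 'I_k.+1) lam (y : F) := - pow_sum j.+1 lam * ((-1) ^+ (k.+1 - j.+1) *
   (mesym N F (k.+1 - j.+1)).@[fun i => z lam i]).
apply: (@filt2_ext _ _ _ (fun lam y => ((-1) ^+ k.+1 * k.+1%:R^-1) * \sum_(j < k.+1) G j lam y)); last first.
  move=> lam y _; rewrite -mesym_rec -mulrA mulKf ?natr_neq0 // mulrA -expr2.
  by rewrite sqrr_sign mul1r.
apply: filt2_scale => //; apply: filt2_sum => // j _ _.
apply: filt2_le (filt2_mul any_coef_ring (filt2_opp any_coef_ring (filt_pow_sum any_coef_ring j.+1))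
   (filt2_scale any_coef_ring (I : any_coef ((-1) ^+ (k.+1 - j.+1))) (IH (k.+1 - j.+1)%N _))).
  by have := ltn_ord j; lia.
by have := ltn_ord j; lia.
Qed.

Lemma filt_exp d f m : filt any_coef 0 d f -> filt any_coef 0 (m * d) (fun lam => f lam ^+ m).
Proof.
move=> ff; elim: m => [|m IH].
  by apply: filt2_ext (filt2_const (I : any_coef 1)) _ => lam y _; rewrite expr0.
by apply: filt2_ext (filt2_mul any_coef_ring ff IH) _ => lam y _; rewrite exprS.
Qed.

Lemma filt_prod (I : Type) (r : seq I) (d : I -> nat) (f : I -> intpart -> F) :
  (forall i, filt any_coef 0 (d i) (f i)) ->
  filt any_coef 0 (\sum_(i <- r) d i) (fun lam => \prod_(i <- r) f i lam).
Proof.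
move=> ff; elim: r => [|i r IH].
  by rewrite big_nil; apply: filt2_ext (filt2_const (Logic.I : any_coef 1)) _ => lam y _; rewrite big_nil.
rewrite big_cons; apply: filt2_ext (filt2_mul any_coef_ring (ff i) IH) _ => lam y _.
by rewrite big_cons.
Qed.

(** The fundamental theorem comes with a weight bound, which controls the degree after the
    elementary symmetric polynomials are expressed in power sums. *)
Lemma filt_symmetric (g : {mpoly F[N]}) d : g \is symmetric -> (msize g <= d.+1)%N ->
  filt any_coef 0 d (fun lam => g.@[fun i => z lam i]).
Proof.
move=> /sym_fundamental [t [<- wt_t]] sg.
pose G (m : 'X_{1..N}) lam (y : F) := t@_m *
   \prod_(i < N) (mesym N F i.+1).@[fun i => z lam i] ^+ m i.
apply: (@filt2_ext _ _ _ (fun lam y => \sum_(m <- msupp t) G m lam y)); last first.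
  move=> lam y _; rewrite comp_mpoly_meval mevalE; apply: eq_bigr => m _.
  by congr (_ * _); apply: eq_bigr => i _; rewrite tnth_mktuple.
apply: filt2_sum => // m mt _; apply: filt2_scale => //.
apply: filt2_le (filt_prod (index_enum 'I_N) (fun i => filt_exp (m i) (filt_mesym i.+1))).
have H := leq_trans (mmeasure_mnm_lt _ mt) (leq_trans wt_t sg).
by rewrite !add0n; exact: H.
Qed.

(** * Hook products under the addition of a box *)

(* The factor of a box of arm a and leg l in H (e = false) or H' (e = true). *)
Definition box_hook (e : bool) (a l : nat) : F := al * (a + e)%:R + (l + ~~ e)%:R.

Lemma box_hook_neq0 e a l : box_hook e a l != 0.
Proof.
rewrite /box_hook !pmulrn lin_neq0 //.
by case: e; [rewrite addn1 | rewrite orbC addn1].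
Qed.

Definition row_hooks (e : bool) lam (r : nat) : F :=
  \prod_(0 <= j < part lam r.+1)
     box_hook e (part lam r.+1 - j.+1) (conj_part lam j.+1 - r.+1).

Lemma row_hooks_neq0 e lam r : row_hooks e lam r != 0.
Proof. by rewrite prodf_seq_neq0; apply/allP => j _; exact: box_hook_neq0. Qed.

Lemma conj_part_sum lam j : (size lam <= N)%N ->
  conj_part lam j.+1 = (\sum_(r < N) (j < part lam r.+1))%N.
Proof.
move=> sN; rewrite /conj_part -sum1_count (big_nth 0%N) big_mkord.
rewrite (big_ord_widen_cond _ (fun i => j < nth 0 lam i)%N (fun=> 1%N) sN).
rewrite big_mkcond; apply: eq_bigr => i _; rewrite /part /=.
case: (ltnP i (size lam)) => [_|le]; rewrite ?(andbT, andbF) ?(nth_default _ le) //.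
Qed.

Section AddBox.
Variables (lam : intpart) (i : 'I_N).
Hypotheses (sl : (size lam < N)%N) (ad : addable lam i).
Let kap := inc N lam i.
Let m := part lam i.+1.

Lemma conj_part_inc j : conj_part kap j.+1 = (conj_part lam j.+1 + (j == m))%N.
Proof.
rewrite !conj_part_sum ?size_inc ?(ltnW sl) //.
rewrite (bigD1 i) //= [in RHS](bigD1 i) //= part_inc // eqxx -/m.
rewrite (eq_bigr (fun r : 'I_N => (j < part lam r.+1) : nat)) => [|r]; first by lia.
by rewrite -val_eqE /= part_inc // => /negPf ->; rewrite addn0.
Qed.

Lemma conj_part_new : conj_part lam m.+1 = i.
Proof.
have -> : nat_of_ord i = i.+1.-1 by [].
apply: conj_partE => //; move: ad; rewrite /addable /= => /orP[/eqP ->|]; [by left|by right].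
Qed.

(** Only the box in the column of the new box changes: its leg grows by one. *)
Lemma row_hooks_above e r : (r < i)%N ->
  row_hooks e kap r = row_hooks e lam r * (box_hook e (part lam r.+1 - m.+1) (i - r) /
                                 box_hook e (part lam r.+1 - m.+1) (i - r.+1)).
Proof.
move=> lt_r; have rN : (r < N)%N by exact: ltn_trans lt_r (ltn_ord i).
have lt_m : (m < part lam r.+1)%N.
  move: ad; rewrite /addable => /orP[/eqP i0|lt]; first by rewrite i0 in lt_r.
  by apply: leq_trans lt _; apply: part_leq; lia.
rewrite /row_hooks /kap part_inc // (_ : (r == i :> nat) = false) ?addn0; last by lia.
rewrite !big_mkord (bigD1 (Ordinal lt_m)) //= [in RHS](bigD1 (Ordinal lt_m)) //=.
rewrite -/kap conj_part_inc conj_part_new eqxx.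
rewrite (eq_bigr (fun j : 'I_(part lam r.+1) =>
   box_hook e (part lam r.+1 - j.+1) (conj_part lam j.+1 - r.+1))); last first.
  by move=> j; rewrite -val_eqE /= conj_part_inc => /negPf ->; rewrite addn0.
rewrite addn1 subSS; set X := box_hook e _ (i - r.+1); have X0 : X != 0 by exact: box_hook_neq0.
by field.
Qed.

Lemma row_hooks_below e r : (i < r < N)%N -> row_hooks e kap r = row_hooks e lam r.
Proof.
move=> /andP[lt_r rN]; rewrite /row_hooks /kap part_inc // (_ : (r == i :> nat) = false) ?addn0; last by lia.
rewrite !big_mkord; apply: eq_bigr => j _; rewrite -/kap conj_part_inc.
have le : (part lam r.+1 <= m)%N by apply: part_leq; lia.
by rewrite (_ : _ == m = false) ?addn0 //; have := ltn_ord j; lia.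
Qed.

(** Boxes of row i in columns of equal height share their leg, so increasing their arms by one
    changes the product only at the two ends. *)
Lemma box_hook_telescope e l a b : (a <= b <= m)%N ->
  \prod_(a <= j < b) box_hook e (m - j) l =
  \prod_(a <= j < b) box_hook e (m - j.+1) l * (box_hook e (m - a) l / box_hook e (m - b) l).
Proof.
move=> /andP[ab bm]; elim: b ab bm => [|b IH] ab bm.
  by move: ab; rewrite leqn0 => /eqP ->; rewrite !big_geq // divff ?mul1r // box_hook_neq0.
move: ab; rewrite leq_eqVlt => /orP[/eqP ->|ab].
  by rewrite !big_geq // divff ?mul1r // box_hook_neq0.
rewrite !big_nat_recr //= IH //; last exact: ltnW.
by field; rewrite !box_hook_neq0.
Qed.

Definition row_ratio e (k : nat) : F := box_hook e 0 0 *
  \prod_(i <= l < k) (box_hook e (m - part lam l.+2) (l - i) / box_hook e (m - part lam l.+1) (l - i)).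

(** Induction over the blocks of columns of equal height, from the new box leftwards: the columns
    between [part lam k.+2] and [part lam k.+1] have height k + 1. *)
Lemma row_hooks_same_aux e k : (i <= k)%N ->
  \prod_(part lam k.+1 <= j < m.+1) box_hook e (m - j) (conj_part kap j.+1 - i.+1) =
  \prod_(part lam k.+1 <= j < m) box_hook e (m - j.+1) (conj_part lam j.+1 - i.+1) * row_ratio e k.
Proof.
elim: k => [|k IH].
  rewrite leqn0 => /eqP i0; rewrite /row_ratio i0 (_ : part lam 1 = m) /m ?i0 //.
  by rewrite big_nat1 !big_geq // conj_part_inc /m i0 eqxx -i0 conj_part_new subnn i0 subnn mul1r mulr1.
rewrite leq_eqVlt => /orP[/eqP ik|ik].
  rewrite /row_ratio -ik -/m big_nat1 !big_geq // conj_part_inc eqxx conj_part_new addn1 !subnn.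
  by rewrite mul1r mulr1.
have le1 : (part lam k.+2 <= part lam k.+1)%N by apply: part_leq; lia.
have le2 : (part lam k.+1 <= m)%N by apply: part_leq; lia.
rewrite (big_cat_nat (n := part lam k.+1)) //=; last exact: leqW.
rewrite IH // [in RHS](big_cat_nat (n := part lam k.+1)) //=.
have cl j : (part lam k.+2 <= j < part lam k.+1)%N -> conj_part lam j.+1 = k.+1.
  move=> /andP[lo hi]; have -> : k.+1 = k.+2.-1 by [].
  by apply: conj_partE => //; right.
rewrite [X in X * _ = _](@eq_big_nat _ _ _ _ _ _ (fun j => box_hook e (m - j) (k - i))); last first.
  move=> j jj; rewrite conj_part_inc (cl j jj) (_ : j == m = false) ?addn0 ?subSS //.
  by move: jj; lia.
rewrite [X in _ = X * _ * _](@eq_big_nat _ _ _ _ _ _ (fun j => box_hook e (m - j.+1) (k - i))); last first.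
  by move=> j jj; rewrite (cl j jj) subSS.
rewrite box_hook_telescope ?le1 // /row_ratio big_nat_recr //=.
ring.
Qed.

Lemma row_hooks_same e : row_hooks e kap i = row_hooks e lam i * row_ratio e N.
Proof.
have := @row_hooks_same_aux e N (ltnW (ltn_ord i)).
have -> : part lam N.+1 = 0%N by rewrite /part nth_default // ltnW.
rewrite /row_hooks /kap part_inc // eqxx addn1 -/m => <-.
by apply: eq_bigr => j _; rewrite subSS.
Qed.

Definition above_ratio e (r : nat) : F := box_hook e (part lam r.+1 - m.+1) (i - r) /
                                 box_hook e (part lam r.+1 - m.+1) (i - r.+1).

Lemma prod_row_hooks_inc e : \prod_(r < N) row_hooks e kap r =
  \prod_(r < N) row_hooks e lam r * (\prod_(0 <= r < i) above_ratio e r * row_ratio e N).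
Proof.
rewrite -(big_mkord xpredT (row_hooks e kap)) -(big_mkord xpredT (row_hooks e lam)).
have iN := ltn_ord i; have iN' := ltnW iN.
rewrite !(big_cat_nat (m := 0) (n := i) (p := N)) //= !(big_ltn (m := i) (n := N)) // row_hooks_same.
rewrite (@eq_big_nat _ _ _ 0 i (row_hooks e kap) (fun r => row_hooks e lam r * above_ratio e r)) => [|r /andP[_ ri]]; last exact: row_hooks_above.
rewrite (@eq_big_nat _ _ _ i.+1 N (row_hooks e kap) (row_hooks e lam)) => [|r ri]; last exact: row_hooks_below.
by rewrite big_split /=; ring.
Qed.

Lemma box_hook_z e k l : (part lam k.+1 <= m)%N -> (i <= l)%N ->
  box_hook e (m - part lam k.+1) (l - i) =
   z lam i - z lam k + (if e then al else 0) + l%:R - k%:R + (~~ e)%:R.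
Proof.
move=> le il; rewrite /box_hook !natrD natrB // natrB // /z -!natr1.
by case: e => /=; rewrite ?mulr0n ?mulr1n /m; ring.
Qed.

(** The numerator of index l involves z_(l+1), the denominator z_l. After regrouping, the first
    denominator cancels the hook of the new box and the numerator with z_N is left over. *)
Lemma row_ratio_z e : let w := if e then al else 0 in
  row_ratio e N = (z lam i - z lam N + w - e%:R) *
   \prod_(i.+1 <= k < N) ((z lam i - z lam k + w - e%:R) / (z lam i - z lam k + w + (~~ e)%:R)).
Proof.
move=> w; have iN := ltn_ord i.
have E1 l : (i <= l)%N -> box_hook e (m - part lam l.+2) (l - i) = z lam i - z lam l.+1 + w - e%:R.
  move=> il; rewrite box_hook_z //; last by apply: part_leq; lia.
  by rewrite /w -!natr1; case: (e) => /=; ring.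
have E2 l : (i <= l)%N -> box_hook e (m - part lam l.+1) (l - i) = z lam i - z lam l + w + (~~ e)%:R.
  move=> il; rewrite box_hook_z //; last by apply: part_leq; lia.
  by rewrite /w; ring.
rewrite /row_ratio prodf_div.
rewrite (@eq_big_nat _ _ _ i N _ (fun l => z lam i - z lam l.+1 + w - e%:R)); last first.
  by move=> l /andP[/E1].
rewrite (@eq_big_nat _ _ _ i N (fun l => box_hook e (m - part lam l.+1) (l - i))
   (fun l => z lam i - z lam l + w + (~~ e)%:R)); last first.
  by move=> l /andP[/E2].
have -> : \prod_(i <= l < N) (z lam i - z lam l.+1 + w - e%:R) =
   \prod_(i.+1 <= l < N.+1) (z lam i - z lam l + w - e%:R) by rewrite big_add1.
rewrite big_nat_recr //= [X in _ / X]big_ltn // prodf_div.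
have -> : z lam i - z lam i + w + (~~ e)%:R = box_hook e 0 0.
  by rewrite subrr add0r /box_hook /w; case: (e) => /=; rewrite ?mulr0 ?mulr1 ?addr0.
have b0 := box_hook_neq0 e 0 0; set P1 := \prod_(_ <= _ < _) _; set P2 := \prod_(_ <= _ < _) _.
have P20 : P2 != 0.
  rewrite /P2 prodf_seq_neq0; apply/allP => l; rewrite mem_index_iota => /andP[il _].
  by rewrite -E2 ?box_hook_neq0 // ltnW.
by field; rewrite P20 b0.
Qed.

Lemma above_ratio_z e r : (r < i)%N -> above_ratio e r =
   (z lam i - z lam r + (if e then 0 else al) - (~~ e)%:R) /
   (z lam i - z lam r + (if e then 0 else al) + e%:R).
Proof.
move=> ri; have lt_m : (m < part lam r.+1)%N.
  move: ad; rewrite /addable => /orP[/eqP i0|lt]; first by rewrite i0 in ri.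
  by apply: leq_trans lt _; apply: part_leq; lia.
have B l : box_hook e (part lam r.+1 - m.+1) l =
   - (al * (m%:R - (part lam r.+1)%:R + (~~ e)%:R) - l%:R - (~~ e)%:R).
  by rewrite /box_hook !natrD natrB //; case: (e) => /=; rewrite -natr1 ?mulr0n ?mulr1n; ring.
rewrite /above_ratio !B invrN mulrNN natrB ?(ltnW ri) // natrB //.
congr (_ / _); rewrite /z -/m -!natr1; case: (e) => /=; ring.
Qed.

Lemma hook_ratio :
  ut lam i * (\prod_(r < N) row_hooks false kap r * \prod_(r < N) row_hooks true kap r) =
  al * wt kap i * (\prod_(r < N) row_hooks false lam r * \prod_(r < N) row_hooks true lam r).
Proof.
have iN := ltn_ord i; have iN' := ltnW iN.
have zN : z lam N = - N%:R - 1.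
  by rewrite /z /part nth_default ?(ltnW sl) // mulr0 add0r -natr1 opprD.
have split (f : nat -> F) : \prod_(j < N | j != i) f j =
    \prod_(0 <= j < i) f j * \prod_(i.+1 <= j < N) f j.
  rewrite (eq_bigl (fun j : 'I_N => (j : nat) != i)) // -(big_mkord (fun j => j != i) f).
  rewrite (big_cat_nat (n := i)) //= [X in _ * X]big_ltn_cond // eqxx /=; congr (_ * _).
    by apply: congr_big_nat => // j /andP[_ ji]; rewrite neq_ltn ji.
  by apply: congr_big_nat => // j /andP[ij _]; rewrite neq_ltn ij orbT.
(* In H the rows above contribute f3 / f2 and the rows below f0 / f1; in H' it is the other way
   round. Together they give f3 / f2 and f0 / f1 over all rows other than i, the product in [wt] and
   the inverse of the one in [ut]. *)
pose f0 r := z lam i - z lam r; pose f1 r := z lam i - z lam r + 1.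
pose f2 r := z lam i - z lam r + al; pose f3 r := z lam i - z lam r + al - 1.
have wE : wt kap i = al^-1 * (z lam i + al + N%:R) * \prod_(j < N | j != i) (f3 j / f2 j).
  have zi : z kap i = z lam i + al by rewrite /kap z_inc // eqxx mulr1.
  rewrite /wt zi; congr (_ * _); apply: eq_bigr => j; rewrite -val_eqE /= => ji.
  by rewrite /f3 /f2 /kap z_inc // (negPf ji) mulr0 addr0 (addrAC _ al).
have uE : ut lam i = (z lam i + N%:R + 1)^-1 * \prod_(j < N | j != i) (f1 j / f0 j) by [].
have A0 : \prod_(0 <= r < i) above_ratio false r = \prod_(0 <= r < i) (f3 r / f2 r).
  by apply: eq_big_nat => r /andP[_ ri]; rewrite above_ratio_z //= addr0.
have A1 : \prod_(0 <= r < i) above_ratio true r = \prod_(0 <= r < i) (f0 r / f1 r).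
  by apply: eq_big_nat => r /andP[_ ri]; rewrite above_ratio_z //= subr0 addr0.
have T0 : row_ratio false N = (z lam i + N%:R + 1) * \prod_(i.+1 <= r < N) (f0 r / f1 r).
  rewrite row_ratio_z zN /= subr0 addr0 opprD !opprK addrA; congr (_ * _).
  by apply: eq_bigr => r _; rewrite subr0 addr0.
have T1 : row_ratio true N = (z lam i + al + N%:R) * \prod_(i.+1 <= r < N) (f3 r / f2 r).
  rewrite row_ratio_z zN /=; congr (_ * _); first by ring.
  by apply: eq_bigr => r _; rewrite addr0.
have zn0 := z_addN1_neq0 lam iN.
have nz (f : nat -> F) (a b : nat) : (forall r, (r < N)%N -> (r != i :> nat) -> f r != 0) ->
    (b <= N)%N -> (i < a)%N || (b <= i)%N -> \prod_(a <= r < b) f r != 0.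
  move=> f_n0 bN ab; rewrite prodf_seq_neq0; apply/allP => r; rewrite mem_index_iota => rab.
  by apply: f_n0; lia.
have f0n r : (r < N)%N -> (r != i :> nat) -> f0 r != 0.
  by move=> _ ri; rewrite subr_eq0; apply: contra ri => /eqP /z_inj ->.
(* A zero would force r = i - 1 with equal parts, against addability. *)
have f1n r : (r < N)%N -> (r != i :> nat) -> f1 r != 0.
  move=> _ ri; rewrite /f1 zB -addrA -[1]/(1%:~R) -rmorphD /=.
  apply/eqP => /al_free [/eqP]; rewrite subr_eq0 eqz_nat => /eqP e1 e2.
  have ir : nat_of_ord i = r.+1 by lia.
  by move: ad; rewrite /addable ir /= -e1 ir ltnn.
rewrite !prod_row_hooks_inc A0 A1 T0 T1 wE uE (split (fun j => f1 j / f0 j)) (split (fun j => f3 j / f2 j)).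
set q := \prod_(0 <= _ < _) (f3 _ / _); set q' := \prod_(_ <= _ < _) (f3 _ / _).
rewrite !prodf_div.
have := nz f0 0%N i f0n (ltnW iN); have := nz f0 i.+1 N f0n (leqnn _).
have := nz f1 0%N i f1n (ltnW iN); have := nz f1 i.+1 N f1n (leqnn _).
rewrite !leqnn !orbT /= => /(_ isT) + /(_ isT) + /(_ isT) + /(_ isT).
set g0 := \prod_(0 <= _ < _) f0 _; set g0' := \prod_(_ <= _ < _) f0 _.
set g1 := \prod_(0 <= _ < _) f1 _; set g1' := \prod_(_ <= _ < _) f1 _.
move=> n1 n2 n3 n4; set r1 := \prod_(_ < _) _; set r2 := \prod_(_ < _) _.
move: zn0; set zn := z lam i + N%:R + 1 => zn0; set zm := z lam i + al + N%:R.
by field; rewrite ?zn0 ?n1 ?n2 ?n3 ?n4 ?al_neq0.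
Qed.
End AddBox.

Definition jack_norm lam : F :=
  al ^- weight lam * (\prod_(r < N) row_hooks false lam r * \prod_(r < N) row_hooks true lam r).

Lemma jack_norm_neq0 lam : jack_norm lam != 0.
Proof.
rewrite mulf_neq0 ?invr_eq0 ?expf_neq0 ?al_neq0 //.
by rewrite mulf_neq0 // prodf_seq_neq0; apply/allP => r _; exact: row_hooks_neq0.
Qed.

Lemma jack_norm_nil : jack_norm (mkpart [::]) = 1.
Proof.
have p0 j : part (mkpart [::]) j = 0%N by rewrite /part nth_default.
rewrite /jack_norm weight_mkpart expr0 invr1 mul1r !big1 ?mulr1 // => r _;
  by rewrite /row_hooks p0 big_geq.
Qed.

(** With respect to the norms, adding a box with weight [ut] is adjoint to removing it with weight
    [wt]. *)
Lemma jack_norm_ratio lam (i : 'I_N) : (size lam < N)%N -> addable lam i ->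
  ut lam i * jack_norm (inc N lam i) = wt (inc N lam i) i * jack_norm lam.
Proof.
move=> sl ad; have := hook_ratio sl ad; rewrite /jack_norm weight_inc ?(ltnW sl) //.
move=> E; rewrite mulrCA E exprS invfM.
by field; rewrite ?expf_neq0 ?al_neq0.
Qed.

(** * Pivots in the shifted variables *)

Section Pivot.
Variables (i k : nat) (sig tau : intpart).
Hypotheses (mv : box_move i k sig tau) (ss : (size sig <= N)%N) (st : (size tau <= N)%N).

Let kN : (k.-1 < N)%N.
Proof.
have [/andP[i0 ik] _ tk _] := mv.
by rewrite (leq_trans _ st) // -part_gt0 prednK ?tk //; lia.
Qed.

Let iN : (i.-1 < N)%N.
Proof. by have [/andP[i0 ik] _ _ _] := mv; lia. Qed.

(** Stated without subtraction, to cover parts in [nat] as well as powers of the z_j in F. *)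
Lemma sum_box_move (T : nmodType) (f g : nat -> T) :
  (forall j, j != i.-1 -> j != k.-1 -> f j = g j) ->
  \sum_(j < N) f j + (g i.-1 + g k.-1) = \sum_(j < N) g j + (f i.-1 + f k.-1).
Proof.
move=> fg; have ne : Ordinal kN != Ordinal iN.
  by have [/andP[i0 ik] _ _ _] := mv; rewrite -val_eqE /=; lia.
rewrite (bigD1 (Ordinal iN)) //= (bigD1 (Ordinal kN)) //=.
rewrite [in RHS](bigD1 (Ordinal iN)) //= [in RHS](bigD1 (Ordinal kN)) //=.
set S := \sum_(_ < _ | _) _; have -> : \sum_(j < N | (j != Ordinal iN) && (j != Ordinal kN)) g j = S.
  by apply: eq_bigr => j /andP[]; rewrite -!val_eqE /= => ji jk; rewrite fg.
rewrite [f i.-1 + _]addrA [g i.-1 + (_ + S)]addrA [LHS]addrAC [RHS]addrAC.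
by congr (_ + _); rewrite addrC.
Qed.

Lemma box_move_part j : j != i.-1 -> j != k.-1 -> part tau j.+1 = part sig j.+1.
Proof. by have [/andP[i0 ik] _ _ E] := mv => ji jk; apply: E => //; lia. Qed.

Lemma box_move_weight : weight sig = weight tau.
Proof.
have [/andP[i0 ik] si tk _] := mv; rewrite (weight_part ss) (weight_part st).
have : (\sum_(j < N) part sig j.+1 + (part tau i.-1.+1 + part tau k.-1.+1) =
        \sum_(j < N) part tau j.+1 + (part sig i.-1.+1 + part sig k.-1.+1))%N.
  apply: (@sum_box_move nat (fun j => part sig j.+1) (fun j => part tau j.+1)).
  by move=> j ji jk; rewrite box_move_part.
by rewrite !prednK; [rewrite si tk; lia | lia..].
Qed.

Definition move_hook : F :=
  al * ((part sig i)%:R - (part sig k)%:R - 1) + (k%:R - i%:R).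

Lemma move_hook_neq0 : move_hook != 0.
Proof.
have [/andP[i0 ik] si tk E] := mv.
have -> : move_hook = al * ((part sig i)%:Z - (part sig k)%:Z - 1)%:~R + (k%:Z - i%:Z)%:~R.
  by rewrite /move_hook !rmorphB /= -!pmulrn.
by rewrite lin_neq0 //; lia.
Qed.

(** Modulo the hook, the two rows exchange their shifted variables. *)
Lemma z_box_move : z sig i.-1 = z tau k.-1 + move_hook /\ z tau i.-1 = z sig k.-1 + move_hook.
Proof.
have [/andP[i0 ik] si tk _] := mv.
rewrite /z /move_hook !prednK; [|lia..]; rewrite tk si -!natr1.
by split; ring.
Qed.

Lemma pow_sum_box_move e : pow_sum e sig =
  pow_sum e tau + (pow_diff move_hook e (z tau k.-1) - pow_diff move_hook e (z sig k.-1)).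
Proof.
have [zi zt] := z_box_move.
have := @sum_box_move F (fun j => z sig j ^+ e) (fun j => z tau j ^+ e).
rewrite zi zt /pow_sum /pow_diff => E; apply: (addIr ((z sig k.-1 + move_hook) ^+ e + z tau k.-1 ^+ e)).
rewrite E; first by ring.
by move=> j ji jk; rewrite /z box_move_part.
Qed.

Lemma pow_diff_div (A : F -> Prop) e h y : coef_ring A -> A h -> A y -> exists2 q, A q & pow_diff h e y = h * q.
Proof.
move=> AR Ah Ay; rewrite /pow_diff subrXX addrAC subrr add0r.
eexists; last by []; apply: A_sum => // j _ _.
by apply: A_mul => //; apply: A_exp => //; apply: A_add.
Qed.
End Pivot.

(** * Functions with the vanishing property *)

Section Jack.
Variable Jv : intpart -> intpart -> F.
Hypothesis filt_Jv : forall kap, (weight kap < N)%N -> filt any_coef 0 (weight kap) (Jv kap).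
Hypothesis Jv_diag : forall kap, (weight kap < N)%N -> Jv kap kap = jack_norm kap.
Hypothesis Jv_van : forall kap lam, (weight kap < N)%N -> lam != kap ->
  (weight lam <= weight kap)%N -> Jv kap lam = 0.

Lemma Jv_pw_comb kap : (weight kap < N)%N ->
  exists c, forall lam, (size lam < N)%N -> Jv kap lam = pw_comb (weight kap) c lam.
Proof.
by move=> kN; have [c [_ _ E]] := filt_normal any_coef_ring (leqnn _) (filt_Jv kN); exists c.
Qed.

Lemma size_lt lam d : (weight lam <= d)%N -> (d < N)%N -> (size lam < N)%N.
Proof. by move=> le lt; apply: leq_ltn_trans (size_le_weight _) (leq_ltn_trans le lt). Qed.

(* The values J_kap(lam) form a triangular matrix, which is the product of the
   coefficients of the J_kap in the p_rho and of the values p_rho(lam); the latter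
   matrix is therefore invertible. *)
Lemma pw_comb_eq0 d c : (d < N)%N -> (forall lam, (weight lam <= d)%N -> pw_comb d c lam = 0) ->
  forall rho, (weight rho <= d)%N -> c rho = 0.
Proof.
move=> dN c0; set m := size (parts_le d); pose r (i : 'I_m) := nth (mkpart [::]) (parts_le d) i.
have wr i : (weight (r i) <= d)%N by rewrite -mem_parts_le mem_nth.
have r_inj : injective r.
  by move=> i j /eqP; rewrite nth_uniq ?parts_le_uniq // => /eqP /val_inj.
have r_onto rho : (weight rho <= d)%N -> exists i, rho = r i.
  rewrite -mem_parts_le => rd; rewrite -index_mem in rd.
  by exists (Ordinal rd); rewrite /r /= nth_index // -index_mem.
have sumE (g : intpart -> F) : \sum_(rho <- parts_le d) g rho = \sum_(i < m) g (r i).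
  by rewrite (big_nth (mkpart [::])) big_mkord.
have [C CE] : exists C : 'I_m -> intpart -> F,
    forall i, forall lam, (size lam < N)%N -> Jv (r i) lam = pw_comb d (C i) lam.
  apply: (fin_all_exists (P := fun i (cc : intpart -> F) =>
    forall lam, (size lam < N)%N -> Jv (r i) lam = pw_comb d cc lam)) => i; have [cc E] := Jv_pw_comb (leq_ltn_trans (wr i) dN).
  exists (fun rho => if (weight rho <= weight (r i))%N then cc rho else 0) => lam sl.
  rewrite E // (pw_comb_widen (d := weight (r i))) //; last first.
    by move=> rho; rewrite ltnNge => /negPf ->.
  by apply: eq_big_seq => rho; rewrite mem_parts_le => ->.
pose P : 'M[F]_m := \matrix_(i, j) pow_prod (r i) (r j).
pose CM : 'M[F]_m := \matrix_(i, j) C i (r j).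
have szr i : (size (r i) < N)%N by apply: (size_lt (wr i)).
have TE i j : (CM *m P) i j = Jv (r i) (r j).
  by rewrite mxE CE // /pw_comb sumE; apply: eq_bigr => k _; rewrite !mxE.
have : row_free (CM *m P).
  (* Induction on the weight of [r j]: in its column, entries of lighter rows meet coefficients
     already known to vanish, and the other off-diagonal entries are zero. *)
  apply: inj_row_free => v v0; apply/rowP => j; rewrite mxE.
  have [k] := ubnP (weight (r j)); elim: k j => // k IH j; rewrite ltnS => wj.
  have := congr1 (fun u : 'rV_m => u 0 j) v0; rewrite !mxE (bigD1 j) //= big1 ?addr0.
    rewrite TE Jv_diag ?(leq_ltn_trans (wr _)) // => /eqP.
    by rewrite mulf_eq0 (negPf (jack_norm_neq0 _)) orbF => /eqP.
  move=> i ne; rewrite TE; have [lt|le] := ltnP (weight (r i)) (weight (r j)).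
    by rewrite IH ?mul0r // (leq_trans lt).
  rewrite Jv_van ?mulr0 ?(leq_ltn_trans (wr _)) //.
  by apply: contra ne => /eqP /r_inj ->.
rewrite row_free_unit unitmx_mul => /andP[_ Pu] rho /r_onto [i ->].
have : (\row_j c (r j)) *m P = 0.
  apply/rowP => j; rewrite !mxE -[RHS](c0 _ (wr j)) /pw_comb sumE.
  by apply: eq_bigr => k _; rewrite !mxE.
move=> /(congr1 (mulmx^~ (invmx P))); rewrite mulmxK // mul0mx.
by move/rowP => /(_ i); rewrite !mxE.
Qed.

Lemma filt_any A c d f : filt A c d f -> filt any_coef c d f.
Proof. by move=> [l lP E]; exists l => // x /lP []. Qed.

(** The tool for operator identities: a degree bound and a comparison on small partitions
    suffice. *)
Lemma filt_uniq d f : (d < N)%N -> filt any_coef 0 d f ->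
  (forall lam, (weight lam <= d)%N -> f lam = 0) ->
  forall lam, (size lam < N)%N -> f lam = 0.
Proof.
move=> dN ff f0; have [c [_ _ E]] := filt_normal any_coef_ring (leqnn d) ff.
move=> lam sl; rewrite E // /pw_comb big_seq big1 // => rho; rewrite mem_parts_le => le.
rewrite (pw_comb_eq0 dN (c := c)) ?mul0r // => mu wm; rewrite -E ?f0 //.
exact: size_lt wm dN.
Qed.

Lemma lower_op_van n f d : (forall lam, (weight lam < d)%N -> f lam = 0) ->
  forall lam, (size lam < N)%N -> (weight lam <= d)%N -> lower_op n f lam = 0.
Proof.
move=> f0 lam sl wl; rewrite /lower_op big1 // => i _.
have [rm|nrm] := boolP (removable lam i); last by rewrite wt0 // mul0r.
by rewrite f0 ?mulr0 // -(weight_dec (ltnW sl) (ltn_ord i) rm).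
Qed.

(** Removing a box from a partition of size at most |kap| leads to a zero of J_kap, so there E
    multiplies J_kap by the size. Both sides have degree at most |kap|. *)
Lemma degree_op_Jv kap lam : (weight kap < N)%N -> (size lam < N)%N ->
  degree_op (Jv kap) lam = (weight kap)%:R * Jv kap lam.
Proof.
move=> kN sl; apply/eqP; rewrite -subr_eq0; apply/eqP.
pose f lam := degree_op (Jv kap) lam - (weight kap)%:R * Jv kap lam.
apply: (filt_uniq kN (f := f)) => //.
  apply: filt2_sub => //; first by apply: (filt_degree_op any_coef_ring); apply: filt_Jv.
  by apply: filt2_scale => //; apply: filt_Jv.
move=> mu wm; have sm := size_lt wm kN.
rewrite /f /degree_op (@lower_op_van 0 _ (weight kap)) ?subr0 //; last first.
  move=> nu wn; rewrite Jv_van ?(ltnW wn) //.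
  by apply: contraTneq wn => ->; rewrite ltnn.
rewrite -mulrBl; have [->|ne] := eqVneq mu kap; first by rewrite subrr mul0r.
by rewrite Jv_van // mulr0.
Qed.

(** * Integrality of leading coefficients from the symbols *)

Fixpoint lowerings (s : seq nat) : seq (nat * seq nat) :=
  if s is k :: s' then (k, k.-1 :: s') :: [seq (x.1, k :: x.2) | x <- lowerings s'] else [::].

Lemma mem_lowerings s x : x \in lowerings s ->
  exists2 r, perm_eq s (x.1 :: r) & perm_eq x.2 (x.1.-1 :: r).
Proof.
elim: s x => [|k s IH] x //=; rewrite inE => /orP[/eqP ->|/mapP [y /IH [r p1 p2] ->]] /=.
  by exists s; rewrite perm_refl.
exists (k :: r).
  apply: (@perm_trans _ (k :: y.1 :: r)); first by rewrite perm_cons.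
  by apply/permPl; exact: (perm_catCA [:: k] [:: y.1] r).
apply: (@perm_trans _ (k :: y.1.-1 :: r)); first by rewrite perm_cons.
by apply/permPl; exact: (perm_catCA [:: k] [:: y.1.-1] r).
Qed.

Lemma lowerings_rcons t k : (k, rcons t k.-1) \in lowerings (rcons t k).
Proof.
elim: t => [|j t IH] /=; first by rewrite inE.
by rewrite inE; apply/orP; right; apply/mapP; exists (k, rcons t k.-1).
Qed.

(** For h 0 = 0, the coefficient of p_tau in al^-1 times the derivation [der (symbol h)] of p_rho;
    equal parts are lowered separately. *)
Definition lowering_coef (h : nat -> nat) (rho tau : intpart) : nat :=
  \sum_(x <- lowerings rho | mkpart x.2 == tau) h x.1.

(** As [mkpart] drops a part 0, the last factor is 1 for k = 1, and not p_0 = N. *)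
Definition symbol (h : nat -> nat) (k : nat) lam : F := al * (h k)%:R * pow_prod (mkpart [:: k.-1]) lam.

Lemma pow_prod_mkpart_cons k s lam :
  pow_prod (mkpart (k :: s)) lam = pow_prod (mkpart [:: k]) lam * pow_prod (mkpart s) lam.
Proof.
rewrite /pow_prod !(perm_big _ (perm_mkpart _)) /=.
by case: k => [|k] /=; rewrite ?big_nil ?mul1r // !big_cons big_nil mulr1.
Qed.

Lemma pow_prod_mkpartN0 s lam : 0%N \notin s -> pow_prod (mkpart s) lam = pow_prod s lam.
Proof.
by move=> n0; rewrite (pow_prod_mkpart s) (count_memPn n0) expr0 mul1r.
Qed.

Lemma der_lowerings h s lam : 0%N \notin s ->
  der (symbol h) s lam = \sum_(x <- lowerings s) al * (h x.1)%:R * pow_prod (mkpart x.2) lam.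
Proof.
elim: s => [|k s IH]; first by rewrite big_nil.
rewrite inE negb_or => /andP[k0 n0]; rewrite /= big_cons /= pow_prod_mkpart_cons /symbol.
rewrite (pow_prod_mkpartN0 (s := s)) // mulrA IH // big_map mulr_sumr; congr (_ + _).
apply: eq_bigr => x _ /=; rewrite [in RHS]pow_prod_mkpart_cons (pow_prod_mkpartN0 (s := [:: k])) ?inE ?negb_or ?k0 //.
by rewrite /pow_prod big_seq1; ring.
Qed.

Lemma weight_lowerings rho x : x \in lowerings (parts rho) -> x.1 != 0%N -> weight rho = (weight (mkpart x.2)).+1.
Proof.
case/mem_lowerings => r p1 p2; rewrite weight_mkpart /weight !sumnE (perm_big _ p1) (perm_big _ p2) /=.
by rewrite !big_cons; case: x.1.
Qed.

Lemma sum_der_pw_comb h n c lam : h 0%N = 0%N ->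
  \sum_(rho <- parts_le n) c rho * der (symbol h) rho lam =
  pw_comb n (fun tau => al * \sum_(rho <- parts_le n) c rho * (lowering_coef h rho tau)%:R) lam.
Proof.
move=> sel1; have n0 rho : 0%N \notin parts rho by have /andP[] := partsP rho.
rewrite /pw_comb; under [RHS]eq_bigr => tau _ do rewrite mulr_sumr mulr_suml.
rewrite exchange_big big_seq [RHS]big_seq; apply: eq_bigr => rho.
rewrite mem_parts_le => wr; rewrite der_lowerings // mulr_sumr.
under [RHS]eq_bigr => tau _ do rewrite /lowering_coef natr_sum !mulr_sumr mulr_suml big_mkcond.
rewrite exchange_big /= big_seq [RHS]big_seq; apply: eq_bigr => x xl.
rewrite -big_mkcond /=; have [->|x0] := eqVneq x.1 0%N.
  by rewrite sel1 !(mulr0, mul0r) big1 // => tau _; rewrite !(mulr0, mul0r).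
rewrite sum_parts_le_pred1; first by ring.
by move: wr; rewrite (weight_lowerings xl x0); apply: ltnW.
Qed.

Definition sel1 (k : nat) : nat := (k == 1%N).
Definition sel2 (k : nat) : nat := if (1 < k)%N then k else 0%N.

Lemma der_ext phi psi s lam : (forall k, phi k lam = psi k lam) -> der phi s lam = der psi s lam.
Proof. by move=> E; elim: s => //= k s ->; rewrite E. Qed.

Lemma symbol0E k lam : symbol0 k lam = symbol sel1 k lam.
Proof.
rewrite /symbol0 /symbol /sel1; case: eqP => [->|_]; last by rewrite mulr0 mul0r.
by rewrite /pow_prod /= big_nil !mulr1.
Qed.

Lemma symbol1E k lam : symbol1 k lam = symbol sel2 k lam.
Proof.
rewrite /symbol1 /symbol /sel2; case: k => [|[|k]]; rewrite ?mulr0 ?mul0r //=.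
by rewrite /pow_prod /= big_seq1.
Qed.

Section Integrality.
Variable A : F -> Prop.
Hypothesis A_ring : coef_ring A.

Lemma A_cancel (k : nat) x : (0 < k)%N -> A (k%:R * x) -> A x.
Proof.
move=> k0 Akx; rewrite -[x](mulKf (natr_neq0 k0)); apply: A_mul => //.
exact: A_natV.
Qed.

(* Induction on the smallest part s of rho: lowering it gives a tau to which only
   rho and partitions with a part smaller than s contribute. *)
Lemma top_coef_integral n c : (0 < n)%N ->
  (forall tau, weight tau = n.-1 ->
     A (\sum_(rho <- parts_le n) c rho * (lowering_coef sel1 rho tau)%:R)) ->
  (forall tau, weight tau = n.-1 ->
     A (\sum_(rho <- parts_le n) c rho * (lowering_coef sel2 rho tau)%:R)) ->
  forall rho, weight rho = n -> A (c rho).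
Proof.
move=> n0 A0 A1 rho wr.
have : exists2 s, s \in parts rho & True.
  case E : (parts rho) => [|k s]; last by exists k; rewrite ?inE ?eqxx.
  by move: n0; rewrite -wr /weight E.
case=> s sr _; have [m] := ubnP s; elim: m s rho wr sr => // m IH s0 rho wr s0r ltm.
have zf (mu : intpart) : 0%N \notin parts mu by have /andP[] := partsP mu.
have [t [s E]] : exists t s, parts rho = rcons t s.
  by case/lastP: (parts rho) s0r => [//|t s] _; exists t, s.
have srt : sorted geq (rcons t s) by rewrite -E; have /andP[] := partsP rho.
have le_s : (s <= s0)%N.
  move: s0r; rewrite E mem_rcons inE => /orP[/eqP->//|s0t].
  have pt : path leq s (rev t).
    by have := rev_sorted leq (rcons t s); rewrite rev_rcons /= => ->.
  by have /allP := order_path_min leq_trans pt; apply; rewrite mem_rev.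
have s_gt0 : (0 < s)%N.
  by have := zf rho; rewrite E mem_rcons inE negb_or eq_sym -lt0n => /andP[].
pose tau := mkpart (rcons t s.-1).
have wtau : weight tau = n.-1.
  rewrite weight_mkpart -wr /weight E -!cats1 !sumn_cat /= !addn0.
  by case: (s) s_gt0 => // k _; rewrite addnS.
have rho_mem : rho \in parts_le n by rewrite mem_parts_le wr.
(* In the relation for tau the coefficient of [c rho] is a positive integer, hence invertible; all
   other terms are integral by [others]. *)
have key h : (0 < h s)%N -> (h 0 = 0)%N ->
    A (\sum_(rho <- parts_le n) c rho * (lowering_coef h rho tau)%:R) ->
    (forall mu x, mu != rho -> weight mu = n -> x \in lowerings (parts mu) -> mkpart x.2 = tau ->
       (0 < h x.1)%N -> A (c mu)) -> A (c rho).
  move=> hs hz AS others; apply: (@A_cancel (lowering_coef h rho tau)).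
    rewrite /lowering_coef (big_rem (s, rcons t s.-1)) /= ?E ?lowerings_rcons //.
    by rewrite eqxx addn_gt0 hs.
  rewrite mulrC; move: AS; rewrite (bigD1_seq rho) ?parts_le_uniq //=.
  set u := _ * _; set v := \sum_(_ <- _ | _) _ => Auv.
  rewrite -[u](addrK v); apply: (A_sub A_ring) => //.
  apply: (A_sum A_ring) => mu _ ne.
  have [->|] := eqVneq (lowering_coef h mu tau) 0%N; first by rewrite mulr0; exact: A_0.
  rewrite /lowering_coef => nz.
  have [x xl /andP[/eqP xt hx]] : exists2 x, x \in lowerings (parts mu) & (mkpart x.2 == tau) && (0 < h x.1)%N.
    apply/hasP; apply: contraNT nz => /hasPn nh.
    by apply/eqP; rewrite big_seq_cond big1 // => x /andP[xl xt]; have := nh _ xl; rewrite xt /= -eqn0Ngt => /eqP.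
  have wmu : weight mu = n.
    rewrite (weight_lowerings xl); first by rewrite xt wtau prednK.
    by apply: contraTneq hx => ->; rewrite hz.
  by apply: A_mul => //; [exact: others hx | exact: A_nat].
have eq_rho mu r : perm_eq (parts mu) (s :: r) -> perm_eq r t -> mu = rho.
  move=> p1 p2; rewrite -[mu]mkpartK -[rho]mkpartK; apply: mkpart_perm.
  rewrite !filter_parts E (perm_trans p1) // perm_sym perm_rcons perm_cons perm_sym //.
have zt : 0%N \notin t by have := zf rho; rewrite E mem_rcons inE negb_or => /andP[].
have taup mu x r : x \in lowerings (parts mu) -> mkpart x.2 = tau -> perm_eq x.2 (x.1.-1 :: r) ->
    perm_eq [seq k <- x.1.-1 :: r | k != 0%N] [seq k <- s.-1 :: t | k != 0%N].
  move=> _ e p; apply: perm_trans (_ : perm_eq (parts tau) _).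
    by rewrite -e perm_sym (perm_trans (perm_mkpart _)) // perm_filter.
  by rewrite (perm_trans (perm_mkpart _)) // perm_filter // perm_rcons.
have nz (q : seq nat) : 0%N \notin q -> [seq k <- q | k != 0%N] = q.
  by move=> q0; apply/all_filterP/allP => k kq; apply: contraNneq q0 => <-.
have zr mu k r : perm_eq (parts mu) (k :: r) -> 0%N \notin r.
  by move=> p; have := zf mu; rewrite (perm_mem p) inE negb_or => /andP[].
(* Deletion of a part 1 determines the original partition, so for s = 1 only rho contributes. *)
have [s1|s1] := eqVneq s 1%N.
  apply: (key sel1 _ _ (A0 _ wtau)); rewrite /sel1 ?s1 // => mu x ne wmu xl xt.
  rewrite lt0b => /eqP x1; case/mem_lowerings: (xl) => r p1 p2; have := taup _ _ _ xl xt p2.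
  rewrite x1 s1 /= !nz // ?(zr _ _ _ p1) // => prt.
  by case/eqP: ne; apply: eq_rho prt; rewrite s1 -x1.
have s2 : (1 < s)%N by lia.
apply: (key sel2 _ _ (A1 _ wtau)); rewrite /sel2 ?s2 // => mu x ne wmu xl xt.
case: ifP => // x2 _; case/mem_lowerings: (xl) => r p1 p2; have := taup _ _ _ xl xt p2.
have zxr := zr _ _ _ p1; rewrite !nz ?inE ?negb_or ?zxr ?zt ?andbT; [|lia..] => prt.
(* Either the lowered part is s and mu is rho, or s - 1 is a part of mu and the induction
   applies. *)
have [xs|xs] := eqVneq x.1 s.
  by case/eqP: ne; apply: (eq_rho _ r); [rewrite -xs | move: prt; rewrite xs perm_cons].
apply: (IH s.-1 mu wmu); last by lia.
have : s.-1 \in x.1.-1 :: r by rewrite (perm_mem prt) inE eqxx.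
rewrite inE => /orP[/eqP|sr]; first by lia.
by rewrite (perm_mem p1) inE sr orbT.
Qed.

Lemma weight_eq0 kap : weight kap = 0%N -> kap = mkpart [::].
Proof.
move=> w0; have := size_le_weight kap; rewrite w0 leqn0 size_eq0 => /eqP k0.
by rewrite -[kap]mkpartK k0.
Qed.

Lemma sum_parts_le0 (g : intpart -> F) : \sum_(kap <- parts_le 0) g kap = g (mkpart [::]).
Proof.
have w0 : weight (mkpart [::]) = 0%N by rewrite weight_mkpart.
rewrite (bigD1_seq (mkpart [::])) ?parts_le_uniq ?mem_parts_le ?w0 //=.
rewrite big_seq_cond big1 ?addr0 // => kap /andP[].
by rewrite mem_parts_le leqn0 => /eqP /weight_eq0 ->; rewrite eqxx.
Qed.

Lemma sum_Jv_pw_comb n (t : intpart -> F) (r : seq intpart) : (n < N)%N ->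
  (forall kap, kap \in r -> weight kap = n) ->
  exists c, forall lam, (size lam < N)%N -> \sum_(kap <- r) t kap * Jv kap lam = pw_comb n c lam.
Proof.
move=> nN; elim: r => [|kap r IH] wr.
  by exists (fun=> 0) => lam _; rewrite big_nil /pw_comb big1 // => rho _; rewrite mul0r.
have [c cE] := IH (fun mu mr => wr mu (mem_behead (s := kap :: r) mr)).
have wk := wr kap (mem_head _ _).
have [c' c'E] : exists c, forall lam, (size lam < N)%N -> Jv kap lam = pw_comb (weight kap) c lam.
  by apply: Jv_pw_comb; rewrite wk.
exists (fun rho => t kap * c' rho + c rho) => lam sl.
rewrite big_cons cE // c'E // wk /pw_comb mulr_sumr -big_split.
by apply: eq_bigr => rho _ /=; rewrite mulrA mulrDl.
Qed.

Lemma raise_op_pw_comb n d c lam : (size lam < N)%N ->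
  raise_op n (pw_comb d c) lam = \sum_(rho <- parts_le d) c rho * raise_op n (pow_prod rho) lam.
Proof.
move=> sl; rewrite /raise_op; under [RHS]eq_bigr => rho _ do rewrite mulr_sumr.
rewrite exchange_big /=; apply: eq_bigr => i _; rewrite /pw_comb !mulr_sumr.
by apply: eq_bigr => rho _; ring.
Qed.

(** In the applications b is the mean of (z_i + 1)^n, which is 1 for n = 0 and 0 for n = 1;
    subtracting it removes the leading term. *)
Lemma filt_raise_op_pw_comb n (h : nat -> nat) (b : F) d c : (forall k, h k <= k)%N ->
  (forall s, filt any_coef 2 (sumn s) (fun lam => raise_op n (pow_prod s) lam - b * pow_prod s lam - der (symbol h) s lam)) ->
  filt any_coef 2 d (fun lam => raise_op n (pw_comb d c) lam - b * pw_comb d c lam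
                  - \sum_(rho <- parts_le d) c rho * der (symbol h) rho lam).
Proof.
move=> hk ff; pose G rho lam (y : F) := c rho *
  (raise_op n (pow_prod rho) lam - b * pow_prod rho lam - der (symbol h) rho lam).
apply: (@filt2_ext _ _ _ (fun lam y => \sum_(rho <- parts_le d) G rho lam y)); last first.
  move=> lam y sl; rewrite raise_op_pw_comb // /pw_comb mulr_sumr -!sumrB.
  by apply: eq_bigr => rho _; rewrite /G; ring.
apply: filt2_sum => // rho; rewrite mem_parts_le => wr _; apply: filt2_scale => //.
apply: filt2_le (ff rho); rewrite -/(weight rho); lia.
Qed.

Lemma filt_raise_op0_symbol s :
  filt any_coef 2 (sumn s) (fun lam => raise_op 0 (pow_prod s) lam - 1 * pow_prod s lam - der (symbol sel1) s lam).
Proof.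
apply: filt_ext (filt_raise_op0_pow_prod any_coef_ring s) _ => lam _.
by rewrite mul1r; congr (_ - _); apply: der_ext => k; rewrite symbol0E.
Qed.

Lemma filt_raise_op1_symbol s :
  filt any_coef 2 (sumn s) (fun lam => raise_op 1 (pow_prod s) lam - 0 * pow_prod s lam - der (symbol sel2) s lam).
Proof.
apply: filt_ext (filt_raise_op1_pow_prod any_coef_ring s) _ => lam _.
by rewrite mul0r subr0; congr (_ - _); apply: der_ext => k; rewrite symbol1E.
Qed.

Lemma filt_der_symbol h d c : (h 0 = 0)%N ->
  filt any_coef 1 d (fun lam => \sum_(rho <- parts_le d) c rho * der (symbol h) rho lam).
Proof.
move=> hz; apply: (filt2_sum (G := fun rho lam y => c rho * der (symbol h) rho lam)) => // rho.
rewrite mem_parts_le => wr _; apply: filt2_scale => //.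
have ft k : filt any_coef 1 k (symbol h k).
  case: k => [|k].
    by apply: filt2_ext (filt2_0 _ _ _) _ => lam y _; rewrite /symbol hz mulr0 mul0r.
  apply: filt2_scale => //; apply: filt2_le (filt_pow_prod any_coef_ring _).
  by rewrite -/(weight _) weight_mkpart /=; lia.
by apply: filt2_le (filt_der any_coef_ring rho ft); rewrite -/(weight rho); lia.
Qed.

(* By uniqueness of expansions in power sums, the leading coefficients of g are
   those of the symbol of raise_op n - b. *)
Lemma symbol_integral n (h : nat -> nat) (b : F) d c g : (0 < d < N)%N -> (h 0 = 0)%N ->
  (forall k, h k <= k)%N ->
  (forall s, filt any_coef 2 (sumn s) (fun lam => raise_op n (pow_prod s) lam - b * pow_prod s lam - der (symbol h) s lam)) ->
  filt A 0 d.-1 g ->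
  (forall lam, (size lam < N)%N -> g lam = raise_op n (pw_comb d c) lam - b * pw_comb d c lam) ->
  forall tau, weight tau = d.-1 ->
    A (\sum_(rho <- parts_le d) c rho * (lowering_coef h rho tau)%:R).
Proof.
move=> /andP[d0 dN] hz hk ff gA gE tau wtau.
have [r [_ r0 rE]] := filt_normal any_coef_ring (leqnn d) (filt_raise_op_pw_comb _ c hk ff).
have [q [qA _ qE]] := filt_normal A_ring (leq_pred d) gA.
pose s tau := al * \sum_(rho <- parts_le d) c rho * (lowering_coef h rho tau)%:R.
have := @pw_comb_eq0 d (fun tau => q tau - r tau - s tau) dN _ tau.
rewrite wtau leq_pred => E; have {E} : q tau - r tau - s tau = 0.
  apply: E => // lam wl; have sl := size_lt wl dN.
  rewrite -!pw_combB -qE // -rE // -(sum_der_pw_comb d c lam hz) gE //; ring.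
rewrite (r0 tau) ?subr0; last by rewrite wtau; lia.
move/eqP; rewrite subr_eq0 => /eqP E; have := qA tau; rewrite E => As.
rewrite -[X in A X](mulKf al_neq0); apply: A_mul => //; exact: A_alV.
Qed.

(** * Products of the operators E - j *)

Fixpoint degree_prod (k : nat) (f : intpart -> F) : intpart -> F :=
  if k is j.+1 then fun lam => degree_op (degree_prod j f) lam - j%:R * degree_prod j f lam else f.

Lemma degree_op_ext f g : (forall lam, (size lam < N)%N -> f lam = g lam) ->
  forall lam, (size lam < N)%N -> degree_op f lam = degree_op g lam.
Proof.
move=> E lam sl; rewrite /degree_op E //; congr (_ - _); apply: eq_bigr => i _.
have [rm|nrm] := boolP (removable lam i); last by rewrite wt0 // !mul0r.
by rewrite E // size_dec_lt.
Qed.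

Lemma degree_prod_ext k f g : (forall lam, (size lam < N)%N -> f lam = g lam) ->
  forall lam, (size lam < N)%N -> degree_prod k f lam = degree_prod k g lam.
Proof.
move=> E; elim: k => //= k IH lam sl; rewrite IH //; congr (_ - _).
exact: degree_op_ext.
Qed.

Lemma filt_degree_prod B c d k f : coef_ring B -> filt B c d f -> filt B c d (degree_prod k f).
Proof.
move=> BR ff; elim: k => //= k IH; apply: filt2_sub => //; first exact: filt_degree_op.
by apply: filt2_scale => //; exact: A_nat.
Qed.

Lemma degree_op_sum (I : eqType) (r : seq I) (b : I -> F) (f : I -> intpart -> F) lam :
  degree_op (fun lam => \sum_(j <- r) b j * f j lam) lam = \sum_(j <- r) b j * degree_op (f j) lam.
Proof.
rewrite /degree_op /lower_op; under [RHS]eq_bigr => j _ do rewrite mulrBr.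
rewrite sumrB mulr_sumr; congr (_ - _); first by apply: eq_bigr => j _; ring.
under [RHS]eq_bigr => j _ do rewrite mulr_sumr.
rewrite exchange_big /=; apply: eq_bigr => i _; rewrite !mulr_sumr.
by apply: eq_bigr => j _; ring.
Qed.

Lemma degree_prod_sum k (I : eqType) (r : seq I) (b : I -> F) (f : I -> intpart -> F) lam :
  (size lam < N)%N ->
  degree_prod k (fun lam => \sum_(j <- r) b j * f j lam) lam = \sum_(j <- r) b j * degree_prod k (f j) lam.
Proof.
elim: k lam => //= k IH lam sl; rewrite IH // (degree_op_ext IH) // degree_op_sum mulr_sumr -sumrB.
by apply: eq_bigr => j _; ring.
Qed.

Lemma degree_prod_add k f g lam : (size lam < N)%N ->
  degree_prod k (fun lam => f lam + g lam) lam = degree_prod k f lam + degree_prod k g lam.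
Proof.
move=> sl; pose ff (b : bool) := if b then f else g.
rewrite (degree_prod_ext _ (g := fun lam => \sum_(j <- [:: true; false]) 1 * ff j lam)) //.
  by rewrite degree_prod_sum // !big_cons big_nil !mul1r addr0.
by move=> mu _; rewrite !big_cons big_nil !mul1r addr0.
Qed.

(** E - j kills the values in weight j once those in smaller weights vanish. Nothing is required of
    f. *)
Lemma degree_prod_van k f lam : (size lam < N)%N -> (weight lam < k)%N -> degree_prod k f lam = 0.
Proof.
elim: k lam => // k IH lam sl; rewrite ltnS => le /=.
have W0 : lower_op 0 (degree_prod k f) lam = 0.
  rewrite /lower_op big1 // => i _; have [rm|nrm] := boolP (removable lam i); last by rewrite wt0 // mul0r.
  rewrite IH ?mulr0 ?size_dec_lt //.
  by rewrite (weight_dec (ltnW sl) (ltn_ord i) rm) in le.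
rewrite /degree_op W0 subr0 -mulrBl; have [lt|ge] := ltnP (weight lam) k.
  by rewrite IH // mulr0.
have -> : weight lam = k by apply/eqP; rewrite eqn_leq le.
by rewrite subrr mul0r.
Qed.

Lemma degree_prod_Jv k kap lam : (weight kap < N)%N -> (size lam < N)%N ->
  degree_prod k (Jv kap) lam = \prod_(j < k) ((weight kap)%:R - j%:R) * Jv kap lam.
Proof.
move=> kN; elim: k lam => [|k IH] lam sl; first by rewrite big_ord0 mul1r.
rewrite /= (degree_op_ext (g := fun lam => \sum_(x <- [:: tt])
   (\prod_(j < k) ((weight kap)%:R - j%:R)) * Jv kap lam)) //; last first.
  by move=> mu sm; rewrite big_seq1 IH.
rewrite (degree_op_sum [:: tt] (fun _ => \prod_(j < k) ((weight kap)%:R - j%:R))) big_seq1.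
by rewrite degree_op_Jv // IH // big_ord_recr /=; ring.
Qed.

Lemma prod_sub_fact n : \prod_(j < n) (n%:R - j%:R) = n`!%:R :> F.
Proof.
have E m : (m <= n)%N -> \prod_(j < m) (n%:R - j%:R) = (n ^_ m)%:R :> F.
  elim: m => [|m IH] lt; first by rewrite big_ord0.
  by rewrite big_ord_recr /= IH ?(ltnW lt) // ffactnSr natrM natrB // ltnW.
by rewrite E // ffactnn.
Qed.

(** * Measures on the partitions of n and duality *)

Definition parts_eq (n : nat) : seq intpart := [seq kap <- parts_le n | weight kap == n].

Lemma mem_parts_eq n kap : (kap \in parts_eq n) = (weight kap == n).
Proof. by rewrite mem_filter mem_parts_le andb_idr // => /eqP ->. Qed.

Lemma parts_eq_uniq n : uniq (parts_eq n).
Proof. by rewrite filter_uniq ?parts_le_uniq. Qed.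

Lemma sum_parts_eq_Jv n (t : intpart -> F) lam : (n < N)%N -> (weight lam <= n)%N ->
  \sum_(kap <- parts_eq n) t kap * Jv kap lam = if weight lam == n then t lam * jack_norm lam else 0.
Proof.
move=> nN le; case: eqP => [e|ne].
  rewrite (bigD1_seq lam) ?parts_eq_uniq ?mem_parts_eq ?e //= Jv_diag ?e // big_seq_cond big1 ?addr0 //.
  move=> kap /andP[]; rewrite mem_parts_eq => /eqP wk neq.
  by rewrite Jv_van ?mulr0 ?wk // 1?eq_sym // e.
rewrite big_seq big1 // => kap; rewrite mem_parts_eq => /eqP wk.
by rewrite Jv_van ?mulr0 ?wk //; apply/eqP => e; apply: ne; rewrite e.
Qed.

(* The transpose of lower_op n, acting on measures on partitions. *)
Definition lower_tr (n : nat) (t : intpart -> F) (m : nat) (lam : intpart) : F :=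
  \sum_(kap <- parts_eq m) t kap * \sum_(i < N | removable kap i && (dec N kap i == lam))
     wt kap i * (z kap i - al + 1) ^+ n.

Lemma lower_tr_pair n t m f : (m.+1 < N)%N ->
  \sum_(lam <- parts_eq m) lower_tr n t m.+1 lam * f lam = \sum_(kap <- parts_eq m.+1) t kap * lower_op n f kap.
Proof.
move=> mN; under eq_bigr => lam _ do rewrite /lower_tr mulr_suml.
rewrite exchange_big /= big_seq [RHS]big_seq; apply: eq_bigr => kap.
rewrite mem_parts_eq => /eqP wk; have sk : (size kap < N)%N by apply: (@size_lt _ m.+1); rewrite ?wk.
rewrite /lower_op; under eq_bigr => lam _ do rewrite -mulrA mulr_suml big_mkcond.
rewrite -mulr_sumr; congr (_ * _); rewrite exchange_big; apply: eq_bigr => i _ /=.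
have [rm|nrm] := boolP (removable kap i); last by rewrite wt0 // !mul0r big1.
rewrite (bigD1_seq (dec N kap i)) ?parts_eq_uniq //=; last first.
  by rewrite mem_parts_eq -eqSS -(weight_dec (ltnW sk) (ltn_ord i) rm) wk.
rewrite eqxx big1 ?addr0 1?mulrA // => lam.
by rewrite eq_sym => /negPf ->.
Qed.

(** At lam + e_i only the term of that partition survives, with its norm as value; [jack_norm_ratio]
    trades this norm for that of lam. *)
Lemma raise_op_parts_eq n t m lam : (m.+1 < N)%N -> weight lam = m ->
  raise_op n (fun lam => \sum_(kap <- parts_eq m.+1) t kap * Jv kap lam) lam = lower_tr n t m.+1 lam * jack_norm lam.
Proof.
move=> mN wl; have sl : (size lam < N)%N by apply: (@size_lt _ m); rewrite ?wl // ltnW.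
rewrite /lower_tr; under [X in _ = X * _]eq_bigr => kap _ do rewrite mulr_sumr big_mkcond.
rewrite exchange_big mulr_suml /=; apply: eq_bigr => i _.
have [ad|nad] := boolP (addable lam i); last first.
  rewrite ut0 // mul0r big_seq big1 ?mul0r // => kap; rewrite mem_parts_eq => /eqP wk.
  case: ifP => // /andP[rm /eqP e]; case/negP: nad.
  by rewrite -e addable_dec.
have wi : weight (inc N lam i) = m.+1 by rewrite weight_inc ?wl // ltnW.
rewrite sum_parts_eq_Jv ?wi // eqxx (bigD1_seq (inc N lam i)) ?parts_eq_uniq ?mem_parts_eq ?wi //=.
rewrite removable_inc // dec_inc // eqxx big_seq_cond big1 ?addr0; last first.
  move=> kap /andP[]; rewrite mem_parts_eq => /eqP wk ne; case: ifP => // /andP[rm /eqP e].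
  case/eqP: ne; rewrite -e inc_dec //; apply/ltnW/(@size_lt _ m.+1); rewrite ?wk //.
have r := jack_norm_ratio sl ad; rewrite z_inc // eqxx mulr1 addrK.
transitivity (t (inc N lam i) * (z lam i + 1) ^+ n * (ut lam i * jack_norm (inc N lam i))).
  by ring.
by rewrite r; ring.
Qed.

(* raise_op 0 - 1 and raise_op 1 send F, the sum of the t_kap J_kap, to sums of the
   same kind one degree lower, which are integral by induction. Their symbols then
   make the leading coefficients of F integral, and the product of the E - j for
   j <= m, E the degree operator, annihilates the other coefficients. *)
Theorem dual_integral n t : (n < N)%N ->
  (forall d f, filt A 0 d f -> A (\sum_(kap <- parts_eq n) t kap * f kap)) ->
  filt A 0 n (fun lam => \sum_(kap <- parts_eq n) t kap * Jv kap lam).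
Proof.
elim: n t => [|m IH] t nN tA.
  have parts_eq0 : parts_eq 0 = parts_le 0.
    apply/all_filterP/allP => kap; rewrite mem_parts_le leqn0; by [].
  have w0 : weight (mkpart [::]) = 0%N by rewrite weight_mkpart.
  have [c cE] : exists c, forall lam, (size lam < N)%N -> Jv (mkpart [::]) lam = pw_comb 0 c lam.
    by rewrite -[X in pw_comb X]w0; apply: Jv_pw_comb; rewrite w0.
  (* In degree 0 the function is constant, equal to the norm of the empty partition. *)
  have JE lam : (size lam < N)%N -> Jv (mkpart [::]) lam = 1.
    move=> sl; rewrite -jack_norm_nil -Jv_diag ?w0 // !cE ?size_mkpart // /pw_comb !sum_parts_le0.
    by rewrite /pow_prod /= !big_nil.
  have tA0 : A (t (mkpart [::])).
    by have := tA _ _ (filt2_const (A_1 A_ring)); rewrite parts_eq0 sum_parts_le0 mulr1.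
  apply: filt_ext (filt2_const tA0) _ => lam sl.
  by rewrite parts_eq0 sum_parts_le0 JE ?mulr1.
set Fn := fun lam => _.
have mN : (m < N)%N by exact: ltnW.
(* Pairing f with the transposed measure is pairing [lower_op j f] with t, and lowering preserves
   integrality. *)
have ttA j d f : filt A 0 d f -> A (\sum_(lam <- parts_eq m) lower_tr j t m.+1 lam * f lam).
  by move=> ff; rewrite lower_tr_pair //; exact: (tA _ _ (filt_lower_op A_ring j ff)).
pose G j lam := \sum_(kap <- parts_eq m) lower_tr j t m.+1 kap * Jv kap lam.
have GA j : filt A 0 m (G j) by apply: IH => // d f; exact: ttA.
have [c Fc] : exists c, forall lam, (size lam < N)%N -> Fn lam = pw_comb m.+1 c lam.
  by apply: sum_Jv_pw_comb => // kap; rewrite mem_parts_eq => /eqP.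
(* Both sides have degree at most m, so weights up to m decide. There [Fn] vanishes, and with it the
   term in b. *)
have GE j (h : nat -> nat) (b : F) : (h 0 = 0)%N -> (forall k, h k <= k)%N ->
  (forall s, filt any_coef 2 (sumn s) (fun lam => raise_op j (pow_prod s) lam - b * pow_prod s lam - der (symbol h) s lam)) ->
  forall lam, (size lam < N)%N -> G j lam = raise_op j (pw_comb m.+1 c) lam - b * pw_comb m.+1 c lam.
  move=> hz hk ff lam sl; apply/eqP; rewrite -subr_eq0; apply/eqP.
  pose D lam := G j lam - (raise_op j (pw_comb m.+1 c) lam - b * pw_comb m.+1 c lam).
  apply: (filt_uniq mN (f := D)) => //.
    apply: filt2_sub => //; first exact: filt_any (GA j).
    apply: (@filt2_le _ 1 m.+1); first by [].
    apply: filt2_ext (filt2_add (filt2_le _ (filt_raise_op_pw_comb m.+1 c hk ff)) (filt_der_symbol m.+1 c hz)) _ => //.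
    by move=> mu y _ /=; rewrite subrK.
  move=> mu wm; have sm := size_lt wm mN.
  have UE : raise_op j (pw_comb m.+1 c) mu = raise_op j Fn mu.
    apply: eq_bigr => i _; have [ad|nad] := boolP (addable mu i); last by rewrite ut0 // !mul0r.
    rewrite Fc //; apply: (@size_lt _ m.+1) => //.
    by rewrite (weight_inc (ltnW sm) (ltn_ord i) ad).
  rewrite /D UE -Fc // {1}/G sum_parts_eq_Jv // {2}/Fn sum_parts_eq_Jv //; last exact: leqW.
  have [e|ne] := eqVneq (weight mu) m.
    rewrite e (_ : m == m.+1 = false); last by lia.
    by rewrite mulr0 subr0 raise_op_parts_eq // subrr.
  rewrite (_ : weight mu == m.+1 = false); last by lia.
  rewrite mulr0 subr0 sub0r /raise_op big1 ?oppr0 // => i _.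
  have [ad|nad] := boolP (addable mu i); last by rewrite ut0 // mul0r.
  have wi := weight_inc (ltnW sm) (ltn_ord i) ad.
  rewrite /Fn sum_parts_eq_Jv // wi; last by lia.
  by rewrite eqSS (negPf ne) !mulr0.
have cA rho : weight rho = m.+1 -> A (c rho).
  apply: (@top_coef_integral m.+1) => //.
    apply: (@symbol_integral 0 sel1 1 m.+1 c (G 0%N)) => //.
    - by move=> [|[|k]].
    - exact: filt_raise_op0_symbol.
    - apply: (GE 0%N sel1) => //; [by move=> [|[|k]] | exact: filt_raise_op0_symbol].
  have hk k : (sel2 k <= k)%N by rewrite /sel2; case: ifP.
  apply: (@symbol_integral 1 sel2 0 m.+1 c (G 1%N)) => //.
  - exact: filt_raise_op1_symbol.
  - apply: (GE 1%N sel2) => //; exact: filt_raise_op1_symbol.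
pose cR rho := if weight rho == m.+1 then c rho else 0.
pose c' rho := if (weight rho <= m)%N then c rho else 0.
have fR : filt A 0 m.+1 (pw_comb m.+1 cR).
  apply: filt_pw_comb => // rho _; rewrite /cR; case: eqP => [/cA //|_]; exact: A_0.
have f' : filt any_coef 0 m (pw_comb m.+1 c').
  apply: filt_ext (filt_pw_comb (d := m) (c := c') any_coef_ring _) _ => // lam _.
  by apply: pw_comb_widen => // rho; rewrite /c' ltnNge => /negPf ->.
have FE lam : (size lam < N)%N -> Fn lam = pw_comb m.+1 cR lam + pw_comb m.+1 c' lam.
  move=> sl; rewrite Fc // /pw_comb -big_split; apply: eq_big_seq => rho /=.
  rewrite mem_parts_le leq_eqVlt ltnS /cR /c'.
  by case: eqP => [->|_ /= ->]; rewrite ?ltnn mul0r ?addr0 ?add0r.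
apply: (@filt2_ext _ _ _ (fun lam _ => (m.+1)`!%:R^-1 * degree_prod m.+1 (pw_comb m.+1 cR) lam)).
  apply: filt2_scale => //; first exact: A_natV.
  exact: filt_degree_prod.
move=> lam _ sl; apply: (mulfI (natr_neq0 (fact_gt0 m.+1))).
rewrite mulVKf ?natr_neq0 ?fact_gt0 //.
have E0 : degree_prod m.+1 (pw_comb m.+1 c') lam = 0.
  apply: (filt_uniq mN (f := degree_prod m.+1 (pw_comb m.+1 c'))) => //; first exact: filt_degree_prod.
  by move=> mu wm; apply: degree_prod_van => //; exact: size_lt wm mN.
have : degree_prod m.+1 Fn lam = degree_prod m.+1 (pw_comb m.+1 cR) lam.
  by rewrite (degree_prod_ext m.+1 FE) // degree_prod_add // E0 addr0.
move=> <-; rewrite /Fn degree_prod_sum // mulr_sumr big_seq [RHS]big_seq; apply: eq_bigr => kap.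
rewrite mem_parts_eq => /eqP wk; rewrite degree_prod_Jv ?wk // prod_sub_fact; ring.
Qed.

(* The product of the E - j for j < n, E the degree operator, kills J_kap if
   |kap| < n and multiplies it by n! if |kap| = n. *)
Theorem coef_extract D b f lam : (D < N)%N -> (weight lam <= D)%N ->
  (forall mu, (size mu < N)%N -> f mu = \sum_(kap <- parts_le D) b kap * Jv kap mu) ->
  b lam * jack_norm lam = (weight lam)`!%:R^-1 * degree_prod (weight lam) f lam.
Proof.
move=> DN wl fE; have sl := size_lt wl DN.
rewrite (degree_prod_ext _ fE) // degree_prod_sum // (bigD1_seq lam) ?mem_parts_le ?parts_le_uniq //=.
rewrite degree_prod_Jv ?(leq_ltn_trans wl) // prod_sub_fact Jv_diag ?(leq_ltn_trans wl) //.
rewrite big_seq_cond big1 ?addr0.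
  by rewrite [RHS]mulrCA mulKf ?natr_neq0 ?fact_gt0.
move=> kap /andP[]; rewrite mem_parts_le => wk ne.
have kN := leq_ltn_trans wk DN; rewrite degree_prod_Jv //.
(* A lighter kap is killed by the factor with j = |kap|; the others vanish at lam. *)
have [lt|le] := ltnP (weight kap) (weight lam).
  by rewrite (bigD1 (Ordinal lt)) //= subrr !mul0r mulr0.
by rewrite Jv_van ?mulr0 // eq_sym.
Qed.

(** * Congruences at a pivot *)

Lemma A_z lam i : A (z lam i).
Proof.
by apply: A_sub => //; [apply: A_mul => //; [exact: A_al|exact: A_nat] | exact: A_nat].
Qed.

Lemma A_pow_sum k lam : A (pow_sum k lam).
Proof. by apply: A_sum => // i _ _; apply: A_exp => //; exact: A_z. Qed.

Lemma A_pow_prod s lam : A (pow_prod s lam).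
Proof. by apply: A_prod => // k _; exact: A_pow_sum. Qed.

Lemma filt_val c d f lam : filt A c d f -> (size lam < N)%N -> A (f lam).
Proof.
move=> [l lP E] sl; rewrite (E _ 0) //; apply: A_sum => // x /lP [Ax _] _.
by apply: A_mul => //; [apply: A_mul => //; exact: A_pow_prod | apply: A_exp => //; exact: A_0].
Qed.

Lemma A_move_hook i k sig : A (move_hook i k sig).
Proof.
apply: A_add => //; last by apply: A_sub => //; exact: A_nat.
apply: A_mul => //; first exact: A_al.
by apply: A_sub => //; [apply: A_sub => //; exact: A_nat | exact: A_1].
Qed.

Section Pivots.
Variables (i k : nat) (sig tau : intpart).
Hypotheses (mv : box_move i k sig tau) (ss : (size sig < N)%N) (st : (size tau < N)%N).
Let h := move_hook i k sig.
Let Ah : A h. Proof. exact: A_move_hook. Qed.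

Lemma pow_prod_pivot s : exists2 q, A q & pow_prod s sig - pow_prod s tau = h * q.
Proof.
elim: s => [|e s [q Aq E]].
  by exists 0; [exact: A_0 | rewrite /pow_prod !big_nil subrr mulr0].
have [q1 Aq1 E1] := pow_diff_div e A_ring Ah (A_z tau k.-1).
have [q2 Aq2 E2] := pow_diff_div e A_ring Ah (A_z sig k.-1).
exists (pow_sum e sig * q + (q1 - q2) * pow_prod s tau).
  apply: A_add => //; apply: A_mul => //; [exact: A_pow_sum | exact: A_sub | exact: A_pow_prod].
have Ep : pow_sum e sig = pow_sum e tau + h * (q1 - q2).
  by rewrite (pow_sum_box_move mv (ltnW ss) (ltnW st) e) E1 E2 mulrBr.
rewrite !pow_prod_cons mulrDr mulrCA -E.
by rewrite Ep; ring.
Qed.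

Lemma filt_pivot c d f : filt A c d f -> exists2 q, A q & f sig - f tau = h * q.
Proof.
move=> [l lP E]; rewrite !(E _ 0) // -sumrB big_seq.
apply: (big_ind (fun v => exists2 q, A q & v = h * q)).
- by exists 0; [exact: A_0 | rewrite mulr0].
- by move=> _ _ [q Aq ->] [q' Aq' ->]; exists (q + q'); [exact: A_add | rewrite mulrDr].
move=> x /lP [Ax _]; have [q Aq Eq] := pow_prod_pivot x.1.2.
exists (x.1.1 * q * 0 ^+ x.2).
  by apply: A_mul => //; [exact: A_mul | apply: A_exp => //; exact: A_0].
by rewrite -mulrBl -mulrBr Eq; ring.
Qed.

Lemma Jv_pivot : (weight sig < N)%N ->
  exists2 G, filt A 0 (weight sig) G &
    forall lam, (size lam < N)%N -> Jv sig lam - Jv tau lam = h * G lam.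
Proof.
move=> wN; have ws := box_move_weight mv (ltnW ss) (ltnW st).
have hn0 : h != 0 := move_hook_neq0 mv (ltnW ss) (ltnW st).
pose t kap := ((kap == sig)%:R - (kap == tau)%:R) / h.
have tE g : \sum_(kap <- parts_eq (weight sig)) t kap * g kap = (g sig - g tau) / h.
  have del mu : weight mu = weight sig ->
      \sum_(kap <- parts_eq (weight sig)) (kap == mu)%:R * g kap = g mu.
    move=> wm; rewrite (bigD1_seq mu) ?parts_eq_uniq ?mem_parts_eq ?wm //= eqxx mul1r.
    by rewrite big1 ?addr0 // => kap /negPf ->; rewrite mul0r.
  rewrite mulrBl -{1}(del sig) // -(del tau) // !mulr_suml -sumrB.
  by apply: eq_bigr => kap _; rewrite /t; ring.
exists (fun lam => \sum_(kap <- parts_eq (weight sig)) t kap * Jv kap lam).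
  apply: dual_integral => // d f ff; rewrite tE.
  by have [q Aq ->] := filt_pivot ff; rewrite mulrAC divff // mul1r.
by move=> lam _; rewrite (tE (fun mu => Jv mu lam)) mulrCA divff // mulr1.
Qed.
End Pivots.

Lemma Jv_integral kap : (weight kap < N)%N -> filt A 0 (weight kap) (Jv kap).
Proof.
move=> wN; have tE (g : intpart -> F) : \sum_(mu <- parts_eq (weight kap)) (mu == kap)%:R * g mu = g kap.
  rewrite (bigD1_seq kap) ?parts_eq_uniq ?mem_parts_eq //= eqxx mul1r.
  by rewrite big1 ?addr0 // => mu /negPf ->; rewrite mul0r.
apply: (@filt_ext _ _ _ (fun lam => \sum_(mu <- parts_eq (weight kap)) (mu == kap)%:R * Jv mu lam)).
  apply: dual_integral => // d f ff.
  by rewrite tE; apply: filt_val ff _; apply: size_lt (leqnn _) wN.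
by move=> lam _; rewrite (tE (fun mu => Jv mu lam)).
Qed.

Lemma A_factV n : A n`!%:R^-1.
Proof. exact: A_natV. Qed.

(** Both partitions have the same size, so the two coefficients are values of one integral
    function. *)
Lemma coef_pivot_top D b f d i k sig tau : (D < N)%N -> (weight sig <= D)%N ->
  box_move i k sig tau -> (size tau < N)%N ->
  (forall mu, (size mu < N)%N -> f mu = \sum_(kap <- parts_le D) b kap * Jv kap mu) ->
  filt A 0 d f ->
  exists2 q, A q & b sig * jack_norm sig - b tau * jack_norm tau = move_hook i k sig * q.
Proof.
move=> DN ws mv st fE ff; have ss := size_lt ws DN.
have wst := box_move_weight mv (ltnW ss) (ltnW st).
rewrite (coef_extract DN ws fE) (coef_extract DN _ fE) -?wst // -mulrBr.
have [q Aq ->] := filt_pivot mv ss st (filt_degree_prod (weight sig) A_ring ff).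
by exists ((weight sig)`!%:R^-1 * q); [apply: A_mul => //; exact: A_factV | rewrite mulrCA].
Qed.

(** Extraction is linear, so the factor h passes from the functions to their coefficients. *)
Lemma coef_pivot_low D b b' f f' g h d lam : (D < N)%N -> (weight lam <= D)%N ->
  (forall mu, (size mu < N)%N -> f mu = \sum_(kap <- parts_le D) b kap * Jv kap mu) ->
  (forall mu, (size mu < N)%N -> f' mu = \sum_(kap <- parts_le D) b' kap * Jv kap mu) ->
  filt A 0 d g -> (forall mu, (size mu < N)%N -> f mu - f' mu = h * g mu) ->
  exists2 q, A q & b lam * jack_norm lam - b' lam * jack_norm lam = h * q.
Proof.
move=> DN wl fE f'E gA E; have sl := size_lt wl DN.
rewrite (coef_extract DN wl fE) (coef_extract DN wl f'E) -mulrBr.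
have -> : degree_prod (weight lam) f lam - degree_prod (weight lam) f' lam = h * degree_prod (weight lam) g lam.
  rewrite (degree_prod_ext (weight lam) (g := fun mu => f' mu + h * g mu)) //; last first.
    by move=> mu sm; rewrite -E // addrC subrK.
  rewrite degree_prod_add // addrAC subrr add0r.
  rewrite (degree_prod_ext (weight lam) (g := fun mu => \sum_(j <- [:: tt]) h * g mu)).
  - by rewrite (degree_prod_sum (weight lam) [:: tt] (fun=> h) (fun=> g)) // big_seq1.
  - by move=> mu _; rewrite big_seq1.
  - by [].
exists ((weight lam)`!%:R^-1 * degree_prod (weight lam) g lam); last by rewrite mulrCA.
apply: A_mul => //; first exact: A_factV.
exact: filt_val (filt_degree_prod _ A_ring gA) sl.
Qed.

End Integrality.
End Jack.

End Shifted.

(** * Laurent polynomials and shifted Jack functions *)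

Implicit Types (nu kap sig tau rho : intpart).

Lemma alpha_free (a b : int) : alpha * a%:~R + b%:~R = 0 -> a = 0 /\ b = 0.
Proof.
rewrite /alpha -!(rmorph_int (@tofrac {poly rat})) -rmorphM -rmorphD /= => /eqP.
rewrite tofrac_eq0 => /eqP E.
have := congr1 (fun p : {poly rat} => p`_0) E; have := congr1 (fun p : {poly rat} => p`_1) E.
rewrite !coefD !coefXM /= !coef0 -!polyCMz !coefC /= addr0 add0r.
by move=> /eqP; rewrite intr_eq0 => /eqP -> /eqP; rewrite intr_eq0 => /eqP ->.
Qed.

Lemma laurent_ring : coef_ring alpha laurent.
Proof.
have a0 : alpha != 0 := al_neq0 alpha_free.
split.
- move=> x y [p [m ->]] [q [n ->]]; exists (p * 'X^n + q * 'X^m), (m + n)%N.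
  rewrite rmorphD !rmorphM !rmorphXn /= -/alpha exprD.
  by rewrite addf_div ?expf_neq0.
- move=> x y [p [m ->]] [q [n ->]]; exists (p * q), (m + n)%N.
  by rewrite rmorphM /= exprD invfM mulrACA.
- by exists 'X, 0%N; rewrite expr0 divr1.
- by exists 1, 1%N; rewrite rmorph1 expr1 div1r.
- split; first by exists (-1), 0%N; rewrite rmorphN1 expr0 divr1.
  move=> k; exists (k.+1%:R^-1)%:P, 0%N; rewrite expr0 divr1.
  have k0 : k.+1%:R != 0 :> Qalpha := natr_neq0 alpha_free (ltn0Sn k).
  apply: (mulfI k0); rewrite divff // -[k.+1%:R](rmorph_nat (@tofrac {poly rat})) -rmorphM /=.
  rewrite -[k.+1%:R](rmorph_nat (@polyC rat)) -rmorphM /= divff ?rmorph1 //.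
  by rewrite Num.Theory.pnatr_eq0.
Qed.

(** * Degrees under affine substitutions *)

Lemma msizeM_bound n (R : idomainType) (p q : {mpoly R[n]}) a b :
  (msize p <= a.+1)%N -> (msize q <= b.+1)%N -> (msize (p * q) <= (a + b).+1)%N.
Proof.
move=> pa qb; have [->|p0] := eqVneq p 0; first by rewrite mul0r msize0.
have [->|q0] := eqVneq q 0; first by rewrite mulr0 msize0.
rewrite msizeM //; lia.
Qed.

Lemma msize_comp_affine n m (R : idomainType) (p : {mpoly R[n]})
    (lq : n.-tuple {mpoly R[m]}) :
  (forall i, msize (tnth lq i) <= 2)%N -> (msize (p \mPo lq) <= msize p)%N.
Proof.
move=> lq2; rewrite comp_mpolyEX.
have prodb k (I : Type) (r : seq I) (f : I -> {mpoly R[m]}) (e : I -> nat) :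
    (forall i, msize (f i) <= k.+1)%N ->
    (msize (\prod_(i <- r) f i ^+ e i) <= (\sum_(i <- r) e i * k).+1)%N.
  move=> fk; elim: r => [|i r IH]; first by rewrite !big_nil msize1.
  rewrite !big_cons; apply: msizeM_bound => //.
  elim: (e i) => [|u IHu]; first by rewrite expr0 msize1.
  by rewrite exprS mulSn; apply: msizeM_bound.
apply: leq_trans (mmeasure_sum _ _ _ _) _; apply/bigmax_leqP_seq => mm mp _.
rewrite (leq_trans (msizeZ_le _ _)) // comp_mpolyX.
apply: leq_trans (prodb 1%N _ _ _ _ lq2) _.
apply: leq_trans (msize_mdeg_lt mp); rewrite ltnS mdegE.
by apply: leq_sum => i _; rewrite muln1.
Qed.

Lemma msize_affine n (R : idomainType) (i : 'I_n) (a b : R) :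
  (msize (a *: 'X_i + b%:MP : {mpoly R[n]}) <= 2)%N.
Proof.
rewrite (leq_trans (mmeasureD_le _ _ _)) // geq_max (leq_trans (msizeZ_le _ _)) ?msizeX ?mdeg1 //=.
by rewrite mmeasureC; case: (_ != 0).
Qed.

Lemma comp_mpolyA n m k (R : comNzRingType) (p : {mpoly R[n]})
    (s : n.-tuple {mpoly R[m]}) (t : m.-tuple {mpoly R[k]}) :
  (p \mPo s) \mPo t = p \mPo [tuple tnth s i \mPo t | i < n].
Proof.
rewrite (comp_mpolyEX p s) (comp_mpolyEX p) raddf_sum /=; apply: eq_bigr => mm _.
rewrite linearZ /= !comp_mpolyX rmorph_prod /=; congr (_ *: _); apply: eq_bigr => i _.
by rewrite rmorphXn /= tnth_mktuple.
Qed.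

Section AffineSubstitution.
Variables (F : fieldType) (n : nat) (a : F) (k : 'I_n -> nat).

Definition affine_vars : n.-tuple {mpoly F[n]} := [tuple a *: 'X_i - (k i)%:R | i < n].

Lemma meval_affine_vars (g : {mpoly F[n]}) v :
  (g \mPo affine_vars).@[v] = g.@[fun i => a * v i - (k i)%:R].
Proof.
rewrite comp_mpoly_meval; apply: meval_eq => i.
by rewrite tnth_mktuple mevalB mevalZ mevalXU -mpolyC_nat mevalC.
Qed.

(** The inverse substitution is affine too and does not raise degrees. This turns the degree bound
    in the x_i into one in the shifted variables. *)
Lemma msize_affine_vars (g : {mpoly F[n]}) : a != 0 ->
  (msize g <= msize (g \mPo affine_vars))%N.
Proof.
move=> a0; pose inv : n.-tuple {mpoly F[n]} :=
  [tuple a^-1 *: 'X_i + (a^-1 * (k i)%:R)%:MP | i < n].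
have {1}-> : g = (g \mPo affine_vars) \mPo inv.
  rewrite comp_mpolyA -[LHS]comp_mpoly_id; congr (_ \mPo _); apply: eq_mktuple => i.
  rewrite tnth_mktuple comp_mpolyB comp_mpolyZ comp_mpolyXU -tnth_nth tnth_mktuple.
  rewrite -mpolyC_nat comp_mpolyC scalerDr scalerA divff // scale1r.
  by rewrite -mul_mpolyC -mpolyCM mulrA divff // mul1r addrK.
apply: msize_comp_affine => i.
by rewrite tnth_mktuple; exact: msize_affine.
Qed.

End AffineSubstitution.

Lemma filt_shifted_eval M (f : poly_family) d : shifted_symmetric f -> degree_le f d ->
  filt alpha M (@any_coef Qalpha) 0 d (shifted_eval f).
Proof.
move=> [_ /(_ M) [g gsym fE] fst] /(_ M) fd; have a0 : alpha != 0 := al_neq0 alpha_free.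
have {}fE : f M = g \mPo affine_vars alpha (fun i : 'I_M.+1 => i.+1) by exact: fE.
have gd : (msize g <= d.+1)%N.
  by rewrite fE in fd; apply: leq_trans fd; exact: msize_affine_vars a0.
apply: filt_ext (filt_symmetric alpha_free gsym gd) _ => lam sl.
rewrite -(shifted_evalE fst (ltnW sl)) /eval_at fE meval_affine_vars.
exact: meval_eq.
Qed.

Lemma prod_rows_le (lam : intpart) N (g : nat -> nat -> Qalpha) : (size lam <= N)%N ->
  \prod_(1 <= i < (size lam).+1) \prod_(1 <= j < (part lam i).+1) g i j =
  \prod_(r < N) \prod_(0 <= j < part lam r.+1) g r.+1 j.+1.
Proof.
move=> sN; rewrite big_add1 /= (big_nat_widen _ _ N) // big_mkord big_mkcond /=.
apply: eq_bigr => i _; case: ltnP => [_|le]; first by rewrite big_add1.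
by rewrite /part nth_default // big_geq.
Qed.

Lemma jack_norm_hooks M (lam : intpart) : (size lam <= M.+1)%N ->
  jack_norm alpha M lam = alpha ^- weight lam * Hprod lam * Hprod' lam.
Proof.
move=> sN; rewrite /jack_norm -mulrA; congr (_ * (_ * _)).
- rewrite /Hprod (prod_rows_le _ sN); apply: eq_bigr => r _; apply: eq_bigr => j _.
  by rewrite /box_hook /hook /arm /leg /= addn0 natrD addrA.
- rewrite /Hprod' (prod_rows_le _ sN); apply: eq_bigr => r _; apply: eq_bigr => j _.
  by rewrite /box_hook /hook' /arm /leg /= addn0 natrD.
Qed.

Lemma filt_jack M J : (forall mu, is_shifted_jack mu (J mu)) ->
  forall kap, (weight kap < M.+1)%N ->
    filt alpha M (@any_coef Qalpha) 0 (weight kap) (shifted_eval (J kap)).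
Proof. by move=> hJ kap _; have [ss dg _ _] := hJ kap; exact: filt_shifted_eval. Qed.

Lemma jack_diag M J : (forall mu, is_shifted_jack mu (J mu)) ->
  forall kap, (weight kap < M.+1)%N -> shifted_eval (J kap) kap = jack_norm alpha M kap.
Proof.
move=> hJ kap wk; have [_ _ -> _] := hJ kap; rewrite jack_norm_hooks //.
by apply: leq_trans (size_le_weight _) (ltnW wk).
Qed.

Lemma jack_vanish M J : (forall mu, is_shifted_jack mu (J mu)) ->
  forall kap lam, (weight kap < M.+1)%N -> lam != kap ->
    (weight lam <= weight kap)%N -> shifted_eval (J kap) lam = 0.
Proof. by move=> hJ kap lam _; have [_ _ _] := hJ kap; apply. Qed.

Lemma jack_product M J d mu nu lam : (forall mu, is_shifted_jack mu (J mu)) -> is_jack_LR J d ->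
  (size lam < M.+1)%N ->
  shifted_eval (J mu) lam * shifted_eval (J nu) lam =
  \sum_(kap <- parts_le (weight mu + weight nu)) d mu nu kap * shifted_eval (J kap) lam.
Proof.
move=> hJ hd sl; have st kap : stable (J kap) by have [[]] := hJ kap.
have E kap : shifted_eval (J kap) lam = eval_at (J kap) M lam.
  by rewrite shifted_evalE // ltnW.
have [/(_ M) H _] := hd mu nu; rewrite !E /eval_at -mevalM H raddf_sum /=.
by apply: eq_bigr => kap _; rewrite mevalZ E.
Qed.

(** Up to a power of alpha, a unit of R, g is the coefficient times norm that the operators
    extract. *)
Lemma jack_gE M d mu nu lam : (size lam <= M.+1)%N ->
  jack_g d mu nu lam = alpha ^+ weight lam * (d mu nu lam * jack_norm alpha M lam).
Proof.
move=> sl; have a0 : alpha ^+ weight lam != 0 by rewrite expf_neq0 ?(al_neq0 alpha_free).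
rewrite /jack_g jack_norm_hooks // -[_ * Hprod _ * _]mulrA.
by rewrite [RHS]mulrCA (mulVKf a0) [RHS]mulrC.
Qed.

Lemma jack_g_eq0 J d mu nu lam : is_jack_LR J d ->
  (weight mu + weight nu < weight lam)%N -> jack_g d mu nu lam = 0.
Proof. by move=> hd lt; have [_ H] := hd mu nu; rewrite /jack_g H // mulr0. Qed.

Lemma laurent_alphaM n x : laurent x -> laurent (alpha ^+ n * x).
Proof.
by have AR := laurent_ring; move=> lx; apply: (A_mul AR) => //; apply: (A_exp AR); apply: (A_al AR).
Qed.

(** * The congruences for the structure coefficients *)

Section StructureCoefficients.
Variables (J : intpart -> poly_family) (d : intpart -> intpart -> intpart -> Qalpha).
Hypotheses (hJ : forall mu, is_shifted_jack mu (J mu)) (hd : is_jack_LR J d).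

Lemma jack_integral M kap : (weight kap < M.+1)%N ->
  filt alpha M laurent 0 (weight kap) (shifted_eval (J kap)).
Proof.
exact: (Jv_integral alpha_free (filt_jack hJ) (jack_diag hJ) (jack_vanish hJ) laurent_ring).
Qed.

Lemma jack_g_pivot_top i k mu nu sig tau : box_move i k sig tau ->
  exists2 q, laurent q &
    jack_g d mu nu sig - jack_g d mu nu tau = move_hook alpha i k sig * q.
Proof.
(* Any number of variables exceeding all the sizes and lengths involved would do. *)
move=> mv; pose M := (weight mu + weight nu + size sig + size tau)%N.
have ss : (size sig < M.+1)%N by rewrite /M; lia.
have st : (size tau < M.+1)%N by rewrite /M; lia.
have wst := box_move_weight mv (ltnW ss) (ltnW st).
have [ws|ws] := leqP (weight sig) (weight mu + weight nu); last first.
  exists 0; first exact: A_0 laurent_ring.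
  by rewrite !(jack_g_eq0 hd) ?subrr ?mulr0 // -wst.
have wmu : (weight mu < M.+1)%N by rewrite /M; lia.
have wnu : (weight nu < M.+1)%N by rewrite /M; lia.
have DM : (weight mu + weight nu < M.+1)%N by rewrite /M; lia.
have ff := filt2_mul laurent_ring (jack_integral wmu) (jack_integral wnu).
have [q lq E] := coef_pivot_top alpha_free (filt_jack hJ) (jack_diag hJ) (jack_vanish hJ)
  laurent_ring DM ws mv st (fun lam sl => jack_product mu nu hJ hd sl) ff.
exists (alpha ^+ weight sig * q); first exact: laurent_alphaM.
by rewrite !(jack_gE (M := M)) ?(ltnW ss) ?(ltnW st) // -wst -mulrBr E mulrCA.
Qed.

Lemma jack_g_pivot_low mu nu mu' nu' lam M h g e :
  (weight mu + weight nu < M.+1)%N -> (size lam < M.+1)%N ->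
  (weight mu' + weight nu' = weight mu + weight nu)%N ->
  filt alpha M laurent 0 e g ->
  (forall kap, (size kap < M.+1)%N ->
     shifted_eval (J mu) kap * shifted_eval (J nu) kap -
     shifted_eval (J mu') kap * shifted_eval (J nu') kap = h * g kap) ->
  exists2 q, laurent q & jack_g d mu nu lam - jack_g d mu' nu' lam = h * q.
Proof.
move=> DM sl wE gL E.
have [wl|wl] := leqP (weight lam) (weight mu + weight nu); last first.
  exists 0; first exact: A_0 laurent_ring.
  by rewrite !(jack_g_eq0 hd) ?subrr ?mulr0 ?wE.
have P' kap : (size kap < M.+1)%N -> shifted_eval (J mu') kap * shifted_eval (J nu') kap =
    \sum_(rho <- parts_le (weight mu + weight nu)) d mu' nu' rho * shifted_eval (J rho) kap.
  by move=> sk; rewrite -wE (jack_product _ _ hJ hd sk).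
have [q lq Eq] := coef_pivot_low alpha_free (filt_jack hJ) (jack_diag hJ) (jack_vanish hJ)
  laurent_ring DM wl (fun kap sk => jack_product mu nu hJ hd sk) P' gL E.
exists (alpha ^+ weight lam * q); first exact: laurent_alphaM.
by rewrite !(jack_gE (M := M)) ?(ltnW sl) // -mulrBr Eq mulrCA.
Qed.

Lemma jack_g_pivot_factor i k sig tau nu lam : box_move i k sig tau ->
  (exists2 q, laurent q &
    jack_g d sig nu lam - jack_g d tau nu lam = move_hook alpha i k sig * q) /\
  (exists2 q, laurent q &
    jack_g d nu sig lam - jack_g d nu tau lam = move_hook alpha i k sig * q).
Proof.
move=> mv; pose M := (weight sig + weight nu + size sig + size tau + size lam)%N.
have ss : (size sig < M.+1)%N by rewrite /M; lia.
have st : (size tau < M.+1)%N by rewrite /M; lia.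
have sl : (size lam < M.+1)%N by rewrite /M; lia.
have wst := box_move_weight mv (ltnW ss) (ltnW st).
have wsig : (weight sig < M.+1)%N by rewrite /M; lia.
have wnu : (weight nu < M.+1)%N by rewrite /M; lia.
have [G GL GE] := Jv_pivot alpha_free (filt_jack hJ) (jack_diag hJ) (jack_vanish hJ)
  laurent_ring mv ss st wsig.
have gL := filt2_mul laurent_ring GL (jack_integral wnu).
split; apply: (jack_g_pivot_low (M := M) _ sl _ gL).
- by rewrite /M; lia.
- by rewrite wst.
- by move=> kap sk; rewrite -mulrBl GE // mulrA.
- by rewrite /M; lia.
- by rewrite wst.
- by move=> kap sk; rewrite -mulrBr GE // mulrCA [_ * G _]mulrC.
Qed.

End StructureCoefficients.

Theorem theorem1
    (J : intpart -> poly_family)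
    (hJ : forall mu : intpart, is_shifted_jack mu (J mu))
    (d : intpart -> intpart -> intpart -> Qalpha)
    (hd : is_jack_LR J d)
    (p : nat * nat) (h : Qalpha)
    (mu nu lam mu' nu' lam' : intpart)
    (hpivot : pivot_triple p h (mu, nu, lam) (mu', nu', lam')) :
  exists2 q : Qalpha, laurent q &
    jack_g d mu nu lam - jack_g d mu' nu' lam' = h * q.
Proof.
have hookE i k sig tau : box_move i k sig tau ->
    hook sig (i, (part sig k).+1) = move_hook alpha i k sig.
  by move=> mv; have [-> _] := pivot_hookE mv.
case: hpivot => -[].
- move=> [i [k [mv -> ->]]] -> ->; rewrite (hookE _ _ _ _ mv).
  by have [] := jack_g_pivot_factor hJ hd nu' lam' mv.
- move=> -> [i [k [mv -> ->]]] ->; rewrite (hookE _ _ _ _ mv).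
  by have [] := jack_g_pivot_factor hJ hd mu' lam' mv.
- move=> -> -> [i [k [mv -> ->]]]; rewrite (hookE _ _ _ _ mv).
  exact: jack_g_pivot_top.
Qed.
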